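(* Let $A$ be a linear operator on a $2$-dimensional complex Hilbert space with eigenvalues $\lambda_1,\lambda_2$ (with multiplicity), and let $\Lambda_1=\iota^{[2]}(\lambda_1)$, $\Lambda_2=\iota^{[2]}(\lambda_2)$ be its $h$-eigenpoints. (a) If $A$ has no real eigenvalue, then $\mathrm{DW}^{\mathbb R}(A)$ is a possibly degenerate synthetic $h$-elliptical disk with foci $\Lambda_1,\Lambda_2$: there is $m^+\ge\mathrm d(\Lambda_1,\Lambda_2)$ such that $\mathrm{DW}^{\mathbb R}(A)=\{\boldsymbol x\text{ ordinary}:\mathrm d(\Lambda_1,\boldsymbol x)+\mathrm d(\Lambda_2,\boldsymbol x)\le m^+\}$. If $\lambda_1$ is non-real and $\lambda_2$ is real, then $\mathrm{DW}^{\mathbb R}(A)$ is a possibly degenerate synthetic $h$-elliptic parabolic disk with focus $\Lambda_1$ and asymptotic point $\Lambda_2$: there is an $h$-horocycle $C$ with asymptotic point $\Lambda_2$ and $\mathrm d_C(\Lambda_1)\le0$ such that the set of ordinary points of $\mathrm{DW}^{\mathbb R}(A)$ is $\{\boldsymbol x\text{ ordinary}:\mathrm d(\Lambda_1,\boldsymbol x)+\mathrm d_C(\boldsymbol x)\le 0\}$. If the asymptotic points of the range are also counted as foci, then in all cases (including that of two real eigenvalues) the foci of $\mathrm{DW}^{\mathbb R}(A)$ are the $h$-eigenpoints of $A$. (b) Unless $A$ has a double real eigenvalue, the (generalized) minor semi-axis length of $\mathrm{DW}^{\mathbb R}(A)$ is $$s^-=\frac12\,\mathrm{arcosh}\left(1+\frac{U_A-|D_A|}{\max(E_A,|D_A|)}\right)=\mathrm{arsinh}\sqrt{\frac{U_A-|D_A|}{2\max(E_A,|D_A|)}}.$$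 If $A$ has a double real eigenvalue, this formula yields the value $0$ (by declaration, for the quotient $\frac00$) when $A$ is normal, and $+\infty$ when $A$ is not normal.
   Context: Conformal range in the Beltrami–Cayley–Klein (BCK) model (inner product linear in the first variable): $$\mathrm{DW}^{\mathbb R}_{\mathrm{BCK}}(A)=\left\{\left(\frac{2\,\mathrm{Re}\langle \mathbf y,\mathbf x\rangle}{|\mathbf y|^2+|\mathbf x|^2},\frac{|\mathbf y|^2-|\mathbf x|^2}{|\mathbf y|^2+|\mathbf x|^2}\right): \mathbf y=A\mathbf x,\ \mathbf x\ne0\right\}.$$ The BCK model of the asymptotically closed hyperbolic plane is the closed unit disk in the $(x,z)$-plane; interior points are ordinary, boundary points asymptotic. All statements are about hyperbolic geometry and may be read in this model; $\mathrm{DW}^{\mathbb R}(A)$ means $\mathrm{DW}^{\mathbb R}_{\mathrm{BCK}}(A)$ and $\iota^{[2]}(\lambda)=\left(\frac{2\mathrm{Re}\lambda}{|\lambda|^2+1},\frac{|\lambda|^2-1}{|\lambda|^2+1}\right)$ for $\lambda\in\mathbb C$ (asymptotic iff $\lambda$ is real). Distance of ordinary points: $\mathrm d(v,w)=\mathrm{arcosh}\frac{1-\langle v,w\rangle}{\sqrt{1-|v|^2}\sqrt{1-|w|^2}}$. $h$-lines are (open) chords. For an asymptotic point $p$ ($|p|=1$), the $h$-horocycles with asymptotic point $p$ are the level sets of $v\mapsto\log\frac{1-\langle v,p\rangle}{\sqrt{1-|v|^2}}$ on ordinary points; if $C$ is the level set with value $k$, then $\mathrm d_C(v)=\log\frac{1-\langle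 v,p\rangle}{\sqrt{1-|v|^2}}-k$ is the signed distance from $C$, negative inside $C$. Notation: $D_A=\det A-\frac{(\mathrm{tr}A)^2}4$, $U_A=\frac{\mathrm{tr}A^*A}2-\frac{|\mathrm{tr}A|^2}4$, $E_A=\left(\frac{\mathrm{Im}\,\mathrm{tr}A}2\right)^2+\frac{|D_A|-\mathrm{Re}D_A}2$. (Thus $|D_A|=|\frac{\lambda_1-\lambda_2}2|^2$ and $E_A=|\frac{\lambda_1-\bar\lambda_2}2|^2$.) Generalized minor semi-axis length $s^-$ of $\mathrm{DW}^{\mathbb R}(A)$: - No real eigenvalue: the range is a point, an $h$-segment, an $h$-disk, or a proper $h$-elliptical disk (a non-degenerate filled ellipse in the open unit disk which is not an $h$-disk). For a point or segment $s^-=0$; for an $h$-disk $s^-$ is its hyperbolic radius; for a proper $h$-elliptical disk, the major axis is the diameter, contained in the range, of the unique $h$-disk of minimal radius containing the range, the minor axis is the intersection of the range with the perpendicular bisector of the major axis, and $s^-$ is half the hyperbolic length of the minor axis. - Two distinct real eigenvalues: the range is the asymptotically closed $h$-line through the $h$-eigenpoints ($s^-=0$) or the asymptotically closed set of points at distance at most $r>0$ from that line ($s^-=r$). - Exactly one real eigenvalue (one non-real): $s^-$ is the smallest $r\ge0$ such that all ordinary points of the range are at distance at most $r$ from the $h$-line through $\Lambda_1$ and $\Lambda_2$. - Double real eigenvalue: $s^-=0$ if the range is a single asymptotic point ($A$ normal), $s^-=+\infty$ if the range is an $h$-horodisk ($A$ not normal). *)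

(* Defs.v *)
From HB Require Import structures.
From mathcomp Require Import all_boot all_order all_algebra.
From mathcomp Require Import sesquilinear complex.
From mathcomp Require Import all_classical all_reals all_analysis.

Set Implicit Arguments.
Unset Strict Implicit.
Unset Printing Implicit Defensive.

Import Order.TTheory GRing.Theory Num.Theory.
Import numFieldNormedType.Exports.

Local Open Scope classical_set_scope.
Local Open Scope ring_scope.

Section Hyperbolic.
Variable R : realType.
Implicit Types (p v w F : R * R) (S L : set (R * R)) (k m r : R).

Definition arcosh (x : R) : R := ln (x + Num.sqrt (x ^+ 2 - 1)).
Definition arsinh (x : R) : R := ln (x + Num.sqrt (x ^+ 2 + 1)).

(* Points of the BCK model are pairs (x, z) in the closed unit disk. *)
Definition inner v w : R := v.1 * w.1 + v.2 * w.2.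
Definition ordinary v : Prop := inner v v < 1.
Definition asymptotic v : Prop := inner v v = 1.

(* Only meaningful for ordinary points; every use below is guarded. *)
Definition hdist v w : R :=
  arcosh ((1 - inner v w) /
          (Num.sqrt (1 - inner v v) * Num.sqrt (1 - inner w w))).

Definition affine v w (t : R) : R * R :=
  (v.1 + t * (w.1 - v.1), v.2 + t * (w.2 - v.2)).

Definition hsegment v w : set (R * R) :=
  [set x | exists2 t, 0 <= t <= 1 & x = affine v w t].

(* The open chord; v and w may be ordinary or asymptotic. *)
Definition hline v w : set (R * R) :=
  [set x | ordinary x /\ exists t, x = affine v w t].

Definition hdist_to L v : R := inf [set hdist v w | w in L].

Definition hdisk v r : set (R * R) := [set x | ordinary x /\ hdist v x <= r].

Definition horofun p v : R :=
  ln ((1 - inner v p) / Num.sqrt (1 - inner v v)).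

(* On ordinary points horofun p takes every real value, so the h-horocycles
   with asymptotic point p are faithfully represented by their level k;
   this is the signed distance from the one of level k. *)
Definition horocycle_sdist p k v : R := horofun p v - k.

Definition horodisk p k : set (R * R) :=
  [set x | ordinary x /\ horocycle_sdist p k x <= 0].

(* Possibly degenerate synthetic h-elliptical disk with foci F and F'. *)
Definition is_elliptical_disk S F F' : Prop :=
  exists m, hdist F F' <= m /\
    S = [set x | ordinary x /\ hdist F x + hdist F' x <= m].

(* Possibly degenerate synthetic h-elliptic parabolic disk with focus F and
   asymptotic point p; only the ordinary points of S are constrained. *)
Definition is_elliptic_parabolic_disk S F p : Prop :=
  exists k, horocycle_sdist p k F <= 0 /\
    S `&` ordinary =
      [set x | ordinary x /\ hdist F x + horocycle_sdist p k x <= 0].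

(* All foci of S: the asymptotic points of S are counted as foci. *)
Definition foci S : set (R * R) :=
  [set F | [\/ S F /\ asymptotic F,
    ordinary F /\ (exists F', ordinary F' /\ is_elliptical_disk S F F')
  | ordinary F /\
      (exists p, asymptotic p /\ is_elliptic_parabolic_disk S F p)]].

Definition filled_ellipse S : Prop :=
  exists c e f : R * R, e.1 * f.2 - e.2 * f.1 != 0 /\
    S = [set (c.1 + s.1 * e.1 + s.2 * f.1, c.2 + s.1 * e.2 + s.2 * f.2)
        | s in [set s : R * R | inner s s <= 1]].

Definition is_hdisk S : Prop := exists c r, ordinary c /\ 0 < r /\ S = hdisk c r.

Definition proper_elliptical_disk S : Prop :=
  [/\ filled_ellipse S, S `<=` ordinary & ~ is_hdisk S].

(* hdisk c r is the unique h-disk of minimal radius containing S *)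
Definition min_enclosing_hdisk S c r : Prop :=
  [/\ ordinary c, 0 <= r, S `<=` hdisk c r
    & forall c' r', ordinary c' -> 0 <= r' -> S `<=` hdisk c' r' ->
        r <= r' /\ (r' = r -> c' = c)].

Definition hdiameter c r v w : Prop :=
  [/\ ordinary v, ordinary w, hsegment v w c, hdist c v = r & hdist c w = r].

Definition is_major_axis S v w : Prop :=
  exists c r, [/\ min_enclosing_hdisk S c r, hdiameter c r v w,
    hsegment v w `<=` S
    & forall v' w', hdiameter c r v' w' -> hsegment v' w' `<=` S ->
        hsegment v' w' = hsegment v w].

Definition perp_bisector v w : set (R * R) :=
  [set x | ordinary x /\ hdist v x = hdist w x].

Definition is_minor_axis S u u' : Prop :=
  exists v w, is_major_axis S v w /\ S `&` perp_bisector v w = hsegment u u'.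

(* [minor_semiaxis_* S s]: "s is the minor semi-axis length of S". *)

Definition minor_semiaxis_elliptical S (s : \bar R) : Prop :=
  [\/ (exists c, ordinary c /\ S = [set c]) /\ s = 0%E,
      (exists u v, [/\ ordinary u, ordinary v, u <> v & S = hsegment u v]) /\
        s = 0%E,
      (exists c r, [/\ ordinary c, 0 < r, S = hdisk c r & s = r%:E])
    | proper_elliptical_disk S /\
        (exists u u', [/\ ordinary u, ordinary u', is_minor_axis S u u'
                        & s = (hdist u u' / 2)%:E])].

Definition minor_semiaxis_parabolic p q S (s : \bar R) : Prop :=
  let bound r :=
    0 <= r /\ (forall x, S x -> ordinary x -> hdist_to (hline p q) x <= r) in
  exists r, [/\ s = r%:E, bound r & forall r', bound r' -> r <= r'].

(* [closure] adjoins exactly the asymptotic limit points. *)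
Definition minor_semiaxis_line p q S (s : \bar R) : Prop :=
  (S = closure (hline p q) /\ s = 0%E) \/
  (exists r, [/\ 0 < r,
     S = closure [set x | ordinary x /\ hdist_to (hline p q) x <= r]
     & s = r%:E]).

Definition minor_semiaxis_double S (s : \bar R) : Prop :=
  exists2 p, asymptotic p &
    (S = [set p] /\ s = 0%E) \/
    (exists k, S = closure (horodisk p k) /\ s = +oo%E).

End Hyperbolic.

Section ConformalRange.
Variables (R : realType) (V : vectType R[i]) (form : {dot V for Num.conj}).
Implicit Types (A B : 'End(V)) (l : R[i]).

Definition sqnorm (x : V) : R := complex.Re (form x x).

Definition DW A : set (R * R) :=
  [set v | exists x : V, x != 0 /\
     let y := A x in
     v = (2 * complex.Re (form y x) / (sqnorm y + sqnorm x),
          (sqnorm y - sqnorm x) / (sqnorm y + sqnorm x))].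

Definition is_adjoint A B : Prop := forall x y, form (A x) y = form x (B y).

(* Matrix in a fixed (not necessarily orthonormal) basis; only its
   basis-independent trace, determinant and characteristic polynomial are
   used. *)
Definition mx_of A : 'M[R[i]]_(\dim {:V}) :=
  passmx.mxof (vbasis {:V}) (vbasis {:V}) A.

Definition tr_op A : R[i] := \tr (mx_of A).
Definition det_op A : R[i] := \det (mx_of A).

(* The multiset of eigenvalues of A is {l1, l2}. *)
Definition eigenvalues2 A l1 l2 : Prop :=
  char_poly (mx_of A) = ('X - l1%:P) * ('X - l2%:P).

Definition cabs l : R := ComplexField.Normc.normc l.

Definition D_of A : R[i] := det_op A - tr_op A ^+ 2 / 4.

(* B is the adjoint of A; tr (B A) is real. *)
Definition U_of A B : R :=
  complex.Re (tr_op (B \o A)%VF) / 2 - cabs (tr_op A) ^+ 2 / 4.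

Definition E_of A : R :=
  (complex.Im (tr_op A) / 2) ^+ 2 + (cabs (D_of A) - complex.Re (D_of A)) / 2.

(* The two closed forms for s^-, in extended reals. Library conventions give
   0%:E / 0%:E = 0 and a%:E / 0%:E = +oo for 0 < a; er_map fixes +oo. *)
Definition s_arcosh A B : \bar R :=
  ((2^-1)%:E * er_map (@arcosh R)
    (1 + (U_of A B - cabs (D_of A))%:E /
         (Num.max (E_of A) (cabs (D_of A)))%:E))%E.

Definition s_arsinh A B : \bar R :=
  er_map (@arsinh R)
    (sqrte ((U_of A B - cabs (D_of A))%:E /
            (2 * Num.max (E_of A) (cabs (D_of A)))%:E))%E.

Definition hpoint l : R * R :=
  (2 * complex.Re l / (cabs l ^+ 2 + 1), (cabs l ^+ 2 - 1) / (cabs l ^+ 2 + 1)).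

Definition isreal l : bool := complex.Im l == 0.

(* Generalized minor semi-axis length of the set S = DW A, where A has
   eigenvalues l1, l2: the definition depends on how many of them are real. *)
Definition minor_semiaxis l1 l2 (S : set (R * R)) (s : \bar R) : Prop :=
  if isreal l1 && isreal l2 then
    if l1 == l2 then minor_semiaxis_double S s
    else minor_semiaxis_line (hpoint l1) (hpoint l2) S s
  else if isreal l1 || isreal l2 then
    minor_semiaxis_parabolic (hpoint l1) (hpoint l2) S s
  else minor_semiaxis_elliptical S s.

End ConformalRange.

(* Main.v *)
Require Import Defs.
From HB Require Import structures.
From mathcomp Require Import all_boot all_order all_algebra.
From mathcomp Require Import sesquilinear complex.
From mathcomp Require Import all_classical all_reals all_analysis.
From mathcomp Require Import ring lra.
Import Order.TTheory GRing.Theory Num.Theory.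
Import numFieldNormedType.Exports.
Local Open Scope classical_set_scope.
Local Open Scope ring_scope.

Set Implicit Arguments.
Unset Strict Implicit.
Unset Printing Implicit Defensive.

(** The range is an explicit convex region of the disk, and all assertions are
    read off its equation and its dual equation.

    In a suitable orthonormal basis A is upper triangular with diagonal l1, l2
    and an off-diagonal entry of modulus b. A point (x, z) of the disk is lifted
    to the symmetric matrix with rows (a c) and (c d), where a = (1 + z) / 2,
    c = x / 2 and d = (1 - z) / 2. The point given by a vector x lifts to a
    multiple of the real part of the Gram matrix of Ax and x; the determinant
    a d - c^2 is the Minkowski form of the hyperboloid model; and the eigenpoint
    of l is the ray of (|l|^2, Re l, 1). Gram matrices depend linearly on the
    rank one matrix of x. The linear map in question has a kernel and maps the
    semidefinite Hermitian 2 x 2 matrices onto the same cone as those of rank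
    one. Whether a point belongs to the range is thus a question about a
    quadratic polynomial in one variable, and its discriminant is the equation
    of the range ([gram_coneP], [DW_grange]).

    If no eigenvalue is real this equation is, up to a positive factor,
    C1^2 + C2^2 - 2 K C1 C2 + K^2 - 1 >= 0, where C_i is the hyperbolic cosine
    of the distance d_i to the eigenpoint; this together with C1 C2 <= K is the
    condition d1 + d2 <= arcosh K ([grange_elliptical]). If l2 is real, d2 is
    replaced by a Busemann function ([grange_parabolic]). Conversely each
    synthetic disk is such a region, for a suitable b.

    The uniqueness of the foci comes from duality. A linear functional takes
    both signs on the range exactly when a certain Hermitian matrix is
    indefinite, and its determinant, as a form in the coefficients of the
    functional, is the product of the values of the functional at the two
    eigenpoints plus b^2 times the absolute. The region determines this dual
    form, and a short pencil argument recovers the eigenpoints from it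
    ([focus_unique], [foci_grange]).

    For the minor axis of an elliptical disk an isometry moves the foci to the
    points (t, 0) and (- t, 0), where the disk becomes an ellipse with the
    coordinate axes as its axes ([standard_ellipseP], [elliptical_minor_axis]).
    For real eigenvalues the distance from the h-line through the eigenpoints is
    computed in closed form ([hdist_to_line]) and compared with the equation of
    the range. Unless there is a double real eigenvalue, the minor semi-axis is
    arsinh (b / M), where M > 0 is the larger one of |l1 - l2| and
    |l1 - conj l2|; and U - |D| = b^2 / 2, while max (E, |D|) = M^2 / 4
    ([discriminant_gap], [max_E_D]). For a double real eigenvalue M vanishes,
    and the range is a point or a horodisk according to whether b vanishes. *)

(** * Gram matrices and the conic that bounds the range *)

Section GramCone.
Variable R : realType.
Implicit Types r k b a c d p q s t : R.

(** Twice the polarization of the determinant a d - c^2 between (a, c, d) and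
    the lift (|l|^2, Re l, 1) of l = r + i k. For a = |Ax|^2, c = Re <Ax, x>,
    d = |x|^2 it is the mean of the squared norms of (A - l) x and of
    (A - conj l) x. *)
Definition gpol r k a c d : R := a - 2 * c * r + d * (r ^+ 2 + k ^+ 2).

(** The value of [gpol] at the other eigenpoint, that is, the mean of
    |l1 - l2|^2 and |l1 - conj l2|^2. *)
Definition gpair r1 k1 r2 k2 : R := (r1 - r2) ^+ 2 + k1 ^+ 2 + k2 ^+ 2.

(** For a d - c^2 = 1 and C_i = cosh d_i this is a positive multiple of
    C1^2 + C2^2 - 2 K C1 C2 + K^2 - 1, with K as in [major_cosh] below; the
    normalization keeps it polynomial when some k_i vanishes. *)
Definition conic r1 k1 r2 k2 b a c d : R :=
  k2 ^+ 2 * gpol r1 k1 a c d ^+ 2 + k1 ^+ 2 * gpol r2 k2 a c d ^+ 2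
  - (gpair r1 k1 r2 k2 + b ^+ 2) * (gpol r1 k1 a c d * gpol r2 k2 a c d)
  + ((gpair r1 k1 r2 k2 + b ^+ 2) ^+ 2 - 4 * k1 ^+ 2 * k2 ^+ 2)
    * (a * d - c ^+ 2).

(** The linear image of the positive semidefinite Hermitian matrices with
    diagonal p, q and off-diagonal entry s + i t. The matrices of rank one come
    from vectors x, for which (a, c, d) = (|Ax|^2, Re <Ax, x>, |x|^2). *)
Definition gram_cone r1 k1 r2 k2 b a c d : Prop :=
  exists p q s t, [/\ 0 <= p, 0 <= q, s ^+ 2 + t ^+ 2 <= p * q
    & [/\ a = (r1 ^+ 2 + k1 ^+ 2) * p + (r2 ^+ 2 + k2 ^+ 2 + b ^+ 2) * q
            + 2 * b * (r1 * s - k1 * t),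
          c = r1 * p + r2 * q + b * s
        & d = p + q]].

(** Without the off-diagonal entry the conic is the Gram determinant of three
    Minkowski vectors, hence minus the square of their determinant. *)
Lemma conic_gram r1 k1 r2 k2 a c d :
  conic r1 k1 r2 k2 0 a c d =
  - (a * (r1 - r2) + c * (r2 ^+ 2 + k2 ^+ 2 - r1 ^+ 2 - k1 ^+ 2)
     + d * ((r1 ^+ 2 + k1 ^+ 2) * r2 - (r2 ^+ 2 + k2 ^+ 2) * r1)) ^+ 2.
Proof. rewrite /conic /gpol /gpair; ring. Qed.

Lemma conic_normal_le0 r1 k1 r2 k2 a c d : conic r1 k1 r2 k2 0 a c d <= 0.
Proof. by rewrite conic_gram oppr_le0 sqr_ge0. Qed.

(** Two nested confocal conics compared: this turns the sign of the conic into
    a bound on the product of the [gpol]s, which rules out the branch on which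
    the difference of the distances to the foci is large. *)
Lemma conic_subr r1 k1 r2 k2 b a c d :
  conic r1 k1 r2 k2 b a c d - conic r1 k1 r2 k2 0 a c d =
  b ^+ 2 * ((2 * gpair r1 k1 r2 k2 + b ^+ 2) * (a * d - c ^+ 2)
            - gpol r1 k1 a c d * gpol r2 k2 a c d).
Proof. rewrite /conic; ring. Qed.

Lemma conicC r1 k1 r2 k2 b a c d :
  conic r1 k1 r2 k2 b a c d = conic r2 k2 r1 k1 b a c d.
Proof. rewrite /conic /gpol /gpair; ring. Qed.

Lemma gpairC r1 k1 r2 k2 : gpair r1 k1 r2 k2 = gpair r2 k2 r1 k1.
Proof. rewrite /gpair; ring. Qed.

Lemma gpair_ge0 r1 k1 r2 k2 : 0 <= gpair r1 k1 r2 k2.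
Proof. by rewrite /gpair !addr_ge0 ?sqr_ge0. Qed.

(** The reversed Cauchy-Schwarz inequality for the lifts of the eigenpoints. *)
Lemma gpair_sqr_ge r1 k1 r2 k2 :
  4 * k1 ^+ 2 * k2 ^+ 2 <= gpair r1 k1 r2 k2 ^+ 2.
Proof.
rewrite /gpair.
have -> : 4 * k1 ^+ 2 * k2 ^+ 2 = (2 * `|k1 * k2|) ^+ 2.
  rewrite exprMn real_normK ?num_real// exprMn; ring.
rewrite ler_sqr ?nnegrE ?mulr_ge0// ?addr_ge0 ?sqr_ge0//.
rewrite normrM -(real_normK (num_real k1)) -(real_normK (num_real k2)).
have := sqr_ge0 (r1 - r2); have := sqr_ge0 (`|k1| - `|k2|).
rewrite sqrrB -mulr_natl; lra.
Qed.

Lemma gpair_sqr_gt r1 k1 r2 k2 b : b != 0 ->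
  4 * k1 ^+ 2 * k2 ^+ 2 < (gpair r1 k1 r2 k2 + b ^+ 2) ^+ 2.
Proof.
move=> b0; apply: le_lt_trans (gpair_sqr_ge r1 k1 r2 k2) _.
have b2 : 0 < b ^+ 2 by rewrite exprn_even_gt0.
have m0 := gpair_ge0 r1 k1 r2 k2.
by rewrite ltr_sqr ?nnegrE ?ltrDl// addr_ge0// ltW.
Qed.

(** The map onto (a, c, d) has one-dimensional fibres; the square is half the
    derivative of p q - s^2 - t^2 along the fibre, so the right-hand side is
    b^2 times a quarter of the discriminant of p q - s^2 - t^2 restricted to
    the fibre. *)
Lemma conic_cone r1 k1 r2 k2 b p q s t a c d :
  a = (r1 ^+ 2 + k1 ^+ 2) * p + (r2 ^+ 2 + k2 ^+ 2 + b ^+ 2) * q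
            + 2 * b * (r1 * s - k1 * t) ->
  c = r1 * p + r2 * q + b * s -> d = p + q ->
  conic r1 k1 r2 k2 b a c d =
  b ^+ 2 * ((b * k1 * (q - p) + 2 * k1 * (r1 - r2) * s
              - t * (2 * k1 ^+ 2 - (gpair r1 k1 r2 k2 + b ^+ 2))) ^+ 2
            + ((gpair r1 k1 r2 k2 + b ^+ 2) ^+ 2 - 4 * k1 ^+ 2 * k2 ^+ 2)
              * (p * q - (s ^+ 2 + t ^+ 2))).
Proof. move=> -> -> ->; rewrite /conic /gpol /gpair; ring. Qed.

(** For a matrix of rank one the value is |(A - l) x|^2. *)
Lemma gram_cone_ge0 r1 k1 r2 k2 b a c d : gram_cone r1 k1 r2 k2 b a c d ->
  forall l, 0 <= a - 2 * l * c + l ^+ 2 * d.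
Proof.
move=> [p [q [s [t [p0 q0 st [-> -> ->]]]]]] l.
set X := (r1 - l) ^+ 2 + k1 ^+ 2.
set w := (r1 - l) * s - k1 * t.
have X0 : 0 <= X by rewrite addr_ge0 ?sqr_ge0.
have -> : (r1 ^+ 2 + k1 ^+ 2) * p + (r2 ^+ 2 + k2 ^+ 2 + b ^+ 2) * q
            + 2 * b * (r1 * s - k1 * t) - 2 * l * (r1 * p + r2 * q + b * s) +
   l ^+ 2 * (p + q) =
   (X * p + 2 * b * w + b ^+ 2 * q) + ((r2 - l) ^+ 2 + k2 ^+ 2) * q.
  by rewrite /X /w; ring.
apply: addr_ge0; last by rewrite mulr_ge0 ?addr_ge0 ?sqr_ge0.
have w2 : w ^+ 2 <= X * p * q.
  rewrite -mulrA; apply: le_trans (ler_wpM2l X0 st).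
  rewrite -subr_ge0; have -> : X * (s ^+ 2 + t ^+ 2) - w ^+ 2 =
     ((r1 - l) * t + k1 * s) ^+ 2 by rewrite /X /w; ring.
  exact: sqr_ge0.
have XP : 0 <= X * p by rewrite mulr_ge0.
have bq : 0 <= b ^+ 2 * q by rewrite mulr_ge0 ?sqr_ge0.
have : `|2 * b * w| <= X * p + b ^+ 2 * q.
  rewrite -ler_sqr ?nnegrE ?addr_ge0// real_normK ?num_real//.
  have -> : (2 * b * w) ^+ 2 = 4 * b ^+ 2 * w ^+ 2 by ring.
  have : 4 * b ^+ 2 * w ^+ 2 <= 4 * b ^+ 2 * (X * p * q).
    by rewrite ler_wpM2l// mulr_ge0 ?sqr_ge0.
  have := sqr_ge0 (X * p - b ^+ 2 * q); lra.
by rewrite ler_norml => /andP[H _]; lra.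
Qed.

(** The minimum over l of the preceding quadratic polynomial. *)
Lemma gram_cone_det_ge0 r1 k1 r2 k2 b a c d : gram_cone r1 k1 r2 k2 b a c d ->
  0 < d -> 0 <= a * d - c ^+ 2.
Proof.
move=> /gram_cone_ge0 /(_ (c / d)) H d0.
have := mulr_ge0 H (ltW d0).
suff -> : (a - 2 * (c / d) * c + (c / d) ^+ 2 * d) * d = a * d - c ^+ 2 by [].
by field; rewrite gt_eqF.
Qed.

Lemma gram_cone_conic_ge0 r1 k1 r2 k2 b a c d :
  gram_cone r1 k1 r2 k2 b a c d -> 0 <= conic r1 k1 r2 k2 b a c d.
Proof.
move=> [p [q [s [t [p0 q0 st [aE cE dE]]]]]].
rewrite (conic_cone aE cE dE) mulr_ge0 ?sqr_ge0// addr_ge0 ?sqr_ge0//.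
rewrite mulr_ge0 ?subr_ge0//.
apply: le_trans (gpair_sqr_ge r1 k1 r2 k2) _.
rewrite ler_sqr ?nnegrE ?addr_ge0 ?sqr_ge0 ?gpair_ge0// lerDl; exact: sqr_ge0.
Qed.

Lemma gram_cone_bound r1 k1 r2 k2 b a c d :
  gram_cone r1 k1 r2 k2 b a c d ->
  gpol r1 k1 a c d * gpol r2 k2 a c d
    <= (2 * gpair r1 k1 r2 k2 + b ^+ 2) * (a * d - c ^+ 2).
Proof.
have [->|b0] := eqVneq b 0; last first.
  move=> /gram_cone_conic_ge0 Q0.
  have := conic_subr r1 k1 r2 k2 b a c d.
  have := conic_normal_le0 r1 k1 r2 k2 a c d => Q1 H.
  have : 0 <= b ^+ 2 * ((2 * gpair r1 k1 r2 k2 + b ^+ 2) * (a * d - c ^+ 2)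
            - gpol r1 k1 a c d * gpol r2 k2 a c d) by rewrite -H; lra.
  by rewrite pmulr_rge0 ?exprn_even_gt0// subr_ge0.
move=> [p [q [s [t [p0 q0 st [-> -> ->]]]]]].
rewrite -subr_ge0; apply: le_trans (_ : 0 <= p * q *
  (gpair r1 k1 r2 k2 ^+ 2 - 4 * k1 ^+ 2 * k2 ^+ 2)) _.
  by rewrite !mulr_ge0// subr_ge0 gpair_sqr_ge.
by rewrite le_eqVlt; apply/orP; left; apply/eqP; rewrite /gpol /gpair; ring.
Qed.

Lemma sum_prod_ge0 p q : 0 <= p + q -> 0 <= p * q -> 0 <= p /\ 0 <= q.
Proof.
move=> h1 h2; split; rewrite leNgt; apply/negP => h; nra.
Qed.

(** Along a fibre p q - s^2 - t^2 is a strictly concave quadratic polynomial, so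
    a nonnegative discriminant makes it nonnegative at its maximum. *)
Lemma conic_ge0_cone_nonreal r1 k1 r2 k2 b a c d : b != 0 -> k1 != 0 ->
  0 <= conic r1 k1 r2 k2 b a c d ->
  exists p q s t, [/\ s ^+ 2 + t ^+ 2 <= p * q
    & [/\ a = (r1 ^+ 2 + k1 ^+ 2) * p + (r2 ^+ 2 + k2 ^+ 2 + b ^+ 2) * q
            + 2 * b * (r1 * s - k1 * t),
          c = r1 * p + r2 * q + b * s
        & d = p + q]].
Proof.
move=> b0 k0 Q0.
set mu := gpair r1 k1 r2 k2 + b ^+ 2.
set N := mu ^+ 2 - 4 * k1 ^+ 2 * k2 ^+ 2.
have N0 : 0 < N by rewrite subr_gt0 gpair_sqr_gt.
(* s and t are those of the point of the fibre with p = d and q = 0. *)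
set s := (c - r1 * d) / b.
set t := ((r1 ^+ 2 + k1 ^+ 2) * d + 2 * r1 * (c - r1 * d) - a) / (2 * b * k1).
have aE : a = (r1 ^+ 2 + k1 ^+ 2) * d + (r2 ^+ 2 + k2 ^+ 2 + b ^+ 2) * 0
            + 2 * b * (r1 * s - k1 * t).
  by rewrite /s /t; field; rewrite b0 k0.
have cE : c = r1 * d + r2 * 0 + b * s by rewrite /s; field.
have dE : d = d + 0 by rewrite addr0.
move: Q0; rewrite (conic_cone aE cE dE) pmulr_rge0 ?exprn_even_gt0//.
rewrite -/mu -/N.
set L := _ - _ * _ => Q0.
have {}Q0 : 0 <= L ^+ 2 / N + (d * 0 - (s ^+ 2 + t ^+ 2)).
  rewrite -(pmulr_rge0 _ N0); suff -> :
   N * (L ^+ 2 / N + (d * 0 - (s ^+ 2 + t ^+ 2))) =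
   L ^+ 2 + N * (d * 0 - (s ^+ 2 + t ^+ 2)) by [].
  by field; rewrite gt_eqF.
pose x := L / N.
exists (d + 2 * b * k1 * x), (- (2 * b * k1 * x)),
  (s - 2 * k1 * (r1 - r2) * x), (t + (2 * k1 ^+ 2 - mu) * x).
split; last first.
  split; last by ring.
  - rewrite {1}aE /mu /gpair; ring.
  - rewrite {1}cE; ring.
rewrite -subr_ge0; suff -> : (d + 2 * b * k1 * x) * - (2 * b * k1 * x) -
   ((s - 2 * k1 * (r1 - r2) * x) ^+ 2 + (t + (2 * k1 ^+ 2 - mu) * x) ^+ 2)
   = L ^+ 2 / N + (d * 0 - (s ^+ 2 + t ^+ 2)) by [].
have -> : L ^+ 2 / N = 2 * x * L - x ^+ 2 * N.
  by rewrite /x; field; rewrite gt_eqF.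
rewrite /L /N /mu /gpair; ring.
Qed.

(** For real l1 the fibres are the lines on which only t varies; p, q and s are
    determined, and t = 0 is the best choice. *)
Lemma conic_ge0_cone_real r1 r2 k2 b a c d : b != 0 ->
  0 <= conic r1 0 r2 k2 b a c d ->
  exists p q s t, [/\ s ^+ 2 + t ^+ 2 <= p * q
    & [/\ a = (r1 ^+ 2 + 0 ^+ 2) * p + (r2 ^+ 2 + k2 ^+ 2 + b ^+ 2) * q
            + 2 * b * (r1 * s - 0 * t),
          c = r1 * p + r2 * q + b * s
        & d = p + q]].
Proof.
move=> b0 Q0.
set mu := gpair r1 0 r2 k2 + b ^+ 2.
have b2 : 0 < b ^+ 2 by rewrite exprn_even_gt0.
have mu0 : 0 < mu by rewrite ltr_wpDl// gpair_ge0.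
pose q := gpol r1 0 a c d / mu.
have muE : gpol r1 0 a c d = mu * q by rewrite /q; field; rewrite gt_eqF.
have aE : a = (r1 ^+ 2 + 0 ^+ 2) * (d - q) + (r2 ^+ 2 + k2 ^+ 2 + b ^+ 2) * q
            + 2 * b * (r1 * ((c - r1 * (d - q) - r2 * q) / b) - 0 * 0).
  have -> : a = gpol r1 0 a c d + 2 * c * r1 - d * r1 ^+ 2.
    by rewrite /gpol; ring.
  by rewrite muE /mu /gpair; field.
have cE : c = r1 * (d - q) + r2 * q + b * ((c - r1 * (d - q) - r2 * q) / b).
  by field.
have dE : d = (d - q) + q by rewrite subrK.
exists (d - q), q, ((c - r1 * (d - q) - r2 * q) / b), 0; split => //.
move: Q0; rewrite (conic_cone aE cE dE) pmulr_rge0// -/mu.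
set s := (c - _ - _) / b; rewrite -(subr_ge0 (s ^+ 2 + _)).
have -> : (b * 0 * (q - (d - q)) + 2 * 0 * (r1 - r2) * s
   - 0 * (2 * 0 ^+ 2 - mu)) ^+ 2 + (mu ^+ 2 - 4 * 0 ^+ 2 * k2 ^+ 2)
     * ((d - q) * q - (s ^+ 2 + 0 ^+ 2))
   = mu ^+ 2 * ((d - q) * q - (s ^+ 2 + 0 ^+ 2)) by ring.
by rewrite pmulr_rge0// exprn_gt0.
Qed.

Lemma conic_ge0_cone r1 k1 r2 k2 b a c d : b != 0 ->
  0 <= conic r1 k1 r2 k2 b a c d ->
  exists p q s t, [/\ s ^+ 2 + t ^+ 2 <= p * q
    & [/\ a = (r1 ^+ 2 + k1 ^+ 2) * p + (r2 ^+ 2 + k2 ^+ 2 + b ^+ 2) * q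
            + 2 * b * (r1 * s - k1 * t),
          c = r1 * p + r2 * q + b * s
        & d = p + q]].
Proof.
have [->|k0] := eqVneq k1 0; first exact: conic_ge0_cone_real.
by move=> b0; exact: conic_ge0_cone_nonreal.
Qed.

Lemma gram_cone_line r1 k1 r2 k2 a c d :
  (exists p q, [/\ 0 <= p, 0 <= q
    & [/\ a = (r1 ^+ 2 + k1 ^+ 2) * p + (r2 ^+ 2 + k2 ^+ 2) * q,
          c = r1 * p + r2 * q & d = p + q]]) <-> gram_cone r1 k1 r2 k2 0 a c d.
Proof.
split=> [[p [q [p0 q0 [-> -> ->]]]]|[p [q [s [t [p0 q0 st [-> -> ->]]]]]]].
  exists p, q, 0, 0; split => //; first by rewrite expr0n /= addr0 mulr_ge0.
  by split=> //; ring.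
by exists p, q; split=> //; split=> //; ring.
Qed.

(** The equality case of [gpair_sqr_ge]: the eigenpoints coincide. *)
Lemma gpair_eq r1 k1 r2 k2 :
  gpair r1 k1 r2 k2 ^+ 2 <= 4 * k1 ^+ 2 * k2 ^+ 2 ->
  r1 = r2 /\ k1 ^+ 2 = k2 ^+ 2.
Proof.
rewrite /gpair => H.
have h : ((r1 - r2) ^+ 2) * ((r1 - r2) ^+ 2 + 2 * (k1 ^+ 2 + k2 ^+ 2))
   + (k1 ^+ 2 - k2 ^+ 2) ^+ 2 <= 0.
  move: H; rewrite -subr_le0; congr (_ <= _); ring.
have h1 := sqr_ge0 (r1 - r2); have h2 := sqr_ge0 (k1 ^+ 2 - k2 ^+ 2).
have h3 := sqr_ge0 k1; have h4 := sqr_ge0 k2.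
have h5 : 0 <= (r1 - r2) ^+ 2 * (2 * (k1 ^+ 2 + k2 ^+ 2)).
  by rewrite mulr_ge0// mulr_ge0// addr_ge0.
have e1 : ((r1 - r2) ^+ 2) ^+ 2 = 0.
  by apply/eqP; rewrite eq_le sqr_ge0 andbT; lra.
have e2 : (k1 ^+ 2 - k2 ^+ 2) ^+ 2 = 0.
  apply/eqP; rewrite eq_le sqr_ge0 andbT.
  have := sqr_ge0 ((r1 - r2) ^+ 2); lra.
split; apply/eqP; rewrite -subr_eq0.
  by move/eqP: e1; rewrite -exprM expf_eq0.
by move/eqP: e2; rewrite expf_eq0.
Qed.

(** The vanishing Gram determinant puts (a, c, d) in the span of the lifts of
    the eigenpoints, and the last hypothesis makes the product of the two
    coefficients nonnegative. If the lifts coincide, the last hypothesis is the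
    equality case of the reversed Cauchy-Schwarz inequality instead. *)
Lemma normal_cone r1 k1 r2 k2 a c d : 0 < d -> 0 <= a * d - c ^+ 2 ->
  0 <= conic r1 k1 r2 k2 0 a c d ->
  gpol r1 k1 a c d * gpol r2 k2 a c d
    <= 2 * gpair r1 k1 r2 k2 * (a * d - c ^+ 2) ->
  gram_cone r1 k1 r2 k2 0 a c d.
Proof.
move=> d0 del0 Q0 gg; apply/gram_cone_line.
have [mlt|] := ltP (4 * k1 ^+ 2 * k2 ^+ 2) (gpair r1 k1 r2 k2 ^+ 2); last first.
  move=> /gpair_eq [r12 k12].
  exists d, 0; split; [exact: ltW|by []|].
  rewrite !mulr0 !addr0.
  set x := c - r1 * d; set D := d ^+ 2 * k1 ^+ 2; set e := a * d - c ^+ 2.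
  rewrite -/e in del0 gg.
  have D0 : 0 <= D by rewrite mulr_ge0 ?sqr_ge0.
  have x2 : 0 <= x ^+ 2 := sqr_ge0 x.
  have dg : d * gpol r1 k1 a c d = e + x ^+ 2 + D.
    by rewrite /gpol /e /x /D; ring.
  have g12 : gpol r2 k2 a c d = gpol r1 k1 a c d.
    by rewrite /gpol -k12 r12.
  have mE : gpair r1 k1 r2 k2 = 2 * k1 ^+ 2.
    by rewrite /gpair -k12 r12; ring.
  have H : (e + x ^+ 2 + D) ^+ 2 <= 4 * D * e.
    rewrite -dg exprMn (expr2 (gpol _ _ _ _ _)) -{2}g12.
    have -> : 4 * D * e = d ^+ 2 * (2 * gpair r1 k1 r2 k2 * e).
      by rewrite mE /D; ring.
    by rewrite ler_wpM2l// sqr_ge0.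
  have xx : x ^+ 2 * x ^+ 2 <= 0.
    have := sqr_ge0 (e - D).
    have := mulr_ge0 x2 del0; have := mulr_ge0 x2 D0; nra.
  have x0 : x = 0.
    apply/eqP; have : (x ^+ 2) ^+ 2 == 0.
      by rewrite eq_le sqr_ge0 andbT expr2.
    by rewrite -exprM expf_eq0.
  have eD : e = D.
    apply/eqP; rewrite -subr_eq0; have : (e - D) ^+ 2 == 0.
      rewrite eq_le sqr_ge0 andbT; move: H; rewrite x0; lra.
    by rewrite expf_eq0.
  have cE : c = r1 * d by apply/eqP; rewrite -subr_eq0 -/x x0.
  split => //.
  apply: (mulIf (lt0r_neq0 d0)).
  have -> : a * d = e + c ^+ 2 by rewrite /e; ring.
  by rewrite eD cE /D; ring.
have det0 : a * (r1 - r2) + c * (r2 ^+ 2 + k2 ^+ 2 - r1 ^+ 2 - k1 ^+ 2)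
     + d * ((r1 ^+ 2 + k1 ^+ 2) * r2 - (r2 ^+ 2 + k2 ^+ 2) * r1) = 0.
  apply/eqP; rewrite -[_ == 0](expf_eq0 _ 2) eq_le sqr_ge0 andbT.
  by rewrite -oppr_ge0 -conic_gram.
suff [p [q [aE cE dE]]] : exists p q,
  [/\ a = (r1 ^+ 2 + k1 ^+ 2) * p + (r2 ^+ 2 + k2 ^+ 2) * q,
          c = r1 * p + r2 * q & d = p + q].
  exists p, q.
  have pq : 0 <= p * q.
    move: gg; rewrite -subr_ge0.
    have -> : 2 * gpair r1 k1 r2 k2 * (a * d - c ^+ 2) -
     gpol r1 k1 a c d * gpol r2 k2 a c d = (p * q) *
     (gpair r1 k1 r2 k2 ^+ 2 - 4 * k1 ^+ 2 * k2 ^+ 2).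
      by rewrite /gpol /gpair aE cE dE; ring.
    by rewrite pmulr_lge0// subr_gt0.
  have [] := sum_prod_ge0 _ pq; first by rewrite -dE ltW.
  by move=> *; split.
have [r12|r12] := eqVneq (r1 - r2) 0; last first.
  exists ((c - r2 * d) / (r1 - r2)), ((r1 * d - c) / (r1 - r2)).
  split; [|by field|by field].
  apply: (mulfI r12); move: det0; set n1 := r1 ^+ 2 + k1 ^+ 2.
  set n2 := r2 ^+ 2 + k2 ^+ 2.
  have -> : (r1 - r2) * (n1 * ((c - r2 * d) / (r1 - r2)) +
     n2 * ((r1 * d - c) / (r1 - r2))) =
      n1 * (c - r2 * d) + n2 * (r1 * d - c) by field.
  rewrite /n1 /n2; lra.
have r21 : r2 = r1 by apply/esym/eqP; rewrite -subr_eq0 r12.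
have k12 : k1 ^+ 2 - k2 ^+ 2 != 0.
  apply/negP; rewrite subr_eq0 => /eqP h; move: mlt.
  by rewrite /gpair r12 expr0n /= add0r h -subr_gt0 (_ : _ - _ = 0) ?ltxx//; ring.
exists ((a - (r1 ^+ 2 + k2 ^+ 2) * d) / (k1 ^+ 2 - k2 ^+ 2)).
exists (((r1 ^+ 2 + k1 ^+ 2) * d - a) / (k1 ^+ 2 - k2 ^+ 2)).
rewrite r21; split; [by field| |by field].
have : (k1 ^+ 2 - k2 ^+ 2) * (c - r1 * d) = 0.
  move: det0; rewrite r21; set z := _ + _ * _ => z0.
  by rewrite -[RHS]oppr0 -z0 /z; ring.
move/eqP; rewrite mulf_eq0 (negPf k12) /= subr_eq0 => /eqP ->.
by field.
Qed.

(** The first two conditions describe the inside of the conic. For b = 0 the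
    conic degenerates to a line, and the third condition cuts out the segment
    between the eigenpoints. *)
Lemma gram_coneP r1 k1 r2 k2 b a c d : 0 < a + d ->
  gram_cone r1 k1 r2 k2 b a c d <->
  [/\ 0 <= a * d - c ^+ 2, 0 <= conic r1 k1 r2 k2 b a c d
    & gpol r1 k1 a c d * gpol r2 k2 a c d
    <= (2 * gpair r1 k1 r2 k2 + b ^+ 2) * (a * d - c ^+ 2)].
Proof.
move=> ad0; split=> [G|[del0 Q0 gg]].
  split; [|exact: gram_cone_conic_ge0|exact: gram_cone_bound].
  apply: (gram_cone_det_ge0 G).
  move: G => [p [q [s [t [p0 q0 st [aE _ dE]]]]]].
  rewrite lt_neqAle dE addr_ge0// andbT; apply/negP => /eqP pq0.
  have p00 : p = 0 by lra.
  have q00 : q = 0 by lra.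
  move: st ad0; rewrite dE aE p00 q00 mulr0 => st.
  have s0 : s ^+ 2 = 0.
    by apply/eqP; rewrite eq_le sqr_ge0 andbT; have := sqr_ge0 t; have := sqr_ge0 s; lra.
  have t0 : t ^+ 2 = 0.
    by apply/eqP; rewrite eq_le sqr_ge0 andbT; have := sqr_ge0 t; have := sqr_ge0 s; lra.
  move/eqP: s0; move/eqP: t0; rewrite !expf_eq0 /= => /eqP -> /eqP ->.
  by rewrite (_ : _ + _ = 0) ?ltxx//; ring.
have d0 : 0 < d.
  have [a0 dge] : 0 <= a /\ 0 <= d.
    by apply: sum_prod_ge0; [exact: ltW|have := sqr_ge0 c; lra].
  rewrite lt_neqAle dge andbT; apply/negP => /eqP de.
  have c0 : c = 0.
    apply/eqP; rewrite -[_ == _](expf_eq0 _ 2) eq_le sqr_ge0 andbT.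
    by move: del0; rewrite -de; lra.
  move: gg; rewrite /gpol -de c0 !mulr0 !mul0r !subr0 !addr0 expr0n/= subr0.
  by rewrite mulr0 -expr2 leNgt exprn_gt0//; lra.
have [b0|b0] := eqVneq b 0.
  rewrite b0 in Q0 gg *; apply: normal_cone => //.
  by move: gg; rewrite expr0n /= addr0.
have [p [q [s [t [st [aE cE dE]]]]]] := conic_ge0_cone b0 Q0.
have [] := @sum_prod_ge0 p q _ _; first by rewrite -dE ltW.
  by apply: le_trans st; rewrite addr_ge0 ?sqr_ge0.
by move=> p0 q0; exists p, q, s, t; split.
Qed.

Lemma gram_coneC r1 k1 r2 k2 b a c d : 0 < a + d ->
  gram_cone r1 k1 r2 k2 b a c d <-> gram_cone r2 k2 r1 k1 b a c d.
Proof.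
move=> ad0; rewrite !gram_coneP// conicC gpairC [gpol r1 _ _ _ _ * _]mulrC.
exact: iff_refl.
Qed.

(** For b != 0 the sign of the conic alone decides. On the plane a + d = 0 this
    says that the form is negative definite. *)
Lemma conic_ge0_det r1 k1 r2 k2 b a c d : b != 0 -> 0 <= a + d ->
  0 <= conic r1 k1 r2 k2 b a c d -> [/\ a + d = 0, a = 0 & c = 0] \/
   gram_cone r1 k1 r2 k2 b a c d.
Proof.
move=> b0 ad0 /(conic_ge0_cone b0) [p [q [s [t [st [aE cE dE]]]]]].
have pq : 0 <= p * q by apply: le_trans st; rewrite addr_ge0 ?sqr_ge0.
have [d0|d0] := leP 0 d.
  right; have [] := @sum_prod_ge0 p q _ pq; first by rewrite -dE.
  by move=> p0 q0; exists p, q, s, t; split.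
have [] := @sum_prod_ge0 (- p) (- q) _ _; [lra|by rewrite mulrNN|].
move=> p0 q0.
have G : gram_cone r1 k1 r2 k2 b (- a) (- c) (- d).
  exists (- p), (- q), (- s), (- t); split => //.
    by rewrite !sqrrN mulrNN.
  by rewrite aE cE dE; split; ring.
have := gram_cone_ge0 G 0; rewrite mulr0 mul0r expr0n /= mul0r subr0 addr0.
by lra.
Qed.
End GramCone.

(** * Inverse hyperbolic functions *)

Section InverseHyperbolic.
Variable R : realType.
Implicit Types x y C K m : R.

Lemma sqr1_ge0 C : 1 <= C -> 0 <= C ^+ 2 - 1.
Proof. by move=> C1; rewrite subr_ge0 exprn_ege1. Qed.

Lemma arcosh_arg_gt0 C : 1 <= C -> 0 < C + Num.sqrt (C ^+ 2 - 1).
Proof.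
by move=> C1; rewrite ltr_pwDl ?sqrtr_ge0// (lt_le_trans ltr01).
Qed.

Lemma expR_arcosh C : 1 <= C -> expR (arcosh C) = C + Num.sqrt (C ^+ 2 - 1).
Proof. by move=> C1; rewrite /arcosh lnK// posrE arcosh_arg_gt0. Qed.

Lemma add_sqrt_le C y : 1 <= C ->
  (C + Num.sqrt (C ^+ 2 - 1) <= y) = (C <= y) && (2 * C * y <= y ^+ 2 + 1).
Proof.
move=> C1; have s0 := sqrtr_ge0 (C ^+ 2 - 1).
have s2 : Num.sqrt (C ^+ 2 - 1) ^+ 2 = C ^+ 2 - 1 by rewrite sqr_sqrtr ?sqr1_ge0.
apply/idP/andP => [h|[h1 h2]].
  split; first by lra.
  have : Num.sqrt (C ^+ 2 - 1) ^+ 2 <= (y - C) ^+ 2.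
    by rewrite ler_sqr ?nnegrE ?subr_ge0; lra.
  rewrite s2; lra.
have : Num.sqrt (C ^+ 2 - 1) ^+ 2 <= (y - C) ^+ 2 by rewrite s2; lra.
by rewrite ler_sqr ?nnegrE ?subr_ge0//; lra.
Qed.

(** The algebraic form of the condition that defines elliptic parabolic
    disks. *)
Lemma arcosh_le_ln C y : 1 <= C -> 0 < y ->
  (arcosh C <= ln y) = (C <= y) && (2 * C * y <= y ^+ 2 + 1).
Proof.
by move=> C1 y0; rewrite -add_sqrt_le// ler_ln ?posrE ?arcosh_arg_gt0.
Qed.

Lemma arcosh_le C K : 1 <= C -> 1 <= K -> (arcosh C <= arcosh K) = (C <= K).
Proof.
move=> C1 K1; have lt_arcosh (x y : R) : 1 <= x -> x < y -> arcosh x < arcosh y.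
  move=> x1 xy; have y1 : 1 <= y by lra.
  rewrite ltr_ln ?posrE ?arcosh_arg_gt0//.
  rewrite ltr_leD// ler_sqrt ?sqr1_ge0// lerB// ler_sqr ?nnegrE; lra.
apply/idP/idP => [|]; last by rewrite le_eqVlt => /orP[/eqP->//|/lt_arcosh/ltW->].
by apply: contraTT; rewrite -!ltNge => /lt_arcosh ->.
Qed.

Lemma arcosh_inj C K : 1 <= C -> 1 <= K -> arcosh C = arcosh K -> C = K.
Proof.
by move=> C1 K1 e; apply: le_anti; rewrite -(arcosh_le C1 K1) -(arcosh_le K1 C1) e lexx.
Qed.

Lemma arcosh1 : arcosh 1 = 0 :> R.
Proof. by rewrite /arcosh expr1n subrr sqrtr0 addr0 ln1. Qed.

Lemma arcosh_ge0 C : 1 <= C -> 0 <= arcosh C.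
Proof. by move=> C1; rewrite -arcosh1 arcosh_le. Qed.

Lemma arcosh_gt0 C : 1 < C -> 0 < arcosh C.
Proof. by move=> C1; rewrite ltNge -arcosh1 (arcosh_le (ltW C1) (lexx 1)) -ltNge. Qed.

Lemma arcosh_surj m : 0 <= m -> exists2 K, 1 <= K & arcosh K = m.
Proof.
move=> m0; set e := expR m.
have e1 : 1 <= e by rewrite /e -expR0 ler_expR.
have e0 : 0 < e := expR_gt0 m.
have K1 : 1 <= (e + e^-1) / 2.
  rewrite ler_pdivlMr// mul1r -(ler_pM2r e0) [leRHS]mulrDl mulVf ?gt_eqF//.
  have := sqr_ge0 (e - 1); lra.
exists ((e + e^-1) / 2) => //.
apply: expR_inj; rewrite expR_arcosh// -/e.
have -> : ((e + e^-1) / 2) ^+ 2 - 1 = ((e - e^-1) / 2) ^+ 2.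
  by field; rewrite gt_eqF.
rewrite sqrtr_sqr ger0_norm; first by field; rewrite gt_eqF.
by rewrite divr_ge0// subr_ge0 (le_trans _ e1)// invf_le1.
Qed.

Lemma arcoshD C1 C2 : 1 <= C1 -> 1 <= C2 -> arcosh C1 + arcosh C2 =
  arcosh (C1 * C2 + Num.sqrt ((C1 ^+ 2 - 1) * (C2 ^+ 2 - 1))).
Proof.
move=> h1 h2; have s1 := sqr1_ge0 h1; have s2 := sqr1_ge0 h2.
rewrite {1 2}/arcosh -lnM ?posrE ?arcosh_arg_gt0//; congr (ln _).
set a := Num.sqrt (C1 ^+ 2 - 1); set b := Num.sqrt (C2 ^+ 2 - 1).
have aE : a ^+ 2 = C1 ^+ 2 - 1 by rewrite sqr_sqrtr.
have bE : b ^+ 2 = C2 ^+ 2 - 1 by rewrite sqr_sqrtr.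
rewrite sqrtrM// -/a -/b.
have -> : (C1 * C2 + a * b) ^+ 2 - 1 = (C1 * b + a * C2) ^+ 2.
  have -> : (C1 * C2 + a * b) ^+ 2 = C1 ^+ 2 * C2 ^+ 2 + a ^+ 2 * b ^+ 2
     + 2 * (C1 * C2 * a * b) by ring.
  have -> : (C1 * b + a * C2) ^+ 2 = C1 ^+ 2 * b ^+ 2 + a ^+ 2 * C2 ^+ 2
     + 2 * (C1 * C2 * a * b) by ring.
  rewrite aE bE; ring.
rewrite sqrtr_sqr ger0_norm; first by ring.
by rewrite addr_ge0// mulr_ge0 ?sqrtr_ge0//; lra.
Qed.

(** The algebraic form of the condition that defines elliptical disks: the
    quadratic inequality also holds when |d1 - d2| is large, and the bound on
    C1 C2 excludes that case. *)
Lemma arcoshD_le C1 C2 K : 1 <= C1 -> 1 <= C2 -> 1 <= K ->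
  (arcosh C1 + arcosh C2 <= arcosh K) =
  (C1 * C2 <= K) && (0 <= C1 ^+ 2 + C2 ^+ 2 - 2 * K * (C1 * C2) + K ^+ 2 - 1).
Proof.
move=> h1 h2 hK; rewrite arcoshD// arcosh_le//; last first.
  by rewrite ler_wpDr ?sqrtr_ge0// mulr_ege1.
set X := _ * (C2 ^+ 2 - 1).
have X0 : 0 <= X by rewrite mulr_ge0 ?sqr1_ge0.
have s0 := sqrtr_ge0 X.
have e : X + (C1 ^+ 2 + C2 ^+ 2 - 2 * K * (C1 * C2) + K ^+ 2 - 1) =
         (K - C1 * C2) ^+ 2 by rewrite /X; ring.
have s2 : Num.sqrt X ^+ 2 = X by rewrite sqr_sqrtr.
apply/idP/andP => [h|[h3 h4]].
  split; first by lra.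
  have : Num.sqrt X ^+ 2 <= (K - C1 * C2) ^+ 2.
    by rewrite ler_sqr ?nnegrE ?subr_ge0; lra.
  rewrite s2 -e; lra.
have : Num.sqrt X ^+ 2 <= (K - C1 * C2) ^+ 2 by rewrite s2 -e; lra.
by rewrite ler_sqr ?nnegrE ?subr_ge0//; lra.
Qed.

Lemma arsinh_arcosh x : 0 <= x ->
  arsinh (Num.sqrt x) = arcosh (Num.sqrt (1 + x)).
Proof.
move=> x0; rewrite /arsinh /arcosh !sqr_sqrtr ?addr_ge0//.
by rewrite addrC [in RHS]addrC [1 + x]addrC addrK [in LHS]addrC.
Qed.

Lemma sqrt1D_ge1 x : 0 <= x -> 1 <= Num.sqrt (1 + x).
Proof. by move=> x0; rewrite -[leLHS]sqrtr1 ler_wsqrtr// lerDl. Qed.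

Lemma half_arcosh x : 0 <= x ->
  2^-1 * arcosh (1 + 2 * x) = arcosh (Num.sqrt (1 + x)).
Proof.
move=> x0; have h := sqrt1D_ge1 x0.
apply: (@mulfI _ 2) => //; rewrite mulrA divff// mul1r.
rewrite (_ : 2 * arcosh _ = arcosh (Num.sqrt (1 + x)) + arcosh (Num.sqrt (1 + x)));
  last by ring.
rewrite arcoshD// -expr2 sqr_sqrtr ?addr_ge0//.
rewrite (_ : 1 + x - 1 = x); last by ring.
rewrite -expr2 sqrtr_sqr ger0_norm//; by congr arcosh; ring.
Qed.

End InverseHyperbolic.

(** * Points of the model and their lifts *)

Section Points.
Variable R : realType.
Implicit Types (v w x : R * R) (r k b m : R).

Lemma ordinaryP v : ordinary v <-> 0 < 1 - inner v v.
Proof. by rewrite /ordinary subr_gt0. Qed.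

Lemma innerC v w : inner v w = inner w v.
Proof. by rewrite /inner mulrC [_.2 * _]mulrC. Qed.

Lemma inner_lt1 v w : inner v v < 1 -> inner w w <= 1 -> 0 < 1 - inner v w.
Proof.
rewrite /inner => hv hw.
have := sqr_ge0 (v.1 - w.1); have := sqr_ge0 (v.2 - w.2); lra.
Qed.

(** The reversed Cauchy-Schwarz inequality in the form of an identity whose
    right-hand side is visibly nonnegative on the disk. *)
Lemma lorentz_cauchy v w :
  (1 - inner v w) ^+ 2 - (1 - inner v v) * (1 - inner w w) =
  ((w.1 - v.1) ^+ 2 + (w.2 - v.2) ^+ 2) * (1 - inner v v)
  + (v.1 * (w.1 - v.1) + v.2 * (w.2 - v.2)) ^+ 2.
Proof. rewrite /inner; ring. Qed.

Definition hcosh v w : R :=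
  (1 - inner v w) / (Num.sqrt (1 - inner v v) * Num.sqrt (1 - inner w w)).

Lemma hdistE v w : hdist v w = arcosh (hcosh v w). Proof. by []. Qed.

Lemma hcoshC v w : hcosh v w = hcosh w v.
Proof. by rewrite /hcosh innerC [X in _ / X]mulrC. Qed.

Lemma hdistC v w : hdist v w = hdist w v.
Proof. by rewrite !hdistE hcoshC. Qed.

Lemma sqrt_gt0_ord v : ordinary v -> 0 < Num.sqrt (1 - inner v v).
Proof. by move/ordinaryP => h; rewrite sqrtr_gt0. Qed.

Lemma hcosh_sqr v w : ordinary v -> ordinary w ->
  hcosh v w ^+ 2 = (1 - inner v w) ^+ 2 / ((1 - inner v v) * (1 - inner w w)).
Proof.
move=> /ordinaryP/ltW hv /ordinaryP/ltW hw.
by rewrite /hcosh expr_div_n exprMn !sqr_sqrtr.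
Qed.

Lemma hcosh_gt0 v w : ordinary v -> ordinary w -> 0 < hcosh v w.
Proof.
move=> hv hw; rewrite divr_gt0 ?inner_lt1// ?mulr_gt0 ?sqrt_gt0_ord//.
exact: ltW.
Qed.

Lemma hcosh_ge1 v w : ordinary v -> ordinary w -> 1 <= hcosh v w.
Proof.
move=> hv hw.
have c0 := ltW (hcosh_gt0 hv hw).
rewrite -(@ler_sqr R) ?nnegrE//.
have /ordinaryP pv := hv; have /ordinaryP pw := hw.
rewrite expr1n hcosh_sqr// ler_pdivlMr ?mulr_gt0// mul1r -subr_ge0.
rewrite lorentz_cauchy addr_ge0 ?sqr_ge0//; apply: mulr_ge0 (ltW pv).
by rewrite addr_ge0 ?sqr_ge0.
Qed.

Lemma hcosh_eq1 v w : ordinary v -> ordinary w -> hcosh v w <= 1 -> v = w.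
Proof.
move=> hv hw.
have c0 := ltW (hcosh_gt0 hv hw).
rewrite -(@ler_sqr R) ?nnegrE//.
have /ordinaryP pv := hv; have /ordinaryP pw := hw.
rewrite expr1n hcosh_sqr// ler_pdivrMr ?mulr_gt0// mul1r -subr_le0.
rewrite lorentz_cauchy => h.
have : (w.1 - v.1) ^+ 2 + (w.2 - v.2) ^+ 2 == 0.
  rewrite eq_le addr_ge0 ?sqr_ge0// andbT -(pmulr_lle0 _ pv).
  by apply: le_trans h; rewrite lerDl sqr_ge0.
rewrite paddr_eq0 ?sqr_ge0// !expf_eq0 /= !subr_eq0 => /andP[/eqP h1 /eqP h2].
by case: v w h1 h2 {hv hw pv pw h c0} => ? ? [? ?] /= -> ->.
Qed.

Lemma hcosh_id v : ordinary v -> hcosh v v = 1.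
Proof.
move=> hv; have /ordinaryP pv := hv.
by rewrite /hcosh -expr2 sqr_sqrtr ?ltW// divff ?gt_eqF.
Qed.

Lemma hdist_id v : ordinary v -> hdist v v = 0.
Proof. by move=> hv; rewrite hdistE hcosh_id// arcosh1. Qed.

Lemma hdist_ge0 v w : ordinary v -> ordinary w -> 0 <= hdist v w.
Proof. by move=> hv hw; rewrite hdistE arcosh_ge0// hcosh_ge1. Qed.

(** The lift of a point of the disk to the symmetric matrix with rows (a c)
    and (c d) and trace one; the Minkowski form becomes the determinant. *)
Definition ga v : R := (1 + v.2) / 2.
Definition gc v : R := v.1 / 2.
Definition gd v : R := (1 - v.2) / 2.

Lemma gaDgd v : ga v + gd v = 1.
Proof. by rewrite /ga /gd; field. Qed.

Lemma gdet v : ga v * gd v - gc v ^+ 2 = (1 - inner v v) / 4.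
Proof. by rewrite /ga /gd /gc /inner; field. Qed.

Lemma ordinary_gdet v : ordinary v <-> 0 < ga v * gd v - gc v ^+ 2.
Proof. by rewrite gdet ordinaryP pmulr_lgt0 ?invr_gt0. Qed.

(** The h-eigenpoint of r + i k. *)
Definition hp r k : R * R :=
  (2 * r / (r ^+ 2 + k ^+ 2 + 1),
   (r ^+ 2 + k ^+ 2 - 1) / (r ^+ 2 + k ^+ 2 + 1)).

Lemma nsq1_gt0 r k : 0 < r ^+ 2 + k ^+ 2 + 1.
Proof. by rewrite ltr_wpDl// addr_ge0 ?sqr_ge0. Qed.

Lemma inner_hp r k v : 1 - inner (hp r k) v =
  2 / (r ^+ 2 + k ^+ 2 + 1) * gpol r k (ga v) (gc v) (gd v).
Proof.
have := nsq1_gt0 r k; rewrite /inner /hp /gpol /ga /gc /gd /= => h.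
by field; rewrite gt_eqF.
Qed.

Lemma inner_hp_hp r k : 1 - inner (hp r k) (hp r k) =
  (2 * k / (r ^+ 2 + k ^+ 2 + 1)) ^+ 2.
Proof.
have := nsq1_gt0 r k; rewrite /inner /hp /= => h.
by field; rewrite gt_eqF.
Qed.

Lemma ordinary_hp r k : k != 0 -> ordinary (hp r k).
Proof.
move=> k0; apply/ordinaryP; rewrite inner_hp_hp exprn_even_gt0//=.
by rewrite mulf_neq0 ?invr_eq0 ?(gt_eqF (nsq1_gt0 _ _))// mulf_neq0.
Qed.

Lemma asymptotic_hp r : asymptotic (hp r 0).
Proof.
rewrite /asymptotic; apply/esym/eqP; rewrite -subr_eq0 inner_hp_hp.
by rewrite mulr0 mul0r expr0n.
Qed.

Lemma ordinary_hpP r k : ordinary (hp r k) <-> k != 0.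
Proof.
split; last exact: ordinary_hp.
by apply: contraPneq => ->; rewrite /ordinary asymptotic_hp ltxx.
Qed.

Lemma sqrt_hp r k : Num.sqrt (1 - inner (hp r k) (hp r k)) =
  2 * `|k| / (r ^+ 2 + k ^+ 2 + 1).
Proof.
rewrite inner_hp_hp sqrtr_sqr !normrM normfV.
by rewrite (gtr0_norm (nsq1_gt0 _ _)) ger0_norm.
Qed.

Lemma sqrt_gdet v : Num.sqrt (1 - inner v v) =
  2 * Num.sqrt (ga v * gd v - gc v ^+ 2).
Proof.
rewrite (_ : 1 - _ = 2 ^+ 2 * (ga v * gd v - gc v ^+ 2)).
  by rewrite sqrtrM ?sqr_ge0// sqrtr_sqr ger0_norm.
by rewrite gdet; field.
Qed.

Lemma hcosh_hp r k v : k != 0 -> ordinary v -> hcosh (hp r k) v =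
  gpol r k (ga v) (gc v) (gd v)
   / (2 * `|k| * Num.sqrt (ga v * gd v - gc v ^+ 2)).
Proof.
move=> k0 /ordinary_gdet dv; rewrite /hcosh inner_hp sqrt_hp sqrt_gdet.
have := nsq1_gt0 r k; have : 0 < `|k| by rewrite normr_gt0.
move: dv; rewrite -sqrtr_gt0; move: (Num.sqrt _) `|k| => s z s0 z0 h.
by field; rewrite !gt_eqF.
Qed.

Lemma horofun_hp r v : ordinary v -> horofun (hp r 0) v =
  ln (gpol r 0 (ga v) (gc v) (gd v)
   / ((r ^+ 2 + 1) * Num.sqrt (ga v * gd v - gc v ^+ 2))).
Proof.
move=> /ordinary_gdet dv; rewrite /horofun innerC inner_hp sqrt_gdet.
congr ln; have := nsq1_gt0 r 0; rewrite expr0n /= addr0.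
move: dv; rewrite -sqrtr_gt0; move: (Num.sqrt _) => s s0 h.
by field; rewrite !gt_eqF.
Qed.

Lemma gpol_gt0 r k v : ordinary v -> 0 < gpol r k (ga v) (gc v) (gd v).
Proof.
move=> ov; have : 0 < 1 - inner (hp r k) v.
  rewrite innerC inner_lt1//.
  by rewrite -subr_ge0 inner_hp_hp sqr_ge0.
by rewrite inner_hp pmulr_rgt0// divr_gt0// nsq1_gt0.
Qed.

(** Only the point (0, 1), the image of infinity, is missed. *)
Lemma hp_surj v : inner v v <= 1 -> v.2 != 1 ->
  exists r k, v = hp r k /\ 0 <= k.
Proof.
move=> hv v1.
have d0 : gd v != 0 by rewrite mulf_neq0// subr_eq0 eq_sym.
exists (gc v / gd v), (Num.sqrt (ga v * gd v - gc v ^+ 2) / gd v).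
have e : (gc v / gd v) ^+ 2 + (Num.sqrt (ga v * gd v - gc v ^+ 2) / gd v) ^+ 2
   = ga v / gd v.
  rewrite (expr_div_n (gc v)) (expr_div_n (Num.sqrt _)) sqr_sqrtr.
    by field.
  by rewrite gdet divr_ge0// subr_ge0.
have d1 : 0 < gd v.
  rewrite lt0r d0 /= /gd divr_ge0// subr_ge0.
  move: hv; rewrite /inner => hv.
  have := sqr_ge0 v.1; have := sqr_ge0 (v.2 - 1); nra.
split; last by rewrite divr_ge0 ?sqrtr_ge0// ltW.
rewrite /hp e; have -> : ga v / gd v + 1 = 1 / gd v.
  by rewrite -[in RHS](gaDgd v); field.
case: v d0 {hv v1 e d1} => x z; rewrite /ga /gc /gd /= => d0.
by congr pair; field; move: d0; rewrite mulf_eq0 negb_or => /andP[].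
Qed.
End Points.

(** * The range as a synthetic disk *)

Section Range.
Variable R : realType.
Implicit Types (v w x : R * R) (r k b m : R).

(** The conformal range of a triangular operator with diagonal r_i + i k_i and
    off-diagonal entry of modulus b. *)
Definition grange r1 k1 r2 k2 b : set (R * R) :=
  [set v | gram_cone r1 k1 r2 k2 b (ga v) (gc v) (gd v)].

Lemma nsq1_neq0 r k : r ^+ 2 + k ^+ 2 + 1 != 0.
Proof. by rewrite gt_eqF// nsq1_gt0. Qed.

Lemma ga_hp r k : ga (hp r k) = (r ^+ 2 + k ^+ 2) / (r ^+ 2 + k ^+ 2 + 1).
Proof. by rewrite /ga /hp /=; field; rewrite ?nsq1_neq0. Qed.

Lemma gc_hp r k : gc (hp r k) = r / (r ^+ 2 + k ^+ 2 + 1).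
Proof. by rewrite /gc /hp /=; field; rewrite ?nsq1_neq0. Qed.

Lemma gd_hp r k : gd (hp r k) = 1 / (r ^+ 2 + k ^+ 2 + 1).
Proof. by rewrite /gd /hp /=; field; rewrite ?nsq1_neq0. Qed.

(** The Schur form can list the eigenvalues in either order. *)
Lemma grangeC r1 k1 r2 k2 b : grange r1 k1 r2 k2 b = grange r2 k2 r1 k1 b.
Proof.
apply/seteqP; split=> v; rewrite /grange /= gram_coneC// gaDgd; exact: ltr01.
Qed.

Lemma grange_hp1 r1 k1 r2 k2 b : grange r1 k1 r2 k2 b (hp r1 k1).
Proof.
exists (1 / (r1 ^+ 2 + k1 ^+ 2 + 1)), 0, 0, 0.
rewrite ga_hp gc_hp gd_hp; split.
- by rewrite divr_ge0// ltW// nsq1_gt0.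
- by [].
- by rewrite expr0n mulr0 addr0.
- by split; field; rewrite ?nsq1_neq0.
Qed.

Lemma grange_hp2 r1 k1 r2 k2 b : grange r1 k1 r2 k2 b (hp r2 k2).
Proof. rewrite grangeC; exact: grange_hp1. Qed.

(** [gram_coneP] with the last bound in the form C1 C2 <= K that occurs in
    [arcoshD_le]; the weaker bound implies the sharper one on the inside of the
    conic, by [conic_subr]. *)
Lemma grangeP r1 k1 r2 k2 b v : grange r1 k1 r2 k2 b v <->
  [/\ 0 <= ga v * gd v - gc v ^+ 2,
    0 <= conic r1 k1 r2 k2 b (ga v) (gc v) (gd v)
  & gpol r1 k1 (ga v) (gc v) (gd v) * gpol r2 k2 (ga v) (gc v) (gd v)
    <= 2 * (gpair r1 k1 r2 k2 + b ^+ 2) * (ga v * gd v - gc v ^+ 2)].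
Proof.
rewrite /grange /= gram_coneP ?gaDgd ?ltr01//.
move: (ga v) (gc v) (gd v) => a c d.
split=> -[d0 Q0 h]; split => //.
  apply: le_trans h _; rewrite ler_wpM2r//.
  by have := sqr_ge0 b; lra.
have [b0|b0] := eqVneq b 0.
  by move: h; rewrite b0 expr0n /= !addr0.
rewrite -subr_ge0 -(pmulr_rge0 _ (_ : 0 < b ^+ 2)) ?exprn_even_gt0//.
by rewrite -conic_subr subr_ge0 (le_trans (conic_normal_le0 _ _ _ _ _ _ _)).
Qed.

Lemma grange_disk r1 k1 r2 k2 b v : grange r1 k1 r2 k2 b v -> inner v v <= 1.
Proof.
by move=> /grangeP[]; rewrite gdet pmulr_lge0 ?invr_gt0// subr_ge0.
Qed.

Lemma inner_eq1 v w : inner v v <= 1 -> inner w w <= 1 -> inner v w = 1 -> v = w.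
Proof.
rewrite /inner => hv hw hvw.
have h : (v.1 - w.1) ^+ 2 + (v.2 - w.2) ^+ 2 == 0.
  by rewrite eq_le addr_ge0 ?sqr_ge0// andbT; lra.
move: h; rewrite paddr_eq0 ?sqr_ge0// !expf_eq0 /= !subr_eq0.
by case: v w {hv hw hvw} => ? ? [? ?] /= /andP[/eqP-> /eqP->].
Qed.

Lemma inner_le1 v w : inner v v <= 1 -> inner w w <= 1 -> inner v w <= 1.
Proof.
rewrite /inner => hv hw.
have := sqr_ge0 (v.1 - w.1); have := sqr_ge0 (v.2 - w.2); lra.
Qed.

Lemma inner_hp_le1 r k : inner (hp r k) (hp r k) <= 1.
Proof. by rewrite -subr_ge0 inner_hp_hp sqr_ge0. Qed.

Lemma gpol_hp r k v : gpol r k (ga v) (gc v) (gd v) =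
  (r ^+ 2 + k ^+ 2 + 1) / 2 * (1 - inner (hp r k) v).
Proof. by rewrite inner_hp; field; rewrite nsq1_neq0. Qed.

Lemma gpol_ge0 r k v : inner v v <= 1 -> 0 <= gpol r k (ga v) (gc v) (gd v).
Proof.
move=> hv; rewrite gpol_hp mulr_ge0//; first by rewrite divr_ge0// ltW// nsq1_gt0.
by rewrite subr_ge0; apply: inner_le1 (inner_hp_le1 r k) hv.
Qed.

Lemma gpol_eq0 r k v : inner v v <= 1 ->
  gpol r k (ga v) (gc v) (gd v) = 0 -> v = hp r k.
Proof.
move=> hv /eqP; rewrite gpol_hp mulf_eq0 mulf_eq0 (negPf (nsq1_neq0 _ _)).
rewrite invr_eq0 pnatr_eq0 /= subr_eq0 => /eqP/esym/inner_eq1 -> //.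
exact: inner_hp_le1.
Qed.

(** At an asymptotic point the determinant vanishes, so the last bound of
    [grangeP] forces one of the [gpol]s to vanish. *)
Lemma grange_asymptotic r1 k1 r2 k2 b v : grange r1 k1 r2 k2 b v ->
  asymptotic v -> (k1 = 0 /\ v = hp r1 k1) \/ (k2 = 0 /\ v = hp r2 k2).
Proof.
move=> G va; have hv := grange_disk G.
have as0 r k : v = hp r k -> k = 0.
  move=> e; apply/eqP; apply/negPn/negP => /(ordinary_hp r).
  by rewrite -e /ordinary va ltxx.
move/grangeP: G => -[_ _].
rewrite gdet va subrr mul0r mulr0 => gg.
have : gpol r1 k1 (ga v) (gc v) (gd v) * gpol r2 k2 (ga v) (gc v) (gd v) == 0.
  by rewrite eq_le gg mulr_ge0// gpol_ge0.
rewrite mulf_eq0 => /orP[] /eqP/(gpol_eq0 hv) e; [left|right].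
  by split=> //; exact: as0 e.
by split=> //; exact: as0 e.
Qed.

Lemma grange_ordinary r1 k1 r2 k2 b v : k1 != 0 -> k2 != 0 ->
  grange r1 k1 r2 k2 b v -> ordinary v.
Proof.
move=> h1 h2 G; rewrite /ordinary lt_neqAle (grange_disk G) andbT.
apply/eqP => /(grange_asymptotic G) [[e _]|[e _]].
  by rewrite e eqxx in h1.
by rewrite e eqxx in h2.
Qed.

(** The hyperbolic cosine of the length of the major axis. *)
Definition major_cosh r1 k1 r2 k2 b : R :=
  (gpair r1 k1 r2 k2 + b ^+ 2) / (2 * (`|k1| * `|k2|)).

Lemma hcosh_hp_hp r1 k1 r2 k2 : k1 != 0 -> k2 != 0 ->
  hcosh (hp r1 k1) (hp r2 k2) = major_cosh r1 k1 r2 k2 0.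
Proof.
move=> h1 h2; rewrite hcosh_hp//; last exact: ordinary_hp.
rewrite gdet inner_hp_hp sqrtrM ?sqr_ge0// sqrtr_sqr.
rewrite (_ : 4^-1 = (2^-1) ^+ 2); last by field.
rewrite sqrtr_sqr (ger0_norm (_ : 0 <= 2^-1)) ?invr_ge0// !normrM normfV.
rewrite (gtr0_norm (nsq1_gt0 r2 k2)) (ger0_norm (_ : 0 <= 2))//.
rewrite /gpol ga_hp gc_hp gd_hp /major_cosh /gpair.
by field; rewrite nsq1_neq0 !normr_eq0 h1 h2.
Qed.

Lemma major_cosh_ge r1 k1 r2 k2 b : k1 != 0 -> k2 != 0 ->
  hcosh (hp r1 k1) (hp r2 k2) <= major_cosh r1 k1 r2 k2 b.
Proof.
move=> h1 h2; rewrite hcosh_hp_hp// /major_cosh ler_wpM2r ?lerD2l//.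
by rewrite expr0n sqr_ge0.
Qed.

Lemma major_cosh_ge1 r1 k1 r2 k2 b : k1 != 0 -> k2 != 0 ->
  1 <= major_cosh r1 k1 r2 k2 b.
Proof.
move=> h1 h2; apply: le_trans (major_cosh_ge r1 r2 b h1 h2).
by apply: hcosh_ge1; exact: ordinary_hp.
Qed.

Lemma grange_elliptical r1 k1 r2 k2 b : k1 != 0 -> k2 != 0 ->
  grange r1 k1 r2 k2 b = [set x | ordinary x /\
    hdist (hp r1 k1) x + hdist (hp r2 k2) x
      <= arcosh (major_cosh r1 k1 r2 k2 b)].
Proof.
move=> h1 h2.
suff H v : ordinary v -> grange r1 k1 r2 k2 b v <->
    hdist (hp r1 k1) v + hdist (hp r2 k2) v
      <= arcosh (major_cosh r1 k1 r2 k2 b).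
  apply/seteqP; split=> v /=.
    by move=> G; have ov := grange_ordinary h1 h2 G; split=> //; apply/H.
  by move=> [ov]; rewrite -H.
move=> ov; have /ordinary_gdet d0 := ov.
have o1 := ordinary_hp r1 h1; have o2 := ordinary_hp r2 h2.
rewrite !hdistE arcoshD_le ?hcosh_ge1 ?major_cosh_ge1// grangeP.
rewrite !hcosh_hp//.
set g1 := gpol r1 _ _ _ _; set g2 := gpol r2 _ _ _ _.
set del := ga v * _ - _; set K := major_cosh _ _ _ _ _.
have s0 : Num.sqrt del != 0 by rewrite gt_eqF// sqrtr_gt0.
have s2 : Num.sqrt del ^+ 2 = del by rewrite sqr_sqrtr// ltW.
have e1 : `|k1| ^+ 2 = k1 ^+ 2 by rewrite real_normK ?num_real.
have e2 : `|k2| ^+ 2 = k2 ^+ 2 by rewrite real_normK ?num_real.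
have n1 : `|k1| != 0 by rewrite normr_eq0.
have n2 : `|k2| != 0 by rewrite normr_eq0.
have E1 : (g1 / (2 * `|k1| * Num.sqrt del)) * (g2 / (2 * `|k2| * Num.sqrt del))
  <= K = (g1 * g2 <= 2 * (gpair r1 k1 r2 k2 + b ^+ 2) * del).
  rewrite /K /major_cosh.
  have -> : g1 / (2 * `|k1| * Num.sqrt del) * (g2 / (2 * `|k2| * Num.sqrt del))
    = g1 * g2 / (2 * del) / (2 * (`|k1| * `|k2|)).
    by rewrite -{3}s2; field; rewrite s0 n1 n2.
  rewrite ler_pM2r ?invr_gt0 ?mulr_gt0 ?normr_gt0//.
  rewrite ler_pdivrMr ?mulr_gt0//; congr (_ <= _); ring.
have E2 : (g1 / (2 * `|k1| * Num.sqrt del)) ^+ 2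
  + (g2 / (2 * `|k2| * Num.sqrt del)) ^+ 2
  - 2 * K * ((g1 / (2 * `|k1| * Num.sqrt del))
     * (g2 / (2 * `|k2| * Num.sqrt del))) + K ^+ 2 - 1 =
  conic r1 k1 r2 k2 b (ga v) (gc v) (gd v) / (4 * k1 ^+ 2 * k2 ^+ 2 * del).
  rewrite /conic -/g1 -/g2 -/del /K /major_cosh -e1 -e2.
  move: (Num.sqrt del) s2 s0 => s <- s0.
  move: `|k1| `|k2| n1 n2 => x1 x2 n1 n2.
  by field; rewrite s0 n1 n2.
have k1p : 0 < k1 ^+ 2 by rewrite exprn_even_gt0.
have k2p : 0 < k2 ^+ 2 by rewrite exprn_even_gt0.
rewrite E1 E2 pmulr_lge0; last first.
  by rewrite invr_gt0 mulr_gt0// mulr_gt0// mulr_gt0.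
split=> [[_ -> ->] //|/andP[-> ->]]; split=> //; exact: ltW.
Qed.

(** The level of the horocycle: for real l2 the sum of distances to the foci
    is replaced by a distance plus a Busemann function. *)
Definition parabolic_level r1 k1 r2 b : R :=
  ln ((gpair r1 k1 r2 0 + b ^+ 2) / (`|k1| * (r2 ^+ 2 + 1))).

Lemma gpair_gt0 r1 k1 r2 k2 b : k1 != 0 -> 0 < gpair r1 k1 r2 k2 + b ^+ 2.
Proof.
move=> h1; rewrite ltr_wpDr ?sqr_ge0// /gpair ltr_wpDr ?sqr_ge0//.
by rewrite ltr_wpDl ?sqr_ge0// exprn_even_gt0.
Qed.

Lemma grange_parabolic r1 k1 r2 b x : k1 != 0 -> ordinary x ->
  grange r1 k1 r2 0 b x <->
  hdist (hp r1 k1) x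
    + horocycle_sdist (hp r2 0) (parabolic_level r1 k1 r2 b) x <= 0.
Proof.
move=> h1 ov; have /ordinary_gdet d0 := ov.
have o1 := ordinary_hp r1 h1.
rewrite /horocycle_sdist horofun_hp// hdistE /parabolic_level.
rewrite addrA subr_le0 -lerBrDr.
have g1p := gpol_gt0 r1 k1 ov; have g2p := gpol_gt0 r2 0 ov.
have mup := gpair_gt0 r1 r2 0 b h1.
have np : 0 < r2 ^+ 2 + 1 by have := nsq1_gt0 r2 0; rewrite expr0n addr0.
have kp : 0 < `|k1| by rewrite normr_gt0.
have sp : 0 < Num.sqrt (ga x * gd x - gc x ^+ 2) by rewrite sqrtr_gt0.
rewrite -ln_div ?posrE ?divr_gt0 ?mulr_gt0//.
rewrite arcosh_le_ln ?hcosh_ge1//; last by rewrite !divr_gt0 ?mulr_gt0.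
rewrite grangeP hcosh_hp//.
set g1 := gpol r1 _ _ _ _ in g1p *; set g2 := gpol r2 _ _ _ _ in g2p *.
set del := ga x * _ - _ in sp d0 *.
set mu := gpair _ _ _ _ + _ in mup *.
have e1 : `|k1| ^+ 2 = k1 ^+ 2 by rewrite real_normK ?num_real.
have s2 : Num.sqrt del ^+ 2 = del by rewrite sqr_sqrtr// ltW.
have yE : mu / (`|k1| * (r2 ^+ 2 + 1)) /
     (g2 / ((r2 ^+ 2 + 1) * Num.sqrt del)) = mu * Num.sqrt del / (`|k1| * g2).
  move: (Num.sqrt del) sp `|k1| kp => s sp z kp; field.
  by rewrite !gt_eqF.
rewrite yE.
have E1 : g1 / (2 * `|k1| * Num.sqrt del) <= mu * Num.sqrt del / (`|k1| * g2)
   = (g1 * g2 <= 2 * mu * del).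
  rewrite ler_pdivrMr ?mulr_gt0// mulrAC ler_pdivlMr ?mulr_gt0//.
  have -> : mu * Num.sqrt del * (2 * `|k1| * Num.sqrt del) =
     2 * mu * del * `|k1| by rewrite -[in RHS]s2; ring.
  rewrite mulrCA mulrC ler_pM2r//.
have E2 : (mu * Num.sqrt del / (`|k1| * g2)) ^+ 2 + 1 -
   2 * (g1 / (2 * `|k1| * Num.sqrt del)) * (mu * Num.sqrt del / (`|k1| * g2))
   = conic r1 k1 r2 0 b (ga x) (gc x) (gd x) / (k1 ^+ 2 * g2 ^+ 2).
  rewrite /conic -/g1 -/g2 -/del -/mu -e1.
  move: (Num.sqrt del) s2 sp => s <- sp; move: `|k1| kp => z kp; field.
  by rewrite !gt_eqF.
have k1p : 0 < k1 ^+ 2 by rewrite exprn_even_gt0.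
have g22p : 0 < g2 ^+ 2 by rewrite exprn_gt0.
rewrite E1 -(subr_ge0 (2 * _ * _)) E2 pmulr_lge0; last first.
  by rewrite invr_gt0 mulr_gt0.
split=> [[_ -> ->] //|/andP[-> ->]]; split=> //; exact: ltW.
Qed.

Lemma grange_is_elliptical r1 k1 r2 k2 b : k1 != 0 -> k2 != 0 ->
  is_elliptical_disk (grange r1 k1 r2 k2 b) (hp r1 k1) (hp r2 k2).
Proof.
move=> h1 h2; exists (arcosh (major_cosh r1 k1 r2 k2 b)).
split; last exact: grange_elliptical.
rewrite hdistE arcosh_le ?major_cosh_ge1 ?hcosh_ge1 ?major_cosh_ge//;
  exact: ordinary_hp.
Qed.

Lemma grange_is_parabolic r1 k1 r2 b : k1 != 0 ->
  is_elliptic_parabolic_disk (grange r1 k1 r2 0 b) (hp r1 k1) (hp r2 0).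
Proof.
move=> h1; exists (parabolic_level r1 k1 r2 b); split.
  have o1 := ordinary_hp r1 h1.
  have := grange_hp1 r1 k1 r2 0 b.
  by rewrite grange_parabolic// hdist_id// add0r.
apply/seteqP; split=> x [].
  by move=> G ox; split=> //; rewrite -grange_parabolic.
by move=> ox; rewrite -grange_parabolic.
Qed.

(** Synthetic disks with given foci form a one-parameter family, exhausted by
    the ranges: it suffices to solve [major_cosh] for b. *)
Lemma elliptical_is_grange S r1 k1 r2 k2 : k1 != 0 -> k2 != 0 ->
  is_elliptical_disk S (hp r1 k1) (hp r2 k2) ->
  exists b, S = grange r1 k1 r2 k2 b.
Proof.
move=> h1 h2 [m [dm ->]].
have o1 := ordinary_hp r1 h1; have o2 := ordinary_hp r2 h2.
have [K K1 Km] := arcosh_surj (le_trans (hdist_ge0 o1 o2) dm).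
have KC : hcosh (hp r1 k1) (hp r2 k2) <= K.
  by rewrite -arcosh_le ?hcosh_ge1// Km.
exists (Num.sqrt (K * (2 * (`|k1| * `|k2|)) - gpair r1 k1 r2 k2)).
rewrite grange_elliptical//; suff -> : major_cosh r1 k1 r2 k2
  (Num.sqrt (K * (2 * (`|k1| * `|k2|)) - gpair r1 k1 r2 k2)) = K by rewrite Km.
have kk : 0 < 2 * (`|k1| * `|k2|) by rewrite !mulr_gt0 ?normr_gt0.
rewrite /major_cosh sqr_sqrtr.
  by rewrite addrC subrK mulfK// gt_eqF.
move: KC; rewrite hcosh_hp_hp// /major_cosh expr0n addr0.
by rewrite ler_pdivrMr// subr_ge0.
Qed.

Lemma parabolic_is_grange S r1 k1 r2 : k1 != 0 ->
  is_elliptic_parabolic_disk S (hp r1 k1) (hp r2 0) ->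
  exists b, S `&` @ordinary R = grange r1 k1 r2 0 b `&` @ordinary R.
Proof.
move=> h1 [k [dk SE]].
have o1 := ordinary_hp r1 h1.
have kp : 0 < `|k1| by rewrite normr_gt0.
have np : 0 < r2 ^+ 2 + 1 by have := nsq1_gt0 r2 0; rewrite expr0n addr0.
pose mu := expR k * (`|k1| * (r2 ^+ 2 + 1)).
have mge : gpair r1 k1 r2 0 <= mu.
  move: dk; rewrite /horocycle_sdist horofun_hp// subr_le0.
  have /ordinary_gdet d0 := o1; have g2p := gpol_gt0 r2 0 o1.
  rewrite -[_ <= k]ler_expR lnK ?posrE ?divr_gt0 ?mulr_gt0 ?sqrtr_gt0//.
  move=> h; rewrite /mu -ler_pdivrMr ?mulr_gt0//.
  apply: le_trans h; rewrite le_eqVlt; apply/orP; left; apply/eqP.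
  rewrite gdet inner_hp_hp sqrtrM ?sqr_ge0// sqrtr_sqr.
  rewrite (_ : 4^-1 = (2^-1) ^+ 2); last by field.
  rewrite sqrtr_sqr (ger0_norm (_ : 0 <= 2^-1)) ?invr_ge0// !normrM normfV.
  rewrite (gtr0_norm (nsq1_gt0 r1 k1)) (ger0_norm (_ : 0 <= 2))//.
  rewrite /gpol ga_hp gc_hp gd_hp /gpair.
  by field; rewrite nsq1_neq0 normr_eq0 h1 gt_eqF.
exists (Num.sqrt (mu - gpair r1 k1 r2 0)).
have kE : parabolic_level r1 k1 r2 (Num.sqrt (mu - gpair r1 k1 r2 0)) = k.
  rewrite /parabolic_level sqr_sqrtr ?subr_ge0// addrC subrK /mu mulfK.
    by rewrite expRK.
  by rewrite gt_eqF// mulr_gt0.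
rewrite SE; apply/seteqP; split=> x [].
  by move=> ox h; split=> //; rewrite grange_parabolic// kE.
by move=> G ox; split=> //; rewrite -kE -grange_parabolic.
Qed.
End Range.

(** * Semidefinite binary forms and monic quadratics *)

Section SemidefiniteForms.
Variable R : realType.
Implicit Types p q s t u w : R.

Lemma cauchy2 u w s t : (u * s + w * t) ^+ 2 <= (u ^+ 2 + w ^+ 2) * (s ^+ 2 + t ^+ 2).
Proof. have := sqr_ge0 (u * t - w * s); lra. Qed.

(** The trace of the product of two positive semidefinite matrices. *)
Lemma psd_form_ge0 P S u w p q s t : 0 <= p -> 0 <= q ->
  s ^+ 2 + t ^+ 2 <= p * q -> u ^+ 2 + w ^+ 2 <= P * S -> 0 <= P + S ->
  0 <= P * p + S * q + 2 * (u * s + w * t).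
Proof.
move=> p0 q0 st uw PS0.
have uw0 : 0 <= u ^+ 2 + w ^+ 2 by rewrite addr_ge0 ?sqr_ge0.
have [P0 S0] := sum_prod_ge0 PS0 (le_trans uw0 uw).
have h : `|2 * (u * s + w * t)| <= P * p + S * q.
  have pp : 0 <= P * p + S * q by rewrite addr_ge0// mulr_ge0.
  rewrite -ler_sqr ?nnegrE// real_normK ?num_real//.
  have h1 := cauchy2 u w s t.
  have h2 : (u ^+ 2 + w ^+ 2) * (s ^+ 2 + t ^+ 2) <= (P * S) * (p * q).
    by apply: ler_pM => //; rewrite addr_ge0 ?sqr_ge0.
  have := sqr_ge0 (P * p - S * q); lra.
by move: h; rewrite ler_norml => /andP[h _]; lra.
Qed.

Lemma pd_form_eq0 P S u w p q s t : 0 <= p -> 0 <= q ->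
  s ^+ 2 + t ^+ 2 <= p * q -> u ^+ 2 + w ^+ 2 < P * S ->
  P * p + S * q + 2 * (u * s + w * t) = 0 -> p = 0 /\ q = 0.
Proof.
move=> p0 q0 st uw e.
have h1 := cauchy2 u w s t.
have h2 : (u ^+ 2 + w ^+ 2) * (s ^+ 2 + t ^+ 2) <= (u ^+ 2 + w ^+ 2) * (p * q).
  by rewrite ler_wpM2l// addr_ge0 ?sqr_ge0.
have h3 : (P * p + S * q) ^+ 2 = 4 * (u * s + w * t) ^+ 2.
  have -> : P * p + S * q = - (2 * (u * s + w * t)) by lra.
  ring.
have h4 := sqr_ge0 (P * p - S * q).
have PS0 : 0 < P * S by apply: le_lt_trans uw; rewrite addr_ge0 ?sqr_ge0.
have pq : p * q = 0.
  apply/eqP; rewrite eq_le mulr_ge0// andbT.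
  rewrite -(@pmulr_rle0 _ (P * S - (u ^+ 2 + w ^+ 2))) ?subr_gt0//; lra.
have P0 : P != 0 by apply: contraTneq PS0 => ->; rewrite mul0r ltxx.
have S0 : S != 0 by apply: contraTneq PS0 => ->; rewrite mulr0 ltxx.
have h5 : (u * s + w * t) ^+ 2 = 0.
  by apply/eqP; rewrite eq_le sqr_ge0 andbT; move: h2; rewrite pq mulr0; lra.
have h6 : P * p + S * q = 0.
  by apply/eqP; rewrite -[_ == _](expf_eq0 _ 2) h3 h5 mulr0.
have /orP[/eqP p00|/eqP q00] : (p == 0) || (q == 0) by rewrite -mulf_eq0 pq.
  move: h6; rewrite p00 mulr0 add0r => /eqP.
  by rewrite mulf_eq0 (negPf S0) => /eqP.
move: h6; rewrite q00 mulr0 addr0 => /eqP.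
by rewrite mulf_eq0 (negPf P0) => /eqP.
Qed.

(** If P != 0, the matrix of rank one built from the first row gives the value
    P times the determinant, which has the sign of - P. *)
Lemma indefinite_form P S u w : P * S < u ^+ 2 + w ^+ 2 ->
  exists p q s t, [/\ 0 <= p, 0 <= q, s ^+ 2 + t ^+ 2 <= p * q, 0 < p + q &
    0 < P * p + S * q + 2 * (u * s + w * t)].
Proof.
move=> h.
have uw0 : 0 <= u ^+ 2 + w ^+ 2 by rewrite addr_ge0 ?sqr_ge0.
have [P0|P0|P0] := ltgtP P 0.
- exists (u ^+ 2 + w ^+ 2), (P ^+ 2), (- P * u), (- P * w); split => //.
  + exact: sqr_ge0.
  + by rewrite le_eqVlt; apply/orP; left; apply/eqP; ring.
  + by rewrite ltr_wpDl// exprn_even_gt0//= lt_eqF.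
  + have -> : P * (u ^+ 2 + w ^+ 2) + S * P ^+ 2 + 2 * (u * (- P * u) + w * (- P * w))
     = (- P) * (u ^+ 2 + w ^+ 2 - P * S) by ring.
    by rewrite mulr_gt0 ?oppr_gt0 ?subr_gt0.
- exists 1, 0, 0, 0; split => //; rewrite ?expr0n /= ?mulr0 ?addr0 ?mulr1//.
  by rewrite !mulr0 addr0.
- rewrite P0 mul0r in h *.
  have [S0|S0|S0] := ltgtP S 0.
  + exists (S ^+ 2), (u ^+ 2 + w ^+ 2), (- S * u), (- S * w); split => //.
    * exact: sqr_ge0.
    * by rewrite le_eqVlt; apply/orP; left; apply/eqP; ring.
    * by rewrite ltr_wpDl// sqr_ge0.
    * have -> : 0 * S ^+ 2 + S * (u ^+ 2 + w ^+ 2) + 2 * (u * (- S * u) + w * (- S * w))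
       = (- S) * (u ^+ 2 + w ^+ 2) by ring.
      by rewrite mulr_gt0 ?oppr_gt0.
  + exists 0, 1, 0, 0; split => //; rewrite ?expr0n /= ?mulr0 ?addr0 ?mulr1 ?add0r//.
    by rewrite !mulr0 addr0.
  + exists (u ^+ 2 + w ^+ 2), 1, u, w; split => //; first by rewrite mulr1.
      by rewrite ltr_wpDl.
    have -> : 0 * (u ^+ 2 + w ^+ 2) + S * 1 + 2 * (u * u + w * w)
      = 2 * (u ^+ 2 + w ^+ 2) by rewrite S0; ring.
    by rewrite mulr_gt0.
Qed.

(** The difference of the two polynomials is affine, nonnegative at the roots of
    the first one and nonpositive at the roots of the second one; these pairs of
    roots bound the same interval. *)
Lemma monic_quadratic_eq B C B' C' x0 :
  x0 ^+ 2 + B * x0 + C <= 0 -> x0 ^+ 2 + B' * x0 + C' <= 0 ->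
  (forall x : R, x ^+ 2 + B * x + C < 0 <-> x ^+ 2 + B' * x + C' < 0) ->
  B = B' /\ C = C'.
Proof.
move=> h0 h0' H.
pose D := (B / 2) ^+ 2 - C; pose D' := (B' / 2) ^+ 2 - C'.
have fE x : x ^+ 2 + B * x + C = (x + B / 2) ^+ 2 - D by rewrite /D; field.
have fE' x : x ^+ 2 + B' * x + C' = (x + B' / 2) ^+ 2 - D' by rewrite /D'; field.
have D0 : 0 <= D by have := sqr_ge0 (x0 + B / 2); move: h0; rewrite fE; lra.
have D0' : 0 <= D' by have := sqr_ge0 (x0 + B' / 2); move: h0'; rewrite fE'; lra.
have [Dz|Dz] := eqVneq D 0.
  have D'z : D' = 0.
    apply/eqP; rewrite eq_le D0' andbT leNgt; apply/negP => D'p.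
    have /H : (- (B' / 2)) ^+ 2 + B' * - (B' / 2) + C' < 0.
      by rewrite fE' addNr expr0n /= sub0r oppr_lt0.
    rewrite fE Dz subr0 => h; have := sqr_ge0 (- (B' / 2) + B / 2); lra.
  have e1 : x0 + B / 2 = 0.
    apply/eqP; rewrite -[_ == _](expf_eq0 _ 2) eq_le sqr_ge0 andbT.
    by move: h0; rewrite fE Dz subr0.
  have e2 : x0 + B' / 2 = 0.
    apply/eqP; rewrite -[_ == _](expf_eq0 _ 2) eq_le sqr_ge0 andbT.
    by move: h0'; rewrite fE' D'z subr0.
  have BB : B = B' by lra.
  by split=> //; move: Dz D'z; rewrite /D /D' BB; lra.
have Dp : 0 < D by rewrite lt0r Dz.
pose m := - (B / 2); pose e := Num.sqrt D.
have e2 : e ^+ 2 = D by rewrite sqr_sqrtr.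
have ep : 0 < e by rewrite sqrtr_gt0.
have hm : m ^+ 2 + B' * m + C' < 0.
  by apply/H; rewrite fE /m addNr expr0n /= sub0r oppr_lt0.
have D'p : 0 < D' by have := sqr_ge0 (m + B' / 2); move: hm; rewrite fE'; lra.
pose m' := - (B' / 2); pose e' := Num.sqrt D'.
have e2' : e' ^+ 2 = D' by rewrite sqr_sqrtr.
(* l is the difference of the two polynomials, which is affine. *)
pose l x : R := (B' - B) * x + (C' - C).
have l1 x : x ^+ 2 + B * x + C = 0 -> 0 <= l x.
  move=> fx; have : ~ (x ^+ 2 + B * x + C < 0) by rewrite fx ltxx.
  by rewrite H => /negP; rewrite -leNgt /l; lra.
have l2 x : x ^+ 2 + B' * x + C' = 0 -> l x <= 0.
  move=> fx; have : ~ (x ^+ 2 + B' * x + C' < 0) by rewrite fx ltxx.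
  by rewrite -H => /negP; rewrite -leNgt /l; lra.
have lp : 0 <= l (m + e) by apply: l1; rewrite fE -e2 /m; ring.
have lm : 0 <= l (m - e) by apply: l1; rewrite fE -e2 /m; ring.
have lp' : l (m' + e') <= 0 by apply: l2; rewrite fE' -e2' /m'; ring.
have lm' : l (m' - e') <= 0 by apply: l2; rewrite fE' -e2' /m'; ring.
have ep' : 0 <= e' := sqrtr_ge0 _.
have mm : m' - e' <= m <= m' + e'.
  have : `|m - m'| <= e'.
    rewrite -ler_sqr ?nnegrE// real_normK ?num_real// e2'.
    by move: hm; rewrite fE' /m' opprK => h; lra.
  by rewrite ler_norml; lra.
have lm0 : l m = 0.
  apply/eqP; rewrite eq_le; apply/andP; split; last by move: lp lm; rewrite /l; lra.
  move: mm lp' lm'; rewrite /l => /andP[h1 h2] h3 h4.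
  by have [b0|b0] := leP 0 (B' - B); nra.
have BB : B' - B = 0.
  have h1 : 0 <= (B' - B) * e by move: lp lm0; rewrite /l; lra.
  have h2 : (B' - B) * e <= 0 by move: lm lm0; rewrite /l; lra.
  move: h1 h2; rewrite pmulr_lge0// pmulr_lle0// => *; lra.
by move: lm0; rewrite /l BB mul0r add0r; split; lra.
Qed.
End SemidefiniteForms.

(** * The dual conic and the uniqueness of foci *)

Section Duality.
Variable R : realType.
Implicit Types (v w F : R * R) (r k b al be gg x : R).

Definition dfun al be gg v : R := al * ga v + 2 * be * gc v + gg * gd v.

(** The functional of [dfun] at the lift (r^2 + k^2, r, 1). *)
Definition dlin r k al be gg : R := al * (r ^+ 2 + k ^+ 2) + 2 * be * r + gg.

(** The determinant of al A^H A + be (A + A^H) + gg, for triangular A; as a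
    form in al, be, gg it is the dual conic of the range. It is the product of
    the equations of the eigenpoints plus a multiple of the absolute, the dual
    description of a confocal family. *)
Definition dconic r1 k1 r2 k2 b al be gg : R :=
  dlin r1 k1 al be gg * dlin r2 k2 al be gg + b ^+ 2 * (al * gg - be ^+ 2).

Lemma dfun_cone r1 k1 r2 k2 b al be gg p q s t a c d :
  a = (r1 ^+ 2 + k1 ^+ 2) * p + (r2 ^+ 2 + k2 ^+ 2 + b ^+ 2) * q
        + 2 * b * (r1 * s - k1 * t) ->
  c = r1 * p + r2 * q + b * s -> d = p + q ->
  al * a + 2 * be * c + gg * d =
  dlin r1 k1 al be gg * p + (dlin r2 k2 al be gg + al * b ^+ 2) * q
  + 2 * (b * (al * r1 + be) * s + - (b * al * k1) * t).
Proof. by move=> -> -> ->; rewrite /dlin; ring. Qed.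

Lemma dconicE r1 k1 r2 k2 b al be gg :
  dconic r1 k1 r2 k2 b al be gg =
  dlin r1 k1 al be gg * (dlin r2 k2 al be gg + al * b ^+ 2)
  - ((b * (al * r1 + be)) ^+ 2 + (- (b * al * k1)) ^+ 2).
Proof. by rewrite /dconic /dlin; ring. Qed.

Lemma dconicN r1 k1 r2 k2 b al be gg :
  dconic r1 k1 r2 k2 b (- al) (- be) (- gg) = dconic r1 k1 r2 k2 b al be gg.
Proof. by rewrite /dconic /dlin; ring. Qed.

Lemma dfunN al be gg v : dfun (- al) (- be) (- gg) v = - dfun al be gg v.
Proof. by rewrite /dfun; ring. Qed.

(** If the Hermitian matrix is semidefinite, its quadratic form, which is the
    functional on the range, keeps its sign. *)
Lemma dconic_ge0_sign r1 k1 r2 k2 b al be gg v w :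
  grange r1 k1 r2 k2 b v -> grange r1 k1 r2 k2 b w ->
  0 <= dconic r1 k1 r2 k2 b al be gg ->
  dfun al be gg v < 0 -> 0 < dfun al be gg w -> False.
Proof.
wlog : al be gg v w / 0 <= dlin r1 k1 al be gg + (dlin r2 k2 al be gg + al * b ^+ 2).
  move=> W Gv Gw D0 vn wp.
  have [h|h] := leP 0 (dlin r1 k1 al be gg + (dlin r2 k2 al be gg + al * b ^+ 2)).
    exact: W h Gv Gw D0 vn wp.
  apply: (W (- al) (- be) (- gg) w v) => //.
  - by move: h; rewrite /dlin; lra.
  - by rewrite dconicN.
  - by rewrite dfunN oppr_lt0.
  - by rewrite dfunN oppr_gt0.
move=> h [p [q [s [t [p0 q0 st [aE cE dE]]]]]] _; rewrite dconicE subr_ge0 => D0.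
rewrite /dfun (dfun_cone _ _ _ aE cE dE) ltNge => /negP + _; apply.
exact: psd_form_ge0 D0 h.
Qed.

Lemma dconic_eq0 r1 k1 r2 k2 b al be gg v :
  grange r1 k1 r2 k2 b v -> dfun al be gg v = 0 ->
  dconic r1 k1 r2 k2 b al be gg <= 0.
Proof.
move=> [p [q [s [t [p0 q0 st [aE cE dE]]]]]].
rewrite /dfun (dfun_cone _ _ _ aE cE dE) dconicE => e.
rewrite leNgt subr_gt0; apply/negP => h.
have [p00 q00] := pd_form_eq0 p0 q0 st h e.
have /eqP := gaDgd v; rewrite aE dE p00 q00 !mulr0 !add0r !addr0.
move: st; rewrite p00 q00 mulr0 => st.
have s0 : s = 0.
  apply/eqP; rewrite -[_ == _](expf_eq0 _ 2) eq_le sqr_ge0 andbT.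
  by have := sqr_ge0 t; lra.
have t0 : t = 0.
  apply/eqP; rewrite -[_ == _](expf_eq0 _ 2) eq_le sqr_ge0 andbT.
  by have := sqr_ge0 s; lra.
by rewrite s0 t0 !mulr0 subr0 mulr0 eq_sym oner_eq0.
Qed.

Lemma ga_pt (a c d : R) : 0 < a + d ->
  ga (2 * c / (a + d), (a - d) / (a + d)) = a / (a + d).
Proof. by move=> h; rewrite /ga /=; field; rewrite gt_eqF. Qed.
Lemma gc_pt (a c d : R) : 0 < a + d ->
  gc (2 * c / (a + d), (a - d) / (a + d)) = c / (a + d).
Proof. by move=> h; rewrite /gc /=; field; rewrite gt_eqF. Qed.
Lemma gd_pt (a c d : R) : 0 < a + d ->
  gd (2 * c / (a + d), (a - d) / (a + d)) = d / (a + d).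
Proof. by move=> h; rewrite /gd /=; field; rewrite gt_eqF. Qed.

Lemma gram_coneZ r1 k1 r2 k2 b (a c d x : R) : 0 <= x ->
  gram_cone r1 k1 r2 k2 b a c d ->
  gram_cone r1 k1 r2 k2 b (a * x) (c * x) (d * x).
Proof.
move=> x0 [p [q [s [t [p0 q0 st [-> -> ->]]]]]].
exists (p * x), (q * x), (s * x), (t * x); split.
- exact: mulr_ge0.
- exact: mulr_ge0.
- by rewrite !exprMn -mulrDl mulrACA -expr2 ler_wpM2r// sqr_ge0.
- by split; ring.
Qed.

Lemma gram_coneD r1 k1 r2 k2 b a c d a' c' d' :
  gram_cone r1 k1 r2 k2 b a c d -> gram_cone r1 k1 r2 k2 b a' c' d' ->
  gram_cone r1 k1 r2 k2 b (a + a') (c + c') (d + d').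
Proof.
move=> [p [q [s [t [p0 q0 st [-> -> ->]]]]]].
move=> [p' [q' [s' [t' [p0' q0' st' [-> -> ->]]]]]].
exists (p + p'), (q + q'), (s + s'), (t + t'); split.
- exact: addr_ge0.
- exact: addr_ge0.
- have h : `|2 * (s * s' + t * t')| <= p * q' + p' * q.
    have pp : 0 <= p * q' + p' * q by rewrite addr_ge0// mulr_ge0.
    rewrite -ler_sqr ?nnegrE// real_normK ?num_real//.
    have h1 := cauchy2 s t s' t'.
    have h2 : (s ^+ 2 + t ^+ 2) * (s' ^+ 2 + t' ^+ 2) <= (p * q) * (p' * q').
      by apply: ler_pM => //; rewrite addr_ge0 ?sqr_ge0.
    have := sqr_ge0 (p * q' - p' * q); lra.
  by move: h; rewrite ler_norml => /andP[_ h]; lra.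
- by split; ring.
Qed.

Lemma grange_pt r1 k1 r2 k2 b a c d : 0 < a + d ->
  gram_cone r1 k1 r2 k2 b a c d ->
  grange r1 k1 r2 k2 b (2 * c / (a + d), (a - d) / (a + d)).
Proof.
move=> ad G; rewrite /grange /= ga_pt// gc_pt// gd_pt//.
by apply: gram_coneZ G; rewrite invr_ge0 ltW.
Qed.

Lemma affineE v w (t : R) :
  [/\ ga (affine v w t) = ga v * (1 - t) + ga w * t,
      gc (affine v w t) = gc v * (1 - t) + gc w * t
    & gd (affine v w t) = gd v * (1 - t) + gd w * t].
Proof. by rewrite /ga /gc /gd /affine /=; split; field. Qed.

(** The range is convex because membership in it allows all semidefinite
    matrices and not only those of rank one. *)
Lemma grange_convex r1 k1 r2 k2 b v w t : 0 <= t <= 1 ->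
  grange r1 k1 r2 k2 b v -> grange r1 k1 r2 k2 b w ->
  grange r1 k1 r2 k2 b (affine v w t).
Proof.
move=> /andP[t0 t1] Gv Gw; rewrite /grange /=.
have [-> -> ->] := affineE v w t.
by apply: gram_coneD; apply: gram_coneZ => //; rewrite subr_ge0.
Qed.

Lemma affine_ordinary v w (t : R) : 0 < t <= 1 -> inner v v <= 1 -> ordinary w ->
  ordinary (affine v w t).
Proof.
move=> /andP[t0 t1] hv; rewrite /ordinary /inner /affine /= => hw.
have h1 := inner_le1 hv (ltW hw); rewrite /inner in h1 hv.
have -> : (v.1 + t * (w.1 - v.1)) * (v.1 + t * (w.1 - v.1)) +
   (v.2 + t * (w.2 - v.2)) * (v.2 + t * (w.2 - v.2)) =
   (1 - t) ^+ 2 * (v.1 * v.1 + v.2 * v.2) + 2 * (t * (1 - t)) * (v.1 * w.1 + v.2 * w.2)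
   + t ^+ 2 * (w.1 * w.1 + w.2 * w.2) by ring.
have h2 : (1 - t) ^+ 2 * (v.1 * v.1 + v.2 * v.2) <= (1 - t) ^+ 2.
  by rewrite ler_piMr// sqr_ge0.
have h3 : 2 * (t * (1 - t)) * (v.1 * w.1 + v.2 * w.2) <= 2 * (t * (1 - t)).
  by rewrite ler_piMr// mulr_ge0// mulr_ge0 ?subr_ge0// ltW.
have h4 : t ^+ 2 * (w.1 * w.1 + w.2 * w.2) < t ^+ 2.
  by rewrite gtr_pMr// exprn_gt0.
lra.
Qed.

Lemma dfun_affine al be gg v w t :
  dfun al be gg (affine v w t) =
  dfun al be gg v + t * (dfun al be gg w - dfun al be gg v).
Proof. by rewrite /dfun; have [-> -> ->] := affineE v w t; ring. Qed.

(** A value of the wanted sign is first found somewhere in the range, then at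
    an ordinary point of the segment that leads to F. *)
Lemma dconic_lt0_pos r1 k1 r2 k2 b al be gg F :
  grange r1 k1 r2 k2 b F -> ordinary F ->
  dconic r1 k1 r2 k2 b al be gg < 0 ->
  exists v, [/\ grange r1 k1 r2 k2 b v, ordinary v & 0 < dfun al be gg v].
Proof.
move=> GF oF; rewrite dconicE subr_lt0.
move=> /indefinite_form[p [q [s [t [p0 q0 st pq L0]]]]].
set a := (r1 ^+ 2 + k1 ^+ 2) * p + (r2 ^+ 2 + k2 ^+ 2 + b ^+ 2) * q
            + 2 * b * (r1 * s - k1 * t).
set c := r1 * p + r2 * q + b * s.
have G : gram_cone r1 k1 r2 k2 b a c (p + q).
  by exists p, q, s, t; split.
have ad : 0 < a + (p + q).
  have := gram_cone_ge0 G 0; rewrite mulr0 mul0r expr0n /= mul0r subr0 addr0.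
  by move=> a0; rewrite ltr_wpDl.
pose w := (2 * c / (a + (p + q)), (a - (p + q)) / (a + (p + q))).
have Gw := grange_pt ad G; rewrite -/w in Gw.
have wL : 0 < dfun al be gg w.
  rewrite /dfun ga_pt// gc_pt// gd_pt//.
  have -> : al * (a / (a + (p + q))) + 2 * be * (c / (a + (p + q))) +
    gg * ((p + q) / (a + (p + q))) =
    (al * a + 2 * be * c + gg * (p + q)) / (a + (p + q)).
    by field; rewrite gt_eqF.
  by rewrite (@dfun_cone r1 k1 r2 k2 b al be gg p q s t) // divr_gt0.
have [LF|LF] := leP (dfun al be gg w) (dfun al be gg F).
  exists F; split=> //; exact: lt_le_trans wL LF.
pose y := dfun al be gg w / (2 * (dfun al be gg w - dfun al be gg F)).
have hy : 0 < 2 * (dfun al be gg w - dfun al be gg F) by lra.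
have [h|h] := leP (2^-1) y.
  exists (affine w F 2^-1); split.
  - by apply: grange_convex => //; lra.
  - by apply: affine_ordinary (grange_disk Gw) oF; lra.
  - rewrite dfun_affine; move: h; rewrite /y ler_pdivlMr// => h.
    by lra.
have y0 : 0 < y by rewrite divr_gt0.
exists (affine w F y); split.
- by apply: grange_convex => //; lra.
- by apply: affine_ordinary (grange_disk Gw) oF; lra.
- rewrite dfun_affine.
  have -> : dfun al be gg w + y * (dfun al be gg F - dfun al be gg w) =
    dfun al be gg w / 2.
    rewrite /y; field; move: hy; rewrite pmulr_rgt0// => /gt_eqF.
    by move/negbT.
  by rewrite divr_gt0.
Qed.

(** The negativity of the dual conic is thus determined by the ordinary points
    of the range. *)
Lemma dconic_lt0P r1 k1 r2 k2 b al be gg F :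
  grange r1 k1 r2 k2 b F -> ordinary F ->
  dconic r1 k1 r2 k2 b al be gg < 0 <->
  (exists v, [/\ grange r1 k1 r2 k2 b v, ordinary v & 0 < dfun al be gg v]) /\
  (exists v, [/\ grange r1 k1 r2 k2 b v, ordinary v & dfun al be gg v < 0]).
Proof.
move=> GF oF; split=> [D|[[v [Gv _ hv]] [w [Gw _ hw]]]].
  split; first exact: dconic_lt0_pos GF oF D.
  have [] := @dconic_lt0_pos r1 k1 r2 k2 b (- al) (- be) (- gg) F GF oF.
    by rewrite dconicN.
  by move=> v [Gv ov]; rewrite dfunN oppr_gt0 => h; exists v.
rewrite ltNge; apply/negP => D; exact: (dconic_ge0_sign Gw Gv D hw hv).
Qed.

Lemma gd_gt0 v : ordinary v -> 0 < gd v.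
Proof.
rewrite /ordinary /inner /gd => h; rewrite divr_gt0// subr_gt0.
rewrite ltNge; apply/negP => h1; have := sqr_ge0 v.1; nra.
Qed.

(** As a function of gg the dual conic is a monic quadratic polynomial, which
    [dconic_lt0P] and one value determine. *)
Lemma dconic_unique r1 k1 r2 k2 b r1' k1' r2' k2' b' F :
  grange r1 k1 r2 k2 b `&` @ordinary R
    = grange r1' k1' r2' k2' b' `&` @ordinary R ->
  grange r1 k1 r2 k2 b F -> ordinary F ->
  forall al be gg,
    dconic r1 k1 r2 k2 b al be gg = dconic r1' k1' r2' k2' b' al be gg.
Proof.
move=> E GF oF al be gg.
have GF' : grange r1' k1' r2' k2' b' F.
  by have : (grange r1 k1 r2 k2 b `&` @ordinary R) F by []; rewrite E => -[].
have E' v : grange r1 k1 r2 k2 b v /\ ordinary v <->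
            grange r1' k1' r2' k2' b' v /\ ordinary v.
  by have := congr1 (fun S => S v) E; rewrite /setI /= => ->.
pose B := al * (r1 ^+ 2 + k1 ^+ 2) + 2 * be * r1
  + (al * (r2 ^+ 2 + k2 ^+ 2) + 2 * be * r2) + b ^+ 2 * al.
pose C := (al * (r1 ^+ 2 + k1 ^+ 2) + 2 * be * r1)
  * (al * (r2 ^+ 2 + k2 ^+ 2) + 2 * be * r2) - b ^+ 2 * be ^+ 2.
pose B' := al * (r1' ^+ 2 + k1' ^+ 2) + 2 * be * r1'
  + (al * (r2' ^+ 2 + k2' ^+ 2) + 2 * be * r2') + b' ^+ 2 * al.
pose C' := (al * (r1' ^+ 2 + k1' ^+ 2) + 2 * be * r1')
  * (al * (r2' ^+ 2 + k2' ^+ 2) + 2 * be * r2') - b' ^+ 2 * be ^+ 2.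
have dE x : dconic r1 k1 r2 k2 b al be x = x ^+ 2 + B * x + C.
  by rewrite /dconic /dlin /B /C; ring.
have dE' x : dconic r1' k1' r2' k2' b' al be x = x ^+ 2 + B' * x + C'.
  by rewrite /dconic /dlin /B' /C'; ring.
have dF := gd_gt0 oF.
pose x0 := - (al * ga F + 2 * be * gc F) / gd F.
have x0E : dfun al be x0 F = 0.
  by rewrite /dfun /x0 divfK ?subrr// gt_eqF.
suff [BB CC] : B = B' /\ C = C' by rewrite dE dE' BB CC.
apply: (@monic_quadratic_eq _ _ _ _ _ x0).
- by rewrite -dE; exact: dconic_eq0 GF x0E.
- by rewrite -dE'; exact: dconic_eq0 GF' x0E.
move=> x; rewrite -dE -dE' (dconic_lt0P _ _ _ GF oF) (dconic_lt0P _ _ _ GF' oF).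
by split=> -[[v [Gv ov hv]] [w [Gw ow hw]]]; split;
  [exists v|exists w|exists v|exists w]; split=> //;
  have [] := E' v; have [] := E' w; tauto.
Qed.

Lemma hp_eq r k r' k' : r = r' -> r ^+ 2 + k ^+ 2 = r' ^+ 2 + k' ^+ 2 ->
  hp r k = hp r' k'.
Proof. by rewrite /hp => -> ->. Qed.

(** Compare the two dual conics. At a functional that annihilates the lifts of
    [hp r1 k1] and [hp r1' k1'] both products vanish, and the absolute does not,
    because the second point is ordinary; so b and b' have the same square. What
    remains is an equality of two products of two linear forms. *)
Lemma focus_unique r1 k1 r2 k2 b r1' k1' r2' k2' b' F :
  grange r1 k1 r2 k2 b `&` @ordinary R
    = grange r1' k1' r2' k2' b' `&` @ordinary R ->
  grange r1 k1 r2 k2 b F -> ordinary F -> k1' != 0 ->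
  hp r1' k1' = hp r1 k1 \/ hp r1' k1' = hp r2 k2.
Proof.
move=> E GF oF k0.
have H := dconic_unique E GF oF.
have bb : b ^+ 2 = b' ^+ 2.
  pose n1 := r1 ^+ 2 + k1 ^+ 2; pose n1' := r1' ^+ 2 + k1' ^+ 2.
  have Z al be : (al != 0) || (be != 0) -> al * (n1 - n1') + 2 * be * (r1 - r1') = 0 ->
     b ^+ 2 = b' ^+ 2.
    move=> ab e; pose g := - (al * n1' + 2 * be * r1').
    have h1' : dlin r1' k1' al be g = 0 by rewrite /dlin /g /n1'; ring.
    have h1 : dlin r1 k1 al be g = 0.
      rewrite /dlin /g -/n1 -[RHS]e; ring.
    have := H al be g; rewrite /dconic h1 h1' !mul0r !add0r.
    have eta : al * g - be ^+ 2 = - ((be + al * r1') ^+ 2 + (al * k1') ^+ 2).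
      by rewrite /g /n1'; ring.
    apply: mulIf; rewrite eta oppr_eq0 paddr_eq0 ?sqr_ge0// !expf_eq0 /=.
    apply/negP => /andP[/eqP h2]; rewrite mulf_eq0 (negPf k0) orbF => /eqP a0.
    by move: ab; rewrite a0 eqxx /=; move: h2; rewrite a0 mul0r addr0 => ->;
       rewrite eqxx.
  have [e1|e1] := eqVneq r1 r1'; last first.
    apply: (Z (2 * (r1' - r1)) (n1 - n1')); last by ring.
    by rewrite mulf_neq0// subr_eq0 eq_sym.
  have [e2|e2] := eqVneq n1 n1'; last first.
    apply: (Z (2 * (r1' - r1)) (n1 - n1')); last by ring.
    by rewrite orbC subr_eq0 e2.
  by apply: (Z 1 0); rewrite ?oner_eq0// e1 e2; ring.
pose n1 := r1 ^+ 2 + k1 ^+ 2; pose n1' := r1' ^+ 2 + k1' ^+ 2.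
pose n2 := r2 ^+ 2 + k2 ^+ 2; pose n2' := r2' ^+ 2 + k2' ^+ 2.
have dE al be g : (al * n1 + 2 * be * r1 + g) * (al * n2 + 2 * be * r2 + g)
  = (al * n1' + 2 * be * r1' + g) * (al * n2' + 2 * be * r2' + g).
  by have := H al be g; rewrite /dconic bb /dlin -/n1 -/n1' -/n2 -/n2' => /addIr.
have rr : r1 * r2 = r1' * r2'.
  by have := dE 0 1 0; lra.
have nn : n1 * n2 = n1' * n2' by have := dE 1 0 0; lra.
have rs : r1 + r2 = r1' + r2' by have := dE 0 1 1; lra.
have ns : n1 + n2 = n1' + n2' by have := dE 1 0 1; lra.
have rn : r1 * n2 + r2 * n1 = r1' * n2' + r2' * n1' by have := dE 1 1 0; lra.
have fr : (r1' - r1) * (r1' - r2) = 0.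
  have -> : (r1' - r1) * (r1' - r2) = r1' ^+ 2 - r1' * (r1 + r2) + r1 * r2 by ring.
  by rewrite rs rr; ring.
have fn : (n1' - n1) * (n1' - n2) = 0.
  have -> : (n1' - n1) * (n1' - n2) = n1' ^+ 2 - n1' * (n1 + n2) + n1 * n2 by ring.
  by rewrite ns nn; ring.
have [r12|r12] := eqVneq r1 r2.
  have e1 : r1' = r1.
    apply/eqP; rewrite -subr_eq0 -[_ == _](expf_eq0 _ 2) expr2.
    by rewrite {2}r12 fr.
  move/eqP: fn; rewrite mulf_eq0 !subr_eq0 => /orP[/eqP e|/eqP e].
    by left; exact: hp_eq.
  by right; apply: hp_eq => //; rewrite -r12.
have r12' : r1 - r2 != 0 by rewrite subr_eq0.
move/eqP: fr; rewrite mulf_eq0 !subr_eq0 => /orP[/eqP e|/eqP e].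
  left; apply: hp_eq => //; apply/eqP; rewrite -subr_eq0 -/n1 -/n1'.
  have e2 : r2' = r2 by lra.
  have : (r1 - r2) * (n1' - n1) = 0.
    by move: rn; rewrite e e2 (_ : n2' = n1 + n2 - n1'); last lra; lra.
  by move/eqP; rewrite mulf_eq0 (negPf r12').
right; apply: hp_eq => //; apply/eqP; rewrite -subr_eq0 -/n2 -/n1'.
have e2 : r2' = r1 by lra.
have : (r1 - r2) * (n1' - n2) = 0.
  by move: rn; rewrite e e2 (_ : n2' = n1 + n2 - n1'); last lra; lra.
by move/eqP; rewrite mulf_eq0 (negPf r12').
Qed.
End Duality.

(** * The foci of the range *)

Section Foci.
Variable R : realType.
Implicit Types (v w x F p : R * R) (r k b : R).

(** Boundedness of the operator keeps the range away from (0, 1), the image of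
    infinity and the only asymptotic point that is not of the form [hp r 0]. *)
Lemma grange_bounded r1 k1 r2 k2 b : exists2 N : R, 0 <= N &
  forall v, grange r1 k1 r2 k2 b v -> ga v <= N * gd v.
Proof.
pose n1 := r1 ^+ 2 + k1 ^+ 2; pose n2 := r2 ^+ 2 + k2 ^+ 2.
have n10 : 0 <= n1 by rewrite addr_ge0 ?sqr_ge0.
have n20 : 0 <= n2 by rewrite addr_ge0 ?sqr_ge0.
have b20 := sqr_ge0 b.
exists (2 * n1 + n2 + 2 * b ^+ 2); first by lra.
move=> v [p [q [s [t [p0 q0 st [-> _ ->]]]]]]; rewrite -/n1 -/n2.
have : 0 <= n1 * p + b ^+ 2 * q + 2 * ((- (b * r1)) * s + (b * k1) * t).
  apply: psd_form_ge0 => //; last by rewrite addr_ge0.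
  by rewrite le_eqVlt; apply/orP; left; apply/eqP; rewrite /n1; ring.
have h1 := mulr_ge0 n10 q0; have h2 := mulr_ge0 n20 p0.
have h3 := mulr_ge0 b20 p0.
by move: h1 h2 h3; lra.
Qed.

(** Along the h-ray from F to p the distance from F grows exactly as fast as
    the Busemann function of p decreases; so an elliptic parabolic disk contains
    the ray joining its focus to its asymptotic point. *)
Lemma ray_parabolic F p k (t : R) : ordinary F -> asymptotic p ->
  horocycle_sdist p k F <= 0 -> 0 <= t < 1 ->
  let x := affine F p t in
  ordinary x /\ hdist F x + horocycle_sdist p k x <= 0.
Proof.
move=> oF ap; rewrite /horocycle_sdist subr_le0 => hk /andP[t0 t1].
set x := affine F p t.
pose phi := 1 - inner F F; pose h := 1 - inner F p.
have phi0 : 0 < phi by apply/ordinaryP.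
have h0 : 0 < h by apply: inner_lt1; rewrite ?ap.
have u0 : 0 < 1 - t by rewrite subr_gt0.
pose m := (1 - t) * phi + 2 * t * h.
have m0 : 0 < m by rewrite ltr_pwDl ?mulr_gt0// mulr_ge0 ?mulr_ge0// ltW.
have xx : 1 - inner x x = (1 - t) * m.
  have -> : 1 - inner x x = (1 - t) * m + t ^+ 2 * (1 - inner p p).
    by rewrite /x /m /phi /h /inner /affine /=; ring.
  by rewrite ap subrr mulr0 addr0.
have ox : ordinary x by apply/ordinaryP; rewrite xx mulr_gt0.
split=> //.
have Fx : 1 - inner F x = (1 - t) * phi + t * h.
  by rewrite /x /phi /h /inner /affine /=; ring.
have xp : 1 - inner x p = (1 - t) * h.
  have -> : 1 - inner x p = (1 - t) * h + t * (1 - inner p p).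
    by rewrite /x /h /inner /affine /=; ring.
  by rewrite ap subrr mulr0 addr0.
rewrite addrA subr_le0; apply: le_trans hk.
rewrite -lerBrDr /horofun -/phi -/h xx xp.
set s := Num.sqrt phi; set y := Num.sqrt ((1 - t) * m).
have s0 : 0 < s by rewrite sqrtr_gt0.
have y0 : 0 < y by rewrite sqrtr_gt0 mulr_gt0.
have s2 : s ^+ 2 = phi by rewrite sqr_sqrtr// ltW.
have y2 : y ^+ 2 = (1 - t) * m by rewrite sqr_sqrtr// ltW// mulr_gt0.
rewrite -ln_div ?posrE ?divr_gt0 ?mulr_gt0//.
have E : h / s / ((1 - t) * h / y) = y / ((1 - t) * s).
  by field; rewrite !gt_eqF.
rewrite hdistE E arcosh_le_ln ?hcosh_ge1//; last by rewrite divr_gt0// mulr_gt0.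
rewrite /hcosh -/phi xx -/s -/y Fx; apply/andP; split.
  rewrite ler_pdivrMr ?mulr_gt0//.
  have -> : y / ((1 - t) * s) * (s * y) = y ^+ 2 / (1 - t).
    by field; rewrite !gt_eqF.
  rewrite y2 [leRHS]mulrC mulKf ?gt_eqF// /m.
  by have := mulr_ge0 t0 (ltW h0); lra.
rewrite le_eqVlt; apply/orP; left; apply/eqP.
have -> : (y / ((1 - t) * s)) ^+ 2 = m / ((1 - t) * phi).
  by rewrite expr_div_n exprMn y2 s2; field; rewrite !gt_eqF.
have -> : 2 * (((1 - t) * phi + t * h) / (s * y)) * (y / ((1 - t) * s)) =
  2 * ((1 - t) * phi + t * h) / ((1 - t) * phi).
  by set X := _ + t * h; rewrite -s2; field; rewrite !gt_eqF.
by rewrite /m; field; rewrite !gt_eqF.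
Qed.

Lemma ordinary_hpE v : ordinary v -> exists r k, v = hp r k /\ k != 0.
Proof.
move=> ov; have [] := @hp_surj R v (ltW ov).
  by have := gd_gt0 ov; rewrite /gd pmulr_lgt0 ?invr_gt0// subr_gt0 => /lt_eqF/negbT.
by move=> r [k [e _]]; exists r, k; split=> //; apply/(ordinary_hpP r); rewrite -e.
Qed.

Lemma asymptotic_hpE v : asymptotic v -> v.2 != 1 -> exists r, v = hp r 0.
Proof.
move=> av v1; have [|r [k [e _]]] := @hp_surj R v _ v1; first by rewrite av.
exists r; rewrite {1}e; have [->//|k0] := eqVneq k 0.
by have := ordinary_hp r k0; rewrite -e /ordinary av ltxx.
Qed.

Lemma elliptical_focus F F' S : ordinary F -> is_elliptical_disk S F F' -> S F.
Proof.
move=> oF [m [dm ->]]; split=> //.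
by rewrite hdist_id// add0r hdistC.
Qed.

Lemma parabolic_focus F p S :
  ordinary F -> is_elliptic_parabolic_disk S F p -> S F.
Proof.
move=> oF [k [dk E]]; suff : (S `&` @ordinary R) F by case.
by rewrite E; split=> //; rewrite hdist_id// add0r.
Qed.

(** A synthetic disk with an ordinary focus F is itself a range that has F as
    an eigenpoint, so [focus_unique] applies; an asymptotic point (0, 1) is
    excluded because the disk would contain the ray leading to it. *)
Lemma foci_grange r1 k1 r2 k2 b :
  foci (grange r1 k1 r2 k2 b) = [set hp r1 k1; hp r2 k2].
Proof.
apply/seteqP; split=> [F|F].
  move=> [[GF aF]|[oF [F' [oF' E]]]|[oF [p [ap E]]]].
  - by have [[_ ->]|[_ ->]] := grange_asymptotic GF aF; [left|right].
  - have GF := elliptical_focus oF E.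
    have [r [k [FE k0]]] := ordinary_hpE oF.
    have [r' [k' [FE' k0']]] := ordinary_hpE oF'.
    rewrite FE FE' in E; have [b' Gb] := elliptical_is_grange k0 k0' E.
    have := @focus_unique R r1 k1 r2 k2 b r k r' k' b' F.
    by rewrite -Gb FE => /(_ erefl); rewrite -FE => /(_ GF oF k0).
  - have GF := parabolic_focus oF E.
    have [r [k [FE k0]]] := ordinary_hpE oF.
    have p1 : p.2 != 1.
      apply/negP => /eqP p1.
      have [N N0 HN] := grange_bounded r1 k1 r2 k2 b.
      have [lev [dk SE]] := E.
      have dF := gd_gt0 oF.
      pose y := gd F * (N + 2).
      pose t := 1 - (N + 2)^-1.
      have N2 : 1 < N + 2 by lra.
      have t01 : 0 <= t < 1.
        rewrite /t subr_ge0 invf_le1 ?(lt_trans ltr01)// (ltW N2) /=.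
        by rewrite ltrBlDr ltrDl invr_gt0; lra.
      have [ox hx] := ray_parabolic oF ap dk t01.
      have : (grange r1 k1 r2 k2 b `&` @ordinary R) (affine F p t).
        by rewrite SE.
      move=> -[/HN + _].
      have [_ _] := affineE F p t.
      have -> : gd p = 0 by rewrite /gd p1 subrr mul0r.
      rewrite mul0r addr0 => gE.
      have -> : ga (affine F p t) = 1 - gd (affine F p t).
        by rewrite -(gaDgd (affine F p t)) addrK.
      have gF1 : gd F <= 1.
        rewrite /gd; move: oF; rewrite /ordinary /inner => oF.
        have := sqr_ge0 F.1; have := sqr_ge0 (F.2 + 1); lra.
      have {}gE : gd (affine F p t) = gd F / (N + 2).
        by rewrite gE /t; ring.
      rewrite gE.
      have -> : 1 - gd F / (N + 2) = ((N + 2) - gd F) / (N + 2).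
        by field; rewrite gt_eqF//; lra.
      rewrite mulrA ler_pM2r ?invr_gt0; last by lra.
      have := ler_wpM2l N0 gF1; lra.
    have [r' pE] := asymptotic_hpE ap p1.
    rewrite FE pE in E; have [b' Gb] := parabolic_is_grange k0 E.
    have := @focus_unique R r1 k1 r2 k2 b r k r' 0 b' F.
    by rewrite Gb FE => /(_ erefl); rewrite -FE => /(_ GF oF k0).
suff H r1' k1' r2' k2' : foci (grange r1' k1' r2' k2' b) (hp r1' k1').
  by case=> ->; [exact: H|rewrite grangeC; exact: H].
have [->|k0] := eqVneq k1' 0.
  by apply: Or31; split; [exact: grange_hp1|exact: asymptotic_hp].
have [->|k0'] := eqVneq k2' 0.
  apply: Or33; split; first exact: ordinary_hp.
  by exists (hp r2' 0); split; [exact: asymptotic_hp|exact: grange_is_parabolic].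
apply: Or32; split; first exact: ordinary_hp.
by exists (hp r2' k2'); split; [exact: ordinary_hp|exact: grange_is_elliptical].
Qed.
End Foci.

(** * Hyperbolic segments *)

Section Segments.
Variable R : realType.
Implicit Types (v w x c : R * R) (r k b t : R).

Lemma gpt_inj v w : gc v = gc w -> gd v = gd w -> v = w.
Proof.
case: v w => x z [x' z']; rewrite /gc /gd /= => h1 h2.
by congr pair; lra.
Qed.

Lemma grange_normal r1 k1 r2 k2 :
  grange r1 k1 r2 k2 0 = hsegment (hp r1 k1) (hp r2 k2).
Proof.
apply/seteqP; split=> [v|v [t t01 ->]]; last first.
  by apply: grange_convex; [|exact: grange_hp1|exact: grange_hp2].
rewrite /grange /= -gram_cone_line => -[p [q [p0 q0 [aE cE dE]]]].
pose n1 := r1 ^+ 2 + k1 ^+ 2 + 1; pose n2 := r2 ^+ 2 + k2 ^+ 2 + 1.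
have n10 : 0 < n1 := nsq1_gt0 r1 k1; have n20 : 0 < n2 := nsq1_gt0 r2 k2.
have e : n1 * p + n2 * q = 1.
  by rewrite -(gaDgd v) aE dE /n1 /n2; ring.
have np0 : 0 <= n1 * p by rewrite mulr_ge0// ltW.
have nq0 : 0 <= n2 * q by rewrite mulr_ge0// ltW.
have pE : p = (1 - n2 * q) / n1.
  by rewrite -e addrK mulrC mulKf// gt_eqF.
exists (n2 * q); first by apply/andP; split=> //; lra.
have [_ h1 h2] := affineE (hp r1 k1) (hp r2 k2) (n2 * q).
apply: gpt_inj.
  rewrite h1 cE !gc_hp -/n1 -/n2 pE; field.
  by rewrite !gt_eqF.
rewrite h2 dE !gd_hp -/n1 -/n2 pE; field.
by rewrite !gt_eqF.
Qed.

(** A segment is a degenerate elliptical disk, hence a metric notion: isometries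
    preserve segments without any appeal to projective maps. *)
Lemma hsegment_metric v w : ordinary v -> ordinary w ->
  hsegment v w = [set x | ordinary x /\ hdist v x + hdist w x <= hdist v w].
Proof.
move=> /ordinary_hpE[r1 [k1 [-> h1]]] /ordinary_hpE[r2 [k2 [-> h2]]].
by rewrite -grange_normal grange_elliptical// -hcosh_hp_hp.
Qed.

Lemma hsegmentC v w : hsegment v w = hsegment w v.
Proof.
suff H v' w' : hsegment v' w' `<=` hsegment w' v' by apply/seteqP; split; exact: H.
move=> x [t /andP[t0 t1] ->]; exists (1 - t); first by apply/andP; split; lra.
by rewrite /affine; congr pair; ring.
Qed.

Lemma hsegment_l v w : hsegment v w v.
Proof.
exists 0; first by rewrite lexx ler01.
by rewrite /affine !mul0r !addr0; case: v.
Qed.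

Lemma hsegment_r v w : hsegment v w w.
Proof. by rewrite hsegmentC; exact: hsegment_l. Qed.

Lemma hsegment_id v x : hsegment v v x -> x = v.
Proof.
by move=> [t _ ->]; rewrite /affine !subrr !mulr0 !addr0; case: v.
Qed.

End Segments.

(** * Isometries of the hyperbolic plane *)

Section Isometries.
Variable R : realType.
Implicit Types (v w x y c h : R * R) (S T : set (R * R)) (g : R * R -> R * R) (r t : R).

(** Isometries are only required to be metric: so are all notions that enter the
    definition of the minor axis. *)
Definition isometry_pair g g' : Prop :=
  [/\ forall x, ordinary x -> ordinary (g x) /\ g' (g x) = x,
      forall x, ordinary x -> ordinary (g' x) /\ g (g' x) = x
    & forall x y, ordinary x -> ordinary y -> hdist (g x) (g y) = hdist x y].

Lemma isometry_pair_comp g1 g1' g2 g2' : isometry_pair g1 g1' ->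
  isometry_pair g2 g2' -> isometry_pair (g2 \o g1) (g1' \o g2').
Proof.
move=> [a1 b1 c1] [a2 b2 c2]; split=> [x ox|x ox|x y ox oy] /=.
- have [oo1 e1] := a1 x ox; have [oo2 e2] := a2 _ oo1.
  by rewrite e2 e1.
- have [oo1 e1] := b2 x ox; have [oo2 e2] := b1 _ oo1.
  by rewrite e2 e1.
- have [oo1 _] := a1 x ox; have [oo2 _] := a1 y oy.
  by rewrite c2// c1.
Qed.

(** In the hyperboloid model this is X |-> - X + 2 <X, H> / <H, H> H, where H
    is the lift of h; it is an involution and needs no square root. *)
Definition point_reflection h x : R * R :=
  let N := inner h h + 1 - 2 * inner x h in
  ((2 * (1 - inner x h) * h.1 - (1 - inner h h) * x.1) / N,
   (2 * (1 - inner x h) * h.2 - (1 - inner h h) * x.2) / N).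

Lemma point_reflection_den h x : ordinary h -> ordinary x ->
  0 < inner h h + 1 - 2 * inner x h.
Proof.
rewrite /ordinary /inner => oh ox.
have := sqr_ge0 (x.1 - h.1); have := sqr_ge0 (x.2 - h.2); lra.
Qed.

Lemma point_reflection_inner h x y : ordinary h -> ordinary x -> ordinary y ->
  1 - inner (point_reflection h x) (point_reflection h y) =
  (1 - inner h h) ^+ 2 * (1 - inner x y) /
   ((inner h h + 1 - 2 * inner x h) * (inner h h + 1 - 2 * inner y h)).
Proof.
move=> oh ox oy.
have := point_reflection_den oh ox; have := point_reflection_den oh oy.
rewrite /point_reflection /inner /= => h1 h2.
by field; rewrite !gt_eqF.
Qed.

Lemma point_reflection_ordinary h x : ordinary h -> ordinary x ->
  ordinary (point_reflection h x).
Proof.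
move=> oh ox; apply/ordinaryP; rewrite point_reflection_inner//.
have d := point_reflection_den oh ox.
have /ordinaryP ph := oh; have /ordinaryP px := ox.
by rewrite divr_gt0// mulr_gt0// exprn_gt0.
Qed.

Lemma point_reflectionK h x : ordinary h -> ordinary x ->
  point_reflection h (point_reflection h x) = x.
Proof.
move=> oh ox.
have d := point_reflection_den oh ox.
have d' := point_reflection_den oh (point_reflection_ordinary oh ox).
have /ordinaryP ph := oh.
have dE : inner h h + 1 - 2 * inner (point_reflection h x) h =
  (1 - inner h h) ^+ 2 / (inner h h + 1 - 2 * inner x h).
  move: d; rewrite /point_reflection /inner /= => d; field.
  by rewrite gt_eqF.
have xE : 1 - inner (point_reflection h x) h =
  (1 - inner h h) * (1 - inner x h) / (inner h h + 1 - 2 * inner x h).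
  move: d; rewrite /point_reflection /inner /= => d; field.
  by rewrite gt_eqF.
rewrite [LHS]/point_reflection dE xE /point_reflection /=.
rewrite {d' dE xE} [RHS]surjective_pairing.
move: ph d; move: (inner h h) (inner x h) => H X H0 N0.
by congr pair; field; rewrite !gt_eqF.
Qed.

Lemma point_reflection_isometry h : ordinary h ->
  isometry_pair (point_reflection h) (point_reflection h).
Proof.
move=> oh; have H x : ordinary x -> ordinary (point_reflection h x) /\
    point_reflection h (point_reflection h x) = x.
  by move=> ox; split; [exact: point_reflection_ordinary|exact: point_reflectionK].
split=> // x y ox oy; rewrite !hdistE; congr arcosh; rewrite /hcosh.
rewrite !point_reflection_inner//.
have dx := point_reflection_den oh ox; have dy := point_reflection_den oh oy.
have /ordinaryP ph := oh; have /ordinaryP px := ox; have /ordinaryP py := oy.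
have sE z : ordinary z -> Num.sqrt ((1 - inner h h) ^+ 2 * (1 - inner z z) /
   ((inner h h + 1 - 2 * inner z h) * (inner h h + 1 - 2 * inner z h))) =
   (1 - inner h h) / (inner h h + 1 - 2 * inner z h) * Num.sqrt (1 - inner z z).
  move=> oz; have dz := point_reflection_den oh oz.
  rewrite -expr2 mulrAC -expr_div_n sqrtrM ?sqr_ge0// sqrtr_sqr.
  by rewrite ger0_norm// divr_ge0// ltW.
rewrite !sE//.
have sx := sqrt_gt0_ord ox; have sy := sqrt_gt0_ord oy.
by field; rewrite !gt_eqF.
Qed.

(** The reflection is in the midpoint of c and the centre. *)
Lemma centre_isometry c : ordinary c ->
  exists g, isometry_pair g g /\ g c = (0, 0).
Proof.
move=> oc; have /ordinaryP pc := oc.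
have sc := sqrt_gt0_ord oc; set s := Num.sqrt _ in sc.
have s2 : s ^+ 2 = 1 - inner c c by rewrite sqr_sqrtr// ltW.
have s10 : 0 < 1 + s by rewrite addr_gt0.
pose h : R * R := (c.1 / (1 + s), c.2 / (1 + s)).
have cc : inner c c = (1 - s) * (1 + s).
  by rewrite -[inner c c](subKr 1) -s2; ring.
have hh : inner h h = (1 - s) / (1 + s).
  have -> : inner h h = inner c c / (1 + s) ^+ 2.
    by rewrite /inner /h /=; field; rewrite gt_eqF.
  by rewrite cc; field; rewrite gt_eqF.
have oh : ordinary h.
  by rewrite /ordinary hh ltr_pdivrMr//; lra.
exists (point_reflection h); split; first exact: point_reflection_isometry.
have ch : inner c h = 1 - s.
  have -> : inner c h = inner c c / (1 + s).
    by rewrite /inner /h /=; field; rewrite gt_eqF.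
  by rewrite cc; field; rewrite gt_eqF.
rewrite /point_reflection hh ch; congr pair; rewrite /h /=.
  by rewrite [X in X / _](_ : _ = 0) ?mul0r//; field; rewrite gt_eqF.
by rewrite [X in X / _](_ : _ = 0) ?mul0r//; field; rewrite gt_eqF.
Qed.

Definition rotation (a b : R) x : R * R := (a * x.1 + b * x.2, a * x.2 - b * x.1).

Lemma rotation_isometry (a b : R) : a ^+ 2 + b ^+ 2 = 1 ->
  isometry_pair (rotation a b) (rotation a (- b)).
Proof.
move=> ab.
have I (b' : R) x y : a ^+ 2 + b' ^+ 2 = 1 ->
    inner (rotation a b' x) (rotation a b' y) = inner x y.
  move=> ab'; rewrite -[RHS]mul1r -ab' /inner /rotation /=; ring.
have K (b' : R) x : a ^+ 2 + b' ^+ 2 = 1 ->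
    rotation a (- b') (rotation a b' x) = x.
  move=> ab'; case: x => x1 x2; rewrite /rotation /=.
  by congr pair; [rewrite -[RHS]mul1r|rewrite -[RHS]mul1r]; rewrite -ab'; ring.
have abN : a ^+ 2 + (- b) ^+ 2 = 1 by rewrite sqrrN.
split=> [x ox|x ox|x y ox oy].
- by split; [rewrite /ordinary I|rewrite K].
- by split; [rewrite /ordinary I|rewrite -{1}[b]opprK K].
- by rewrite !hdistE /hcosh !I.
Qed.

Definition pullback g T : set (R * R) := [set x | ordinary x /\ T (g x)].

Lemma pullback_sub g g' T T' : isometry_pair g g' -> T `<=` @ordinary R ->
  pullback g T `<=` pullback g T' -> T `<=` T'.
Proof.
move=> [_ b1 _] To H x Tx; have ox := To x Tx; have [og e] := b1 x ox.
have [|_] := H (g' x); last by rewrite e.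
by split=> //; rewrite e.
Qed.

Lemma pullback_hsegment g g' v w : isometry_pair g g' ->
  ordinary v -> ordinary w ->
  hsegment v w = pullback g (hsegment (g v) (g w)).
Proof.
move=> [a1 _ c1] ov ow; have [oo1 _] := a1 v ov; have [oo2 _] := a1 w ow.
rewrite !hsegment_metric//; apply/seteqP; split=> x; rewrite /pullback /=.
  by move=> [ox h]; have [oo3 _] := a1 x ox; rewrite !c1.
by move=> [ox [_ h]]; move: h; rewrite !c1.
Qed.

Lemma pullback_hdisk g g' c r : isometry_pair g g' -> ordinary c ->
  hdisk c r = pullback g (hdisk (g c) r).
Proof.
move=> [a1 _ c1] oc; apply/seteqP; split=> x; rewrite /pullback /hdisk /=.
  by move=> [ox h]; have [oo3 _] := a1 x ox; rewrite !c1.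
by move=> [ox [_ h]]; move: h; rewrite !c1.
Qed.

Lemma pullback_bisector g g' v w : isometry_pair g g' ->
  ordinary v -> ordinary w ->
  perp_bisector v w = pullback g (perp_bisector (g v) (g w)).
Proof.
move=> [a1 _ c1] ov ow; apply/seteqP; split=> x; rewrite /pullback /perp_bisector /=.
  by move=> [ox h]; have [oo3 _] := a1 x ox; rewrite !c1.
by move=> [ox [_ h]]; move: h; rewrite !c1.
Qed.

Lemma hsegment_sub_ordinary v w : ordinary v -> ordinary w ->
  hsegment v w `<=` @ordinary R.
Proof. by move=> ov ow; rewrite hsegment_metric// => x []. Qed.

Lemma pullback_minor_axis g g' T u u' : isometry_pair g g' ->
  T `<=` @ordinary R -> ordinary u -> ordinary u' -> is_minor_axis T u u' ->
  is_minor_axis (pullback g T) (g' u) (g' u').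
Proof.
move=> I To ou ou' [v [w [[c [r [[oc r0 Tc Tmin] D vwT vwmax]] uu]]]].
have [a1 b1 c1] := I.
have [ov ow cvw dv dw] := D.
have [ogc ec] := b1 c oc; have [ogv ev] := b1 v ov; have [ogw ew] := b1 w ow.
have [ogu eu] := b1 u ou; have [ogu' eu'] := b1 u' ou'.
exists (g' v), (g' w); split; last first.
  rewrite (pullback_bisector I)// (pullback_hsegment I)// ev ew eu eu' -uu.
  by apply/seteqP; split=> x; rewrite /pullback /setI /=; tauto.
exists (g' c), r; split.
- split=> //.
    rewrite (pullback_hdisk r I)// ec => x [ox Tx]; split=> //; exact: Tc.
  move=> c2 r2 oc2 r20 sub.
  have [ogc2 ec2] := a1 c2 oc2.
  have [] := Tmin (g c2) r2 ogc2 r20.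
    apply: (pullback_sub I) => //.
    by rewrite -(pullback_hdisk r2 I).
  move=> rr2 h; split=> // /h e.
  by rewrite -ec2 e.
- split=> //.
  + by rewrite (pullback_hsegment I)// ev ew; split; rewrite ?ec.
  + by rewrite -c1// ec ev.
  + by rewrite -c1// ec ew.
- rewrite (pullback_hsegment I)// ev ew => x [ox h]; split=> //; exact: vwT.
- move=> v' w' [ov' ow' cvw' dv' dw'].
  have [og1 e1] := a1 v' ov'; have [og2 e2] := a1 w' ow'.
  rewrite (pullback_hsegment I ov' ow') (pullback_hsegment I ogv ogw) ev ew => sub.
  rewrite (vwmax (g v') (g w'))//.
    split=> //.
    + move: cvw'; rewrite (pullback_hsegment I ov' ow') => -[_].
      by rewrite ec.
    + by rewrite -[in LHS]ec c1.
    + by rewrite -[in LHS]ec c1.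
  apply: (pullback_sub I) sub; exact: hsegment_sub_ordinary.
Qed.

Lemma hdist_centre x : ordinary x ->
  hdist (0, 0) x = arcosh (Num.sqrt (1 - inner x x))^-1.
Proof.
move=> ox; rewrite hdistE /hcosh /inner /= !mul0r !addr0 !subr0.
by rewrite sqrtr1 !mul1r.
Qed.

Lemma ordinary0 : ordinary ((0, 0) : R * R).
Proof. by rewrite /ordinary /inner /= !mulr0 addr0 ltr01. Qed.

(** Move the hyperbolic midpoint of the two points to the centre: the images
    are then opposite, and a rotation brings them to the first axis. *)
Lemma symmetric_position F F' : ordinary F -> ordinary F' -> F <> F' ->
  exists g g' t, [/\ isometry_pair g g', 0 < t < 1, g F = (t, 0)
    & g F' = (- t, 0)].
Proof.
move=> oF oF' FF.
have s1 := sqrt_gt0_ord oF; have s2 := sqrt_gt0_ord oF'.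
have /ordinaryP pF := oF; have /ordinaryP pF' := oF'.
set y1 := Num.sqrt (1 - inner F F) in s1.
set y2 := Num.sqrt (1 - inner F' F') in s2.
have e1 : y1 ^+ 2 = 1 - inner F F by rewrite sqr_sqrtr// ltW.
have e2 : y2 ^+ 2 = 1 - inner F' F' by rewrite sqr_sqrtr// ltW.
have s12 : 0 < y1 + y2 by rewrite addr_gt0.
(* The weights make c proportional to the sum of the normalized lifts. *)
pose c := affine F F' (y1 / (y1 + y2)).
have t01 : 0 <= y1 / (y1 + y2) <= 1.
  by rewrite (divr_ge0 (ltW s1) (ltW s12)) ler_pdivrMr// mul1r lerDl ltW.
have cFF : hsegment F F' c by exists (y1 / (y1 + y2)).
have oc : ordinary c by exact: (hsegment_sub_ordinary oF oF').
have cF : hdist c F = hdist c F'.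
  rewrite !hdistE /hcosh -/y1 -/y2; congr arcosh.
  have -> : 1 - inner c F = (y2 * y1 ^+ 2 + y1 * (1 - inner F F')) / (y1 + y2).
    by rewrite e1 /c /inner /affine /=; field; rewrite gt_eqF.
  have -> : 1 - inner c F' = (y1 * y2 ^+ 2 + y2 * (1 - inner F F')) / (y1 + y2).
    by rewrite e2 /c /inner /affine /=; field; rewrite gt_eqF.
  have := sqrt_gt0_ord oc; move: (Num.sqrt _) => z z0.
  by field; rewrite !gt_eqF.
have [g [I gc]] := centre_isometry oc.
have [a1 b1 c1] := I.
have [oG _] := a1 F oF; have [oG' _] := a1 F' oF'.
set G := g F in oG; set G' := g F' in oG'.
have GG : G <> G'.
  move=> e; apply: FF; rewrite -(a1 F oF).2 -(a1 F' oF').2; congr g; exact: e.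
have h0 : hsegment G G' (0, 0).
  by move: cFF; rewrite (pullback_hsegment I oF oF') => -[_]; rewrite gc.
have nG : inner G G = inner G' G'.
  have : hdist (0, 0) G = hdist (0, 0) G' by rewrite -gc !c1.
  move=> /arcosh_inj; rewrite -[X in 1 <= X]/(hcosh _ _).
  rewrite /hcosh /inner /= !mul0r !addr0 !subr0 sqrtr1 !mul1r.
  have H x : ordinary x -> 1 <= 1 / Num.sqrt (1 - (x.1 * x.1 + x.2 * x.2)).
    move=> ox; have := hcosh_ge1 ordinary0 ox.
    by rewrite /hcosh /inner /= !mul0r !addr0 !subr0 sqrtr1 !mul1r.
  move: (H G oG) (H G' oG'); rewrite !mul1r => h1 h2 /(_ h1 h2) /invr_inj.
  have /ordinaryP := oG; have /ordinaryP := oG'; rewrite /inner => p1 p2.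
  move=> /(congr1 (fun z => z ^+ 2)); rewrite !sqr_sqrtr ?ltW//; lra.
have [tt tt01 E] := h0.
have tE : tt = 1 / 2 /\ G' = (- G.1, - G.2).
  have E1 : G.1 * (1 - tt) = - (tt * G'.1) by case: E => + _; lra.
  have E2 : G.2 * (1 - tt) = - (tt * G'.2) by case: E => _; lra.
  have h : (1 - tt) ^+ 2 * inner G G = tt ^+ 2 * inner G G.
    rewrite {2}nG /inner.
    have -> : (1 - tt) ^+ 2 * (G.1 * G.1 + G.2 * G.2) =
      (G.1 * (1 - tt)) ^+ 2 + (G.2 * (1 - tt)) ^+ 2 by ring.
    by rewrite E1 E2; ring.
  have G0 : inner G G != 0.
    apply/negP => /eqP z; apply: GG.
    have z0 x : inner x x = 0 -> x = (0, 0).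
      rewrite /inner -!expr2 => /eqP; rewrite paddr_eq0 ?sqr_ge0// !expf_eq0 /=.
      by case: x => ? ? /= /andP[/eqP-> /eqP->].
    by rewrite (z0 _ z) (z0 _ (etrans (esym nG) z)).
  have tE : tt = 1 / 2.
    have : (1 - 2 * tt) * inner G G = 0 by lra.
    by move/eqP; rewrite mulf_eq0 (negPf G0) orbF => /eqP; lra.
  split=> //; case: (G') E1 E2 => x1 x2 /=; rewrite tE => E1 E2.
  by congr pair; lra.
have [tE1 G'E] := tE.
pose rho := Num.sqrt (inner G G).
have Gpos : 0 < inner G G.
  rewrite lt0r; apply/andP; split; last by rewrite /inner -!expr2 addr_ge0 ?sqr_ge0.
  apply/negP; rewrite /inner -!expr2 paddr_eq0 ?sqr_ge0// !expf_eq0 /=.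
  move=> /andP[/eqP z1 /eqP z2]; apply: GG; rewrite G'E z1 z2 oppr0.
  by move: z1 z2; case: (G) => ? ? /= -> ->.
have rho0 : 0 < rho by rewrite sqrtr_gt0.
have rho2 : rho ^+ 2 = inner G G by rewrite sqr_sqrtr// ltW.
have rho1 : rho < 1.
  rewrite -(@ltr_sqr R) ?nnegrE ?ler01 ?sqrtr_ge0// rho2 expr1n; exact: oG.
have ab : (G.1 / rho) ^+ 2 + (G.2 / rho) ^+ 2 = 1.
  rewrite !expr_div_n -mulrDl rho2 /inner -!expr2 divff//.
  by move: Gpos; rewrite /inner -!expr2 => /gt_eqF/negbT.
exists (rotation (G.1 / rho) (G.2 / rho) \o g).
exists (g \o rotation (G.1 / rho) (- (G.2 / rho))), rho; split.
- apply: isometry_pair_comp => //; exact: rotation_isometry.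
- by rewrite rho0.
- rewrite /= -/G /rotation; congr pair; last by field; rewrite gt_eqF.
  have -> : G.1 / rho * G.1 + G.2 / rho * G.2 = inner G G / rho.
    by rewrite /inner; field; rewrite gt_eqF.
  by rewrite -rho2 expr2 mulfK// gt_eqF.
- rewrite /= -/G' G'E /rotation /=; congr pair; last by field; rewrite gt_eqF.
  have -> : G.1 / rho * - G.1 + G.2 / rho * - G.2 = - (inner G G / rho).
    by rewrite /inner; field; rewrite gt_eqF.
  by rewrite -rho2 expr2 mulfK// gt_eqF.
Qed.
End Isometries.

(** * The elliptical disk in symmetric position *)

Section StandardEllipse.
Variables (R : realType) (t K : R).
Hypotheses (t01 : 0 < t < 1).
Let C : R := (1 + t ^+ 2) / (1 - t ^+ 2).
Hypothesis CK : C < K.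
Implicit Types (v w x c : R * R).

Let F : R * R := (t, 0).
Let F' : R * R := (- t, 0).
Let T : set (R * R) :=
  [set x | ordinary x /\ hdist F x + hdist F' x <= arcosh K].
Let A : R := (K - 1) / (K + 1).
Let B : R := (K - C) / (K + 1).

Let u0 : 0 < 1 - t ^+ 2.
Proof.
have /andP[t0 t1] := t01; have -> : 1 - t ^+ 2 = (1 - t) * (1 + t) by ring.
by rewrite mulr_gt0 ?subr_gt0// addr_gt0.
Qed.

Let C1 : 1 < C.
Proof.
have /andP[t0 t1] := t01; have t2 : 0 < t ^+ 2 by rewrite exprn_gt0.
by rewrite /C ltr_pdivlMr// mul1r; lra.
Qed.

Let K1 : 0 < K - 1. Proof. by have := C1; have := CK; lra. Qed.
Let K2 : 0 < K + 1. Proof. by have := C1; have := CK; lra. Qed.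
Let A0 : 0 < A. Proof. by rewrite divr_gt0 ?K1 ?K2. Qed.
Let A1 : A < 1. Proof. by rewrite ltr_pdivrMr ?K2//; lra. Qed.
Let B0 : 0 < B. Proof. by rewrite divr_gt0 ?K2// subr_gt0. Qed.
Let BA : B < A.
Proof. by rewrite /B /A ltr_pM2r ?invr_gt0 ?K2//; have := C1; lra. Qed.

Let oF : ordinary F.
Proof. by rewrite /ordinary /inner /= mulr0 addr0 -expr2 -subr_gt0 u0. Qed.
Let oF' : ordinary F'.
Proof. by rewrite /ordinary /inner /= mulr0 addr0 mulrNN -expr2 -subr_gt0 u0. Qed.

Let Qn (k : R) x : R :=
  2 + 2 * t ^+ 2 * x.1 ^+ 2 - 2 * k * (1 - t ^+ 2 * x.1 ^+ 2)
  + (k ^+ 2 - 1) * ((1 - t ^+ 2) * (1 - inner x x)).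

(* The degenerate disk with K = C is the segment between the foci. *)
Let QnC x : Qn C x = - ((C ^+ 2 - 1) * (1 - t ^+ 2) * x.2 ^+ 2).
Proof. by rewrite /Qn /C /inner; field; rewrite gt_eqF ?u0. Qed.

Let QnK x : Qn K x - Qn C x = (K - C) *
  ((K + C) * ((1 - t ^+ 2) * (1 - inner x x)) - 2 * (1 - t ^+ 2 * x.1 ^+ 2)).
Proof. by rewrite /Qn; ring. Qed.

(** The synthetic condition, multiplied by the positive quantity
    (1 - t^2) (1 - |x|^2), is affine in the squares of the coordinates. *)
Lemma standard_ellipseP x : T x <-> x.1 ^+ 2 / A + x.2 ^+ 2 / B <= 1.
Proof.
have QE : Qn K x = (K ^+ 2 - 1) * (1 - t ^+ 2) * (B * (1 - x.1 ^+ 2 / A) - x.2 ^+ 2).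
  rewrite /Qn /B /A /C /inner; field.
  by rewrite !gt_eqF ?u0 ?K1 ?K2.
have Kp : 0 < (K ^+ 2 - 1) * (1 - t ^+ 2).
  rewrite mulr_gt0 ?u0//; have -> : K ^+ 2 - 1 = (K - 1) * (K + 1) by ring.
  by rewrite mulr_gt0 ?K1 ?K2.
have ellE : (x.1 ^+ 2 / A + x.2 ^+ 2 / B <= 1) = (0 <= Qn K x).
  rewrite QE pmulr_rge0// subr_ge0 -ler_pdivrMl ?B0// [_^-1 * _]mulrC lerBrDl.
  by [].
have Xo : ordinary x -> (hdist F x + hdist F' x <= arcosh K <-> 0 <= Qn K x).
  move=> ox; have /ordinaryP px := ox.
  have K11 : 1 <= K by have := K1; lra.
  rewrite !hdistE arcoshD_le ?hcosh_ge1//.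
  have s1 := sqrt_gt0_ord ox; have s2 : 0 < Num.sqrt (1 - t ^+ 2) by rewrite sqrtr_gt0 u0.
  have e1 : Num.sqrt (1 - inner x x) ^+ 2 = 1 - inner x x by rewrite sqr_sqrtr ?ltW.
  have e2 : Num.sqrt (1 - t ^+ 2) ^+ 2 = 1 - t ^+ 2 by rewrite sqr_sqrtr ?ltW ?u0.
  have FE : hcosh F x = (1 - t * x.1) / (Num.sqrt (1 - t ^+ 2) * Num.sqrt (1 - inner x x)).
    rewrite /hcosh (_ : inner F x = t * x.1); last by rewrite /inner /= mul0r addr0.
    by rewrite (_ : inner F F = t ^+ 2)// /inner /= mulr0 addr0.
  have FE' : hcosh F' x = (1 + t * x.1) / (Num.sqrt (1 - t ^+ 2) * Num.sqrt (1 - inner x x)).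
    rewrite /hcosh (_ : inner F' x = - (t * x.1)).
      by rewrite opprK (_ : inner F' F' = t ^+ 2)// /inner /= mulr0 addr0 mulrNN.
    by rewrite /inner /= mul0r addr0 mulNr.
  have W0 : 0 < (1 - t ^+ 2) * (1 - inner x x) by rewrite mulr_gt0 ?u0.
  have E1 : hcosh F x * hcosh F' x = (1 - t ^+ 2 * x.1 ^+ 2) / ((1 - t ^+ 2) * (1 - inner x x)).
    rewrite FE FE' -[in RHS]e1 -[in RHS]e2.
    by move: s1 s2; move: (Num.sqrt _) (Num.sqrt _) => y z y0 z0; field; rewrite !gt_eqF.
  have E2 : hcosh F x ^+ 2 + hcosh F' x ^+ 2 - 2 * K * (hcosh F x * hcosh F' x)
      + K ^+ 2 - 1 = Qn K x / ((1 - t ^+ 2) * (1 - inner x x)).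
    have -> : hcosh F x ^+ 2 + hcosh F' x ^+ 2 =
      (2 + 2 * t ^+ 2 * x.1 ^+ 2) / ((1 - t ^+ 2) * (1 - inner x x)).
      rewrite FE FE' -[in RHS]e1 -[in RHS]e2.
      by move: s1 s2; move: (Num.sqrt _) (Num.sqrt _) => y z y0 z0; field; rewrite !gt_eqF.
    by rewrite E1 /Qn; field; rewrite !gt_eqF ?u0.
  rewrite E2 E1 pmulr_lge0 ?invr_gt0//; split=> [/andP[]//|Q0].
  rewrite Q0 andbT ler_pdivrMr//.
  have := QnK x; have : Qn C x <= 0.
    rewrite QnC oppr_le0 mulr_ge0 ?sqr_ge0// mulr_ge0 ?(ltW u0)//.
    by have := C1; rewrite subr_ge0 => /ltW; exact: exprn_ege1.
  move=> h1 h2; have h3 : 0 <= (K - C) * ((K + C) * ((1 - t ^+ 2) * (1 - inner x x))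
      - 2 * (1 - t ^+ 2 * x.1 ^+ 2)) by rewrite -h2; lra.
  move: h3; rewrite pmulr_rge0 ?subr_gt0// => h3.
  have : C * ((1 - t ^+ 2) * (1 - inner x x)) <= K * ((1 - t ^+ 2) * (1 - inner x x)).
    by rewrite ler_pM2r// ltW.
  lra.
rewrite ellE; split=> [[ox]|Q0]; first by rewrite (Xo ox).
suff ox : ordinary x by split=> //; rewrite (Xo ox).
move: Q0; rewrite -ellE => e.
have h1 : x.2 ^+ 2 / A <= x.2 ^+ 2 / B.
  by rewrite ler_wpM2l ?sqr_ge0// lef_pV2 ?posrE ?A0 ?B0// ltW// BA.
have : (x.1 ^+ 2 + x.2 ^+ 2) / A <= 1 by rewrite mulrDl; lra.
rewrite ler_pdivrMr ?A0// mul1r /ordinary /inner -!expr2 => h.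
exact: le_lt_trans h A1.
Qed.

Let al := Num.sqrt A.
Let be := Num.sqrt B.
Let al0 : 0 < al. Proof. by rewrite sqrtr_gt0 A0. Qed.
Let be0 : 0 < be. Proof. by rewrite sqrtr_gt0 B0. Qed.
Let al2 : al ^+ 2 = A. Proof. by rewrite sqr_sqrtr// ltW// A0. Qed.
Let be2 : be ^+ 2 = B. Proof. by rewrite sqr_sqrtr// ltW// B0. Qed.
Let v : R * R := (al, 0).
Let w : R * R := (- al, 0).
Let r : R := arcosh (Num.sqrt (1 - A))^-1.

Let T_norm x : T x -> inner x x <= A.
Proof.
rewrite standard_ellipseP => e.
have h1 : x.2 ^+ 2 / A <= x.2 ^+ 2 / B.
  by rewrite ler_wpM2l ?sqr_ge0// lef_pV2 ?posrE ?A0 ?B0// ltW// BA.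
have : (x.1 ^+ 2 + x.2 ^+ 2) / A <= 1 by rewrite mulrDl; lra.
by rewrite ler_pdivrMr ?A0// mul1r /inner -!expr2.
Qed.

Let vv : inner v v = A. Proof. by rewrite /inner /= mulr0 addr0 -expr2 al2. Qed.
Let ww : inner w w = A.
Proof. by rewrite /inner /= mulr0 addr0 mulrNN -expr2 al2. Qed.
Let ov : ordinary v. Proof. by rewrite /ordinary vv A1. Qed.
Let ow : ordinary w. Proof. by rewrite /ordinary ww A1. Qed.
Let Tv : T v.
Proof.
by apply/standard_ellipseP; rewrite /= expr0n /= mul0r addr0 al2 divff ?gt_eqF ?A0.
Qed.
Let Tw : T w.
Proof.
by apply/standard_ellipseP; rewrite /= expr0n /= mul0r addr0 sqrrN al2 divff ?gt_eqF ?A0.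
Qed.

Let sA : 0 < Num.sqrt (1 - A). Proof. by rewrite sqrtr_gt0 subr_gt0 A1. Qed.
Let sA1 : 1 <= (Num.sqrt (1 - A))^-1.
Proof.
rewrite invf_ge1 ?sA// -[leRHS]sqrtr1 ler_wsqrtr// lerBlDr lerDl.
exact: ltW A0.
Qed.

Let inv_sqrt_ge1 x : ordinary x -> 1 <= (Num.sqrt (1 - inner x x))^-1.
Proof.
move=> ox; rewrite invf_ge1 ?sqrt_gt0_ord// -[leRHS]sqrtr1 ler_wsqrtr//.
by rewrite lerBlDr lerDl /inner -!expr2 addr_ge0 ?sqr_ge0.
Qed.

Let disk_norm x : hdisk (0, 0) r x <-> inner x x <= A.
Proof.
have H : ordinary x -> (hdist (0, 0) x <= r) = (inner x x <= A).
  move=> ox; rewrite hdist_centre// /r arcosh_le ?sA1 ?inv_sqrt_ge1//.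
  rewrite lef_pV2 ?posrE ?sA ?sqrt_gt0_ord// ler_sqrt ?lerD2l ?lerN2//.
  by rewrite subr_ge0 ltW.
split=> [[ox]|h]; first by rewrite (H ox).
have ox : ordinary x by rewrite /ordinary (le_lt_trans h A1).
by split=> //; rewrite (H ox).
Qed.

Let circle_norm x : ordinary x -> hdist (0, 0) x = r -> inner x x = A.
Proof.
move=> ox; rewrite hdist_centre// => /(arcosh_inj (inv_sqrt_ge1 ox) sA1).
move=> /invr_inj /(congr1 (fun z => z ^+ 2)); rewrite !sqr_sqrtr ?subr_ge0.
- lra.
- exact: ltW A1.
- exact: ltW.
Qed.

(* The two vertices on the first axis lie in any enclosing disk, and the sum of
   the hyperbolic cosines of their distances from c' is smallest at the
   centre. *)
Let min_disk : min_enclosing_hdisk T (0, 0) r.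
Proof.
split.
- exact: ordinary0.
- by rewrite arcosh_ge0 ?sA1.
- by move=> x /T_norm /disk_norm.
move=> c' r' oc' r0' sub.
have [K' K1' r'E] := arcosh_surj r0'; rewrite -r'E in sub *.
have [_ hv] := sub v Tv; have [_ hw] := sub w Tw.
rewrite !hdistE !arcosh_le ?hcosh_ge1 ?ov ?ow// in hv hw.
have sc := sqrt_gt0_ord oc'.
have h : (Num.sqrt (1 - A))^-1 <= K' * Num.sqrt (1 - inner c' c').
  have : hcosh c' v + hcosh c' w <= 2 * K' by lra.
  rewrite /hcosh vv ww -mulrDl.
  have -> : 1 - inner c' v + (1 - inner c' w) = 2 by rewrite /inner /=; ring.
  rewrite ler_pdivrMr ?mulr_gt0 ?sA// => h.
  rewrite -[_^-1]mul1r ler_pdivrMr ?sA//; lra.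
have s1 : Num.sqrt (1 - inner c' c') <= 1.
  by rewrite -[leRHS]sqrtr1 ler_wsqrtr// lerBlDr lerDl /inner -!expr2 addr_ge0 ?sqr_ge0.
have K0 : 0 < K' by lra.
split.
  rewrite /r arcosh_le ?sA1//; apply: le_trans h _.
  by rewrite ler_piMr// ltW.
move=> /(arcosh_inj K1' sA1) KE.
move: h; rewrite -KE ler_pMr// => h.
have : inner c' c' = 0.
  have : Num.sqrt (1 - inner c' c') = 1 by apply/le_anti; rewrite s1 h.
  have /ordinaryP pc := oc'.
  by move=> /(congr1 (fun z => z ^+ 2)); rewrite sqr_sqrtr ?ltW// expr1n; lra.
rewrite /inner -!expr2 => /eqP; rewrite paddr_eq0 ?sqr_ge0// !expf_eq0 /=.
by case: (c') => ? ? /= /andP[/eqP-> /eqP->].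
Qed.

Let diam : hdiameter (0, 0) r v w.
Proof.
split.
- exact: ov.
- exact: ow.
- exists 2^-1; first by apply/andP; split; lra.
  by rewrite /affine /v /w /=; congr pair; field.
- by rewrite hdist_centre ?ov// vv.
- by rewrite hdist_centre ?ow// ww.
Qed.

(* B < A, so the ellipse touches the enclosing circle only on the first axis. *)
Let end_points x : T x -> inner x x = A -> x = v \/ x = w.
Proof.
rewrite standard_ellipseP => h nx.
have h1 : x.2 ^+ 2 * (B^-1 - A^-1) <= 0.
  have : (x.1 ^+ 2 + x.2 ^+ 2) / A = 1.
    by move: nx; rewrite /inner -!expr2 => ->; rewrite divff// gt_eqF ?A0.
  rewrite mulrDl; lra.
have x2 : x.2 = 0.
  apply/eqP; rewrite -[_ == _](expf_eq0 _ 2) eq_le sqr_ge0 andbT.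
  move: h1; rewrite pmulr_lle0// subr_gt0 ltf_pV2 ?posrE ?A0 ?B0//; exact: BA.
have : (x.1 - al) * (x.1 + al) = 0.
  have -> : (x.1 - al) * (x.1 + al) = x.1 ^+ 2 - al ^+ 2 by ring.
  by rewrite al2 -nx /inner x2 mulr0 addr0 expr2 subrr.
move/eqP; rewrite mulf_eq0 subr_eq0 addr_eq0 /v /w.
by case: x x2 {h nx h1} => ? ? /= -> /orP[/eqP->|/eqP->]; [left|right].
Qed.

Let major : is_major_axis T v w.
Proof.
exists (0, 0), r; split; [exact: min_disk|exact: diam| |].
  move=> x [s /andP[s0 s1] ->]; apply/standard_ellipseP.
  rewrite /affine /v /w /= subr0 mulr0 addr0 expr0n /= mul0r addr0.
  have -> : al + s * (- al - al) = al * (1 - 2 * s) by ring.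
  rewrite exprMn al2 mulrC mulKf ?gt_eqF ?A0//.
  have : 0 <= s * (1 - s) by rewrite mulr_ge0 ?subr_ge0.
  lra.
move=> v' w' [ov' ow' c0 dv dw] sub.
have [e1|e1] := end_points (sub _ (hsegment_l v' w')) (circle_norm ov' dv);
have [e2|e2] := end_points (sub _ (hsegment_r v' w')) (circle_norm ow' dw).
- move: c0; rewrite e1 e2 => /hsegment_id [/eqP].
  by rewrite eq_sym gt_eqF ?al0.
- by rewrite e1 e2.
- by rewrite e1 e2 hsegmentC.
- move: c0; rewrite e1 e2 => /hsegment_id [/eqP].
  by rewrite eq_sym oppr_eq0 gt_eqF ?al0.
Qed.

Lemma standard_minor_axis :
  is_minor_axis T (0, Num.sqrt B) (0, - Num.sqrt B).
Proof.
exists v, w; split; first exact: major.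
rewrite -/be; apply/seteqP; split=> x.
  move=> [Tx [ox]]; rewrite !hdistE => /arcosh_inj.
  rewrite !hcosh_ge1 ?ov ?ow// => /(_ isT isT).
  rewrite /hcosh vv ww => /mulIf.
  rewrite invr_eq0 mulf_neq0 ?gt_eqF ?sA ?sqrt_gt0_ord// => /(_ isT).
  rewrite /inner /= !mul0r !addr0 => h.
  have x10 : x.1 = 0.
    have : al * x.1 = 0 by lra.
    by move/eqP; rewrite mulf_eq0 gt_eqF ?al0//= => /eqP.
  move: Tx; rewrite standard_ellipseP x10 expr0n /= mul0r add0r.
  rewrite ler_pdivrMr ?B0// mul1r -be2 => hb.
  have : `|x.2| <= be by rewrite -ler_sqr ?nnegrE// ?(ltW be0)// real_normK ?num_real.
  rewrite ler_norml => /andP[h1 h2].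
  exists ((be - x.2) / (2 * be)).
    rewrite divr_ge0 ?mulr_ge0 ?(ltW be0) ?subr_ge0//=.
    by rewrite ler_pdivrMr ?mulr_gt0 ?be0//; lra.
  case: x x10 {ox h hb h1 h2} => ? x2 /= ->; rewrite /affine /=.
  by congr pair; field; rewrite gt_eqF ?be0.
move=> [s /andP[s0 s1] ->].
have Tx : T (affine (0, be) (0, - be) s).
  apply/standard_ellipseP; rewrite /affine /= subr0 mulr0 addr0 expr0n /= mul0r add0r.
  have -> : be + s * (- be - be) = be * (1 - 2 * s) by ring.
  rewrite exprMn be2 mulrC mulKf ?gt_eqF ?B0//.
  have : 0 <= s * (1 - s) by rewrite mulr_ge0 ?subr_ge0.
  lra.
split=> //; have [ox _] := Tx; split=> //.
rewrite !hdistE /hcosh vv ww; congr arcosh; congr (_ / _).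
by rewrite /inner /affine /=; ring.
Qed.

Lemma standard_minor_ordinary :
  ordinary (0, Num.sqrt B) /\ ordinary (0, - Num.sqrt B).
Proof.
have B1 := lt_trans BA A1.
rewrite /ordinary /inner /= !mul0r !add0r mulrNN -expr2 -/be be2.
by split; exact: B1.
Qed.

(** For half-axes with cosh f and cosh a this is the law cosh b = cosh a / cosh f
    of the right-angled triangle on centre, focus and end of the minor axis. *)
Lemma standard_minor_hcosh :
  hcosh (0, Num.sqrt B) (0, - Num.sqrt B) = 1 + 2 * ((K - C) / (C + 1)).
Proof.
have B1 : 0 < 1 - B by rewrite subr_gt0; exact: lt_trans BA A1.
rewrite /hcosh /inner /= !mul0r !add0r mulrNN mulrN -expr2 -/be be2 opprK.
rewrite -expr2 sqr_sqrtr ?(ltW B1)//.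
have -> : 1 - B = (C + 1) / (K + 1) by rewrite /B; field; rewrite gt_eqF ?K2.
have -> : 1 + B = (2 * K + 1 - C) / (K + 1) by rewrite /B; field; rewrite gt_eqF ?K2.
have C0 : 0 < C + 1 by have := C1; lra.
by field; rewrite !gt_eqF ?K2.
Qed.

Lemma standard_hcosh : hcosh F F' = C.
Proof.
rewrite /hcosh /inner /= !mulr0 !addr0 mulrNN mulrN opprK -!expr2.
by rewrite sqr_sqrtr ?(ltW u0).
Qed.
End StandardEllipse.

(** * The minor axis of an elliptical disk *)

Section EllipticalMinorAxis.
Variable R : realType.
Implicit Types (v w x F u : R * R) (K : R).

Lemma elliptical_minor_axis F F' K : ordinary F -> ordinary F' -> F <> F' ->
  hcosh F F' < K ->
  exists u u', [/\ ordinary u, ordinary u',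
    is_minor_axis [set x | ordinary x /\ hdist F x + hdist F' x <= arcosh K] u u'
    & hcosh u u' = 1 + 2 * ((K - hcosh F F') / (hcosh F F' + 1))].
Proof.
move=> oF oF' FF CK.
have [g [g' [t [I t01 gF gF']]]] := symmetric_position oF oF' FF.
have [a1 b1 c1] := I.
have [oG _] := a1 F oF; have [oG' _] := a1 F' oF'.
have hE v w : ordinary v -> ordinary w -> hcosh (g v) (g w) = hcosh v w.
  move=> ov ow; have := c1 v w ov ow; rewrite !hdistE.
  by apply: arcosh_inj; rewrite hcosh_ge1//; [have [] := a1 v ov|have [] := a1 w ow].
have CE : hcosh F F' = (1 + t ^+ 2) / (1 - t ^+ 2).
  by rewrite -hE// gF gF' standard_hcosh.
rewrite CE in CK *.
pose B := (K - (1 + t ^+ 2) / (1 - t ^+ 2)) / (K + 1).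
have [ou ou'] := standard_minor_ordinary t01 CK.
have [og1 e1] := b1 _ ou; have [og2 e2] := b1 _ ou'.
exists (g' (0, Num.sqrt B)), (g' (0, - Num.sqrt B)); split=> //; last first.
  by rewrite -hE// e1 e2 (standard_minor_hcosh t01 CK).
set T := [set x | ordinary x /\ hdist (t, 0) x + hdist (- t, 0) x <= arcosh K].
have -> : [set x | ordinary x /\ hdist F x + hdist F' x <= arcosh K] = pullback g T.
  apply/seteqP; split=> x; rewrite /pullback /T /= -gF -gF'.
    by move=> [ox h]; have [ogx _] := a1 x ox; rewrite !c1.
  by move=> [ox [_]]; rewrite !c1.
apply: pullback_minor_axis I _ ou ou' _; first by move=> x [].
exact: standard_minor_axis.
Qed.
End EllipticalMinorAxis.

(** * Elliptical disks as filled affine ellipses *)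

Section FilledEllipse.
Variable R : realType.
Implicit Types (v w x : R * R) (r k b : R).

Lemma quadratic_filled_ellipse (S : set (R * R)) (a h c d e f x0 y0 : R) :
  0 < a -> 0 < a * c - h ^+ 2 ->
  0 < f - (a * x0 ^+ 2 + 2 * h * x0 * y0 + c * y0 ^+ 2 + d * x0 + e * y0) ->
  (forall v, S v <-> 0 <= f -
    (a * v.1 ^+ 2 + 2 * h * v.1 * v.2 + c * v.2 ^+ 2 + d * v.1 + e * v.2)) ->
  filled_ellipse S.
Proof.
move=> a0 D0 pos SE.
set D := a * c - h ^+ 2 in D0.
(* (cx, cy) is the critical point of the polynomial and M its value there. *)
pose cx := (h * e - c * d) / (2 * D); pose cy := (h * d - a * e) / (2 * D).
pose M := f + (a * cx ^+ 2 + 2 * h * cx * cy + c * cy ^+ 2).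
have DN : D != 0 by rewrite gt_eqF.
have key (x y : R) : f - (a * x ^+ 2 + 2 * h * x * y + c * y ^+ 2 + d * x + e * y) =
   M - (a * ((x - cx) + h / a * (y - cy)) ^+ 2 + D / a * (y - cy) ^+ 2).
  have dE : d = - 2 * (a * cx + h * cy).
    by rewrite /cx /cy; move: DN; rewrite /D => DN; field.
  have eE : e = - 2 * (h * cx + c * cy).
    by rewrite /cx /cy; move: DN; rewrite /D => DN; field.
  move: cx cy @M dE eE => cx cy M dE eE; rewrite dE eE /M /D; field.
  by rewrite gt_eqF.
have M0 : 0 < M.
  move: pos; rewrite key => /lt_le_trans; apply; rewrite lerBlDr lerDl addr_ge0//.
    by rewrite mulr_ge0 ?sqr_ge0// ltW.
  by rewrite mulr_ge0 ?sqr_ge0// divr_ge0 ?ltW.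
pose s := Num.sqrt (M / a); pose z := Num.sqrt (M * a / D).
have s0 : 0 < s by rewrite sqrtr_gt0 divr_gt0.
have z0 : 0 < z by rewrite sqrtr_gt0 divr_gt0 ?mulr_gt0.
have s2 : s ^+ 2 = M / a by rewrite sqr_sqrtr// divr_ge0 ?ltW.
have z2 : z ^+ 2 = M * a / D.
  by rewrite sqr_sqrtr// divr_ge0 ?(ltW D0)// mulr_ge0 ?ltW.
exists (cx, cy), (s, 0), (- (h / a) * z, z); split.
  by rewrite /= mul0r subr0 mulf_neq0 ?gt_eqF.
have ev (p q : R) : f - (a * (cx + p * s + q * (- (h / a) * z)) ^+ 2
    + 2 * h * (cx + p * s + q * (- (h / a) * z)) * (cy + q * z)
    + c * (cy + q * z) ^+ 2 + d * (cx + p * s + q * (- (h / a) * z))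
    + e * (cy + q * z)) = M * (1 - (p * p + q * q)).
  rewrite key.
  have -> : cx + p * s + q * (- (h / a) * z) - cx + h / a * (cy + q * z - cy)
     = p * s by ring.
  have -> : cy + q * z - cy = q * z by ring.
  rewrite !exprMn s2 z2; field.
  by rewrite DN gt_eqF.
apply/seteqP; split=> v; last first.
  move=> [[p q]]; rewrite /inner /= mulr0 addr0 => pq <-; apply/SE => /=.
  by rewrite ev mulr_ge0 ?subr_ge0// ltW.
move=> /SE; rewrite key => h1.
pose q := (v.2 - cy) / z; pose p := ((v.1 - cx) + h / a * (v.2 - cy)) / s.
have v1E : v.1 = cx + p * s + q * (- (h / a) * z).
  by rewrite /p /q; field; rewrite !gt_eqF.
have v2E : v.2 = cy + q * z by rewrite /q; field; rewrite gt_eqF.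
exists (p, q) => /=; last first.
  by case: (v) v1E v2E => x y /= -> ->; rewrite mulr0 addr0.
move: h1; rewrite -key v1E v2E ev pmulr_rge0// subr_ge0; exact.
Qed.

(** For b != 0 the range is the set where the conic, a quadratic polynomial in
    the coordinates, is nonnegative; it is negative definite at infinity and
    positive at an eigenpoint. *)
Lemma grange_filled_ellipse r1 k1 r2 k2 b : k1 != 0 -> k2 != 0 -> b != 0 ->
  filled_ellipse (grange r1 k1 r2 k2 b).
Proof.
move=> h1 h2 b0.
have GE v : grange r1 k1 r2 k2 b v <-> 0 <= conic r1 k1 r2 k2 b (ga v) (gc v) (gd v).
  split=> [/grangeP[]//|Q0].
  have ad0 : 0 <= ga v + gd v by rewrite gaDgd.
  have [[/eqP]|//] := conic_ge0_det b0 ad0 Q0.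
  by rewrite gaDgd oner_eq0.
(* The form is negative definite on the plane a + d = 0. *)
have neg a c d : a + d = 0 -> 0 <= conic r1 k1 r2 k2 b a c d -> a = 0 /\ c = 0.
  move=> ad Q0; have ad0 : 0 <= a + d by rewrite ad.
  have [[]//|[p [q [s [t [p0 q0 st [aE cE dE]]]]]]] := conic_ge0_det b0 ad0 Q0.
  have G : gram_cone r1 k1 r2 k2 b a c d by exists p, q, s, t; split.
  have a0 : 0 <= a.
    by have := gram_cone_ge0 G 0; rewrite mulr0 mul0r expr0n /= mul0r subr0 addr0.
  have d0 : 0 <= d by rewrite dE addr_ge0.
  have a00 : a = 0 by lra.
  have d00 : d = 0 by lra.
  split=> //; apply/eqP; have := gram_cone_ge0 G c; rewrite a00 d00 mulr0 addr0 sub0r.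
  rewrite oppr_ge0 -mulrA pmulr_rle0// -expr2 => c2.
  by rewrite -[_ == _](expf_eq0 _ 2) eq_le sqr_ge0 andbT.
pose q a c d := conic r1 k1 r2 k2 b a c d.
(* The coefficients of the polynomial in v.1, v.2, by polarization. *)
pose q1 := q 0 (1 / 2) 0; pose q2 := q (1 / 2) 0 (- (1 / 2)).
pose q12 := q (1 / 2) (1 / 2) (- (1 / 2)).
pose q0 := q (1 / 2) 0 (1 / 2).
pose q01 := q (1 / 2) (1 / 2) (1 / 2).
pose q02 := q 1 0 0.
have H v : conic r1 k1 r2 k2 b (ga v) (gc v) (gd v) = q0 -
  ((- q1) * v.1 ^+ 2 + 2 * ((q1 + q2 - q12) / 2) * v.1 * v.2 + (- q2) * v.2 ^+ 2
   + (q0 + q1 - q01) * v.1 + (q0 + q2 - q02) * v.2).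
  by rewrite /q0 /q1 /q2 /q12 /q01 /q02 /q /conic /gpol /ga /gc /gd; field.
have q1n : q1 < 0.
  rewrite ltNge; apply/negP => /(neg _ _ _ (addr0 0))[_ /eqP].
  by rewrite mul1r invr_eq0 pnatr_eq0.
have nd (x y : R) : (x != 0) || (y != 0) ->
    q1 * x ^+ 2 - (q1 + q2 - q12) * x * y + q2 * y ^+ 2 < 0.
  move=> xy; have -> : q1 * x ^+ 2 - (q1 + q2 - q12) * x * y + q2 * y ^+ 2 =
     q (y / 2) (x / 2) (- (y / 2)).
    by rewrite /q1 /q2 /q12 /q /conic /gpol; field.
  rewrite ltNge; apply/negP => /(neg _ _ _ (subrr _))[/eqP + /eqP].
  rewrite !mulf_eq0 !invr_eq0 !pnatr_eq0 /= !orbF => /eqP y0 /eqP x0.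
  by move: xy; rewrite x0 y0 eqxx.
pose y := q1; pose x := (q1 + q2 - q12) / 2.
apply: (@quadratic_filled_ellipse _ (- q1) ((q1 + q2 - q12) / 2) (- q2)
  (q0 + q1 - q01) (q0 + q2 - q02) q0 (hp r1 k1).1 (hp r1 k1).2).
- by rewrite oppr_gt0.
- have := nd ((q1 + q2 - q12) / 2) q1; rewrite orbC lt_eqF//= => /(_ isT).
  have -> : q1 * ((q1 + q2 - q12) / 2) ^+ 2 - (q1 + q2 - q12) * ((q1 + q2 - q12) / 2) * q1
     + q2 * q1 ^+ 2 = q1 * (- q1 * - q2 - ((q1 + q2 - q12) / 2) ^+ 2) by field.
  by rewrite nmulr_rlt0.
- rewrite -H ga_hp gc_hp gd_hp.
  set n := r1 ^+ 2 + k1 ^+ 2 + 1.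
  have n0 : 0 < n := nsq1_gt0 r1 k1.
  have -> : conic r1 k1 r2 k2 b ((r1 ^+ 2 + k1 ^+ 2) / n) (r1 / n) (1 / n) =
     (k1 * b ^+ 2 / n) ^+ 2.
    rewrite /conic /gpol /gpair; field.
    by rewrite gt_eqF.
  by rewrite exprn_even_gt0//= mulf_neq0 ?invr_eq0 ?(gt_eqF n0)// mulf_neq0// expf_neq0.
- by move=> v; rewrite GE H.
Qed.
End FilledEllipse.

(** * The generalized minor semi-axis *)

Section MinorSemiaxis.
Variable R : realType.
Implicit Types (v w x p q F : R * R) (r k b : R) (S O : set (R * R)).

(** The larger one of |l1 - l2|^2 and |l1 - conj l2|^2. *)
Definition semiaxis_denom r1 k1 r2 k2 : R :=
  gpair r1 k1 r2 k2 + 2 * (`|k1| * `|k2|).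

Definition semiaxis r1 k1 r2 k2 b : R :=
  2^-1 * arcosh (1 + 2 * (b ^+ 2 / semiaxis_denom r1 k1 r2 k2)).

Lemma semiaxis_denom_ge0 r1 k1 r2 k2 : 0 <= semiaxis_denom r1 k1 r2 k2.
Proof. by rewrite addr_ge0 ?gpair_ge0// !mulr_ge0. Qed.

Lemma semiaxisE r1 k1 r2 k2 b : semiaxis r1 k1 r2 k2 b =
  arcosh (Num.sqrt (1 + b ^+ 2 / semiaxis_denom r1 k1 r2 k2)).
Proof.
by rewrite /semiaxis half_arcosh// divr_ge0 ?sqr_ge0 ?semiaxis_denom_ge0.
Qed.

Lemma semiaxis0 r1 k1 r2 k2 : semiaxis r1 k1 r2 k2 0 = 0.
Proof. by rewrite /semiaxis expr0n /= mul0r mulr0 addr0 arcosh1 mulr0. Qed.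

Lemma semiaxisC r1 k1 r2 k2 b : semiaxis r1 k1 r2 k2 b = semiaxis r2 k2 r1 k1 b.
Proof. by rewrite /semiaxis /semiaxis_denom gpairC [`|k1| * _]mulrC. Qed.

Lemma hsegment_point v : hsegment v v = [set v].
Proof.
apply/seteqP; split=> x; first by move/hsegment_id.
by move=> ->; exact: hsegment_l.
Qed.

Lemma hdisk_elliptical c r : ordinary c -> 0 <= r ->
  is_elliptical_disk (hdisk c r) c c.
Proof.
move=> oc r0; exists (2 * r); rewrite hdist_id//; split; first by rewrite mulr_ge0.
apply/seteqP; split=> x [ox h]; split=> //; lra.
Qed.

(** If the eigenpoints are distinct the range is not an h-disk, since the only
    focus of an h-disk is its centre. *)
Lemma minor_semiaxis_ellipticalP r1 k1 r2 k2 b : k1 != 0 -> k2 != 0 ->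
  minor_semiaxis_elliptical (grange r1 k1 r2 k2 b) (semiaxis r1 k1 r2 k2 b)%:E.
Proof.
move=> h1 h2; have o1 := ordinary_hp r1 h1; have o2 := ordinary_hp r2 h2.
have [->|b0] := eqVneq b 0.
  rewrite semiaxis0 grange_normal.
  have [e|e] := eqVneq (hp r1 k1) (hp r2 k2).
    by apply: Or41; split=> //; exists (hp r1 k1); rewrite e hsegment_point.
  apply: Or42; split=> //; exists (hp r1 k1), (hp r2 k2); split=> //.
  exact/eqP.
have b2 : 0 < b ^+ 2 by rewrite exprn_even_gt0.
have kk : 0 < `|k1| * `|k2| by rewrite mulr_gt0 ?normr_gt0.
have kk2 : 0 < 2 * (`|k1| * `|k2|) by rewrite mulr_gt0.
have kk0 : 2 * (`|k1| * `|k2|) != 0 by rewrite gt_eqF.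
have [e|e] := eqVneq (hp r1 k1) (hp r2 k2).
  apply: Or43.
  have gE : gpair r1 k1 r2 k2 = 2 * (`|k1| * `|k2|).
    have := hcosh_hp_hp r1 r2 h1 h2; rewrite -e hcosh_id// /major_cosh.
    rewrite expr0n addr0 => /esym/eqP; rewrite -subr_eq0.
    move=> /eqP /(congr1 (fun z => z * (2 * (`|k1| * `|k2|)))).
    by rewrite mulrBl divfK// mul0r mul1r => h; lra.
  have sE : semiaxis r1 k1 r2 k2 b = 2^-1 * arcosh (major_cosh r1 k1 r2 k2 b).
    rewrite /semiaxis /major_cosh /semiaxis_denom gE; congr (_ * arcosh _).
    move: kk; move: (`|k1| * `|k2|) => z z0; field.
    by rewrite ?gt_eqF//; lra.
  exists (hp r1 k1), (semiaxis r1 k1 r2 k2 b); split=> //.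
    rewrite sE mulr_gt0// arcosh_gt0// /major_cosh gE ltr_pdivlMr//.
    by rewrite mul1r ltrDl.
  rewrite grange_elliptical// sE -e; apply/seteqP.
  by split=> x [ox h]; split=> //; lra.
have C1 := hcosh_ge1 o1 o2.
have CK : hcosh (hp r1 k1) (hp r2 k2) < major_cosh r1 k1 r2 k2 b.
  by rewrite hcosh_hp_hp// /major_cosh expr0n /= ltr_pM2r ?ltrD2l ?invr_gt0.
have [u [u' [ou ou' uu hE]]] := elliptical_minor_axis o1 o2 (elimN eqP e) CK.
apply: Or44; split.
  split; first exact: grange_filled_ellipse.
    by move=> x; exact: grange_ordinary.
  move=> [c [r [oc [r0 SE]]]].
  have [rc [kc [cE kc0]]] := ordinary_hpE oc.
  have := hdisk_elliptical oc (ltW r0); rewrite -SE cE.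
  move=> /(elliptical_is_grange kc0 kc0)[b' bE].
  have := foci_grange r1 k1 r2 k2 b; rewrite bE foci_grange => fE.
  have p1 : [set hp r1 k1; hp r2 k2] (hp r1 k1) by left.
  have p2 : [set hp r1 k1; hp r2 k2] (hp r2 k2) by right.
  by move: p1 p2 e; rewrite -fE setUid /= => -> ->; rewrite eqxx.
exists u, u'; split=> //; first by rewrite grange_elliptical.
congr EFin; rewrite hdistE hE /semiaxis mulrC; congr (arcosh _ * _).
congr (_ + 2 * _); rewrite hcosh_hp_hp// /major_cosh /semiaxis_denom expr0n /= addr0.
field; rewrite !gt_eqF ?normr_gt0//.
by rewrite ltr_wpDl ?gpair_ge0// mulr_gt0.
Qed.

Lemma ga_continuous : continuous (@ga R).
Proof.
move=> v; rewrite /ga; apply: cvgM; last exact: cvg_cst.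
by apply: cvgD; [exact: cvg_cst|exact: cvg_snd].
Qed.

Lemma gc_continuous : continuous (@gc R).
Proof. by move=> v; rewrite /gc; apply: cvgM; [exact: cvg_fst|exact: cvg_cst]. Qed.

Lemma gd_continuous : continuous (@gd R).
Proof.
move=> v; rewrite /gd; apply: cvgM; last exact: cvg_cst.
by apply: cvgB; [exact: cvg_cst|exact: cvg_snd].
Qed.

Lemma gpol_continuous r k : continuous (fun v => gpol r k (ga v) (gc v) (gd v)).
Proof.
move=> v; rewrite /gpol; apply: cvgD.
  apply: cvgB; first exact: ga_continuous.
  apply: cvgM; last exact: cvg_cst.
  by apply: cvgM; [exact: cvg_cst|exact: gc_continuous].
by apply: cvgM; [exact: gd_continuous|exact: cvg_cst].
Qed.

Lemma gdet_continuous : continuous (fun v => ga v * gd v - gc v ^+ 2 : R).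
Proof.
move=> v; apply: cvgB.
  by apply: cvgM; [exact: ga_continuous|exact: gd_continuous].
by apply: cvgM; exact: gc_continuous.
Qed.

Lemma conic_continuous r1 k1 r2 k2 b :
  continuous (fun v => conic r1 k1 r2 k2 b (ga v) (gc v) (gd v)).
Proof.
move=> v; rewrite /conic; apply: cvgD; last first.
  by apply: cvgM; [exact: cvg_cst|exact: gdet_continuous].
apply: cvgB; last first.
  apply: cvgM; first exact: cvg_cst.
  by apply: cvgM; exact: gpol_continuous.
apply: cvgD; (apply: cvgM; first exact: cvg_cst);
  by apply: cvgM; exact: gpol_continuous.
Qed.

Lemma nonneg_closed (f : R * R -> R) : continuous f -> closed [set v | 0 <= f v].
Proof.
by move=> fc; exact: (iffLR (continuous_closedP f) fc _ (@closed_ge R 0)).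
Qed.

Lemma grange_closed r1 k1 r2 k2 b : closed (grange r1 k1 r2 k2 b).
Proof.
pose f v := 2 * (gpair r1 k1 r2 k2 + b ^+ 2) * (ga v * gd v - gc v ^+ 2)
   - gpol r1 k1 (ga v) (gc v) (gd v) * gpol r2 k2 (ga v) (gc v) (gd v).
have fc : continuous f.
  move=> v; apply: cvgB.
    by apply: cvgM; [exact: cvg_cst|exact: gdet_continuous].
  by apply: cvgM; exact: gpol_continuous.
have -> : grange r1 k1 r2 k2 b =
  [set v | 0 <= ga v * gd v - gc v ^+ 2] `&`
  ([set v | 0 <= conic r1 k1 r2 k2 b (ga v) (gc v) (gd v)]
  `&` [set v | 0 <= f v]).
  apply/seteqP; split=> v; rewrite grangeP /f /setI /=.
    by move=> [e1 e2 e3]; split=> //; split=> //; rewrite subr_ge0.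
  by move=> [e1 [e2 e3]]; split=> //; rewrite -subr_ge0.
apply: closedI; first exact/nonneg_closed/gdet_continuous.
apply: closedI; last exact: nonneg_closed.
exact/nonneg_closed/conic_continuous.
Qed.

Lemma closure_approx S v :
  (forall e : R, 0 < e ->
     exists x, [/\ S x, `|v.1 - x.1| < e & `|v.2 - x.2| < e]) ->
  closure S v.
Proof.
move=> H B /nbhs_ballP[e /= e0 eB].
have [x [Sx h1 h2]] := H e e0.
by exists x; split=> //; apply: eB.
Qed.

(** The range is closed, and convexity joins its asymptotic points to F by
    segments of ordinary points. *)
Lemma grange_closure r1 k1 r2 k2 b F : grange r1 k1 r2 k2 b F -> ordinary F ->
  grange r1 k1 r2 k2 b = closure (grange r1 k1 r2 k2 b `&` @ordinary R).
Proof.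
move=> GF oF; apply/seteqP; split=> v; last first.
  have /closure_id {2}-> := @grange_closed r1 k1 r2 k2 b.
  by apply: closureS => x [].
move=> Gv; apply: closure_approx => e e0.
have hv := grange_disk Gv.
have bnd x : inner x x <= 1 -> `|x.1| <= 1 /\ `|x.2| <= 1.
  rewrite /inner -!expr2 => h; split; rewrite -(@ler_sqr R) ?nnegrE//;
  rewrite real_normK ?num_real// expr1n;
  have := sqr_ge0 x.1; have := sqr_ge0 x.2; lra.
have [v1 v2] := bnd v hv; have [F1 F2] := bnd F (ltW oF).
pose t := e / (e + 3).
have t0 : 0 < t by rewrite divr_gt0// addr_gt0.
have t1 : t <= 1 by rewrite ler_pdivrMr ?addr_gt0// mul1r lerDl.
have te : t * 2 < e.
  rewrite /t mulrAC ltr_pdivrMr ?addr_gt0// ltr_pM2l//; lra.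
have small (y z : R) : `|y| <= 1 -> `|z| <= 1 -> `|y - (y + t * (z - y))| < e.
  move=> hy hz; have -> : y - (y + t * (z - y)) = t * (y - z) by ring.
  rewrite normrM (gtr0_norm t0); apply: le_lt_trans te.
  by rewrite ler_pM2l//; apply: le_trans (ler_normB _ _) _; lra.
exists (affine v F t); split; [|exact: small|exact: small].
split; last by apply: affine_ordinary => //; rewrite t0 t1.
by apply: grange_convex => //; rewrite t1 ltW.
Qed.

Lemma hlineC p q : hline p q = hline q p.
Proof.
suff H p' q' : hline p' q' `<=` hline q' p' by apply/seteqP; split; exact: H.
move=> x [ox [t xE]]; split=> //.
by exists (1 - t); rewrite xE /affine; congr pair; ring.
Qed.

Lemma inf_min (E : set R) e : E e -> lbound E e -> inf E = e.
Proof.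
move=> Ee lb; apply/le_anti/andP; split.
  by apply: ge_inf => //; exists e.
by apply: lb_le_inf => //; exists e.
Qed.

(** The squared hyperbolic cosine of the distance from x to the h-line through
    [hp r1 k1] and [hp r2 0]. *)
Definition line_coshsq r1 k1 r2 x : R :=
  (gpair r1 k1 r2 0 * gpol r1 k1 (ga x) (gc x) (gd x)
      * gpol r2 0 (ga x) (gc x) (gd x)
    - k1 ^+ 2 * gpol r2 0 (ga x) (gc x) (gd x) ^+ 2)
  / (gpair r1 k1 r2 0 ^+ 2 * (ga x * gd x - gc x ^+ 2)).

Lemma line_coshsq_ge1 r1 k1 r2 x : 0 < gpair r1 k1 r2 0 -> ordinary x ->
  1 <= line_coshsq r1 k1 r2 x.
Proof.
move=> m0 /ordinary_gdet d0.
rewrite /line_coshsq ler_pdivlMr; last by rewrite mulr_gt0// exprn_gt0.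
have := conic_normal_le0 r1 k1 r2 0 (ga x) (gc x) (gd x).
rewrite /conic; lra.
Qed.

(** P and Q are the coefficients of the lift of w in terms of the unnormalized
    lifts of the two points that span the line. *)
Lemma hcosh_line r1 k1 r2 x w P Q :
  ordinary x -> ordinary w ->
  [/\ ga w = P * (r1 ^+ 2 + k1 ^+ 2) + Q * (r2 ^+ 2),
      gc w = P * r1 + Q * r2 & gd w = P + Q] ->
  let del := P * (k1 ^+ 2 * P + gpair r1 k1 r2 0 * Q) in
  0 < del /\ hcosh x w ^+ 2 =
    (P * gpol r1 k1 (ga x) (gc x) (gd x)
      + Q * gpol r2 0 (ga x) (gc x) (gd x)) ^+ 2
    / (4 * del * (ga x * gd x - gc x ^+ 2)).
Proof.
move=> ox ow [aE cE dE] del.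
have delE : ga w * gd w - gc w ^+ 2 = del.
  by rewrite aE cE dE /del /gpair; ring.
have del0 : 0 < del by rewrite -delE; apply/ordinary_gdet.
split=> //; rewrite hcosh_sqr//.
have xE : 1 - inner x x = 4 * (ga x * gd x - gc x ^+ 2) by rewrite gdet; field.
have wE : 1 - inner w w = 4 * del by rewrite -delE gdet; field.
have -> : 1 - inner x w = 2 * (P * gpol r1 k1 (ga x) (gc x) (gd x)
      + Q * gpol r2 0 (ga x) (gc x) (gd x)).
  have -> : 1 - inner x w =
    2 * (ga x * gd w + gd x * ga w - 2 * gc x * gc w).
    by rewrite /inner /ga /gd /gc; field.
  by rewrite aE cE dE /gpol; ring.
have /ordinary_gdet d0 := ox.
by rewrite xE wE; field; rewrite !gt_eqF.
Qed.

(** In the coordinates P and be = k1^2 P + m Q the determinant of a point of the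
    line is P be, and the lower bound for the distance is the inequality between
    arithmetic and geometric means. *)
Lemma hdist_to_line r1 k1 r2 x : 0 < gpair r1 k1 r2 0 -> ordinary x ->
  hdist_to (hline (hp r1 k1) (hp r2 0)) x
    = arcosh (Num.sqrt (line_coshsq r1 k1 r2 x)).
Proof.
move=> m0 ox; have /ordinary_gdet d0 := ox.
have H1 := line_coshsq_ge1 m0 ox.
have sH1 : 1 <= Num.sqrt (line_coshsq r1 k1 r2 x).
  by rewrite -[leLHS]sqrtr1 ler_wsqrtr.
set g1 := gpol r1 k1 (ga x) (gc x) (gd x).
set g2 := gpol r2 0 (ga x) (gc x) (gd x).
set m := gpair r1 k1 r2 0 in m0.
have g20 : 0 < g2 by exact: gpol_gt0.
have HE : line_coshsq r1 k1 r2 x = (m * g1 * g2 - k1 ^+ 2 * g2 ^+ 2) /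
   (m ^+ 2 * (ga x * gd x - gc x ^+ 2)) by [].
have n10 := nsq1_gt0 r1 k1; have n20 := nsq1_gt0 r2 0.
rewrite expr0n addr0 in n20.
have Wp : 0 < m * g1 - k1 ^+ 2 * g2.
  have : 0 < (m * g1 - k1 ^+ 2 * g2) * g2.
    have -> : (m * g1 - k1 ^+ 2 * g2) * g2 = line_coshsq r1 k1 r2 x *
       (m ^+ 2 * (ga x * gd x - gc x ^+ 2)).
      rewrite HE divfK; first by ring.
      by rewrite gt_eqF// mulr_gt0// exprn_gt0.
    apply: mulr_gt0; first exact: lt_le_trans ltr01 H1.
    by apply: mulr_gt0 => //; exact: exprn_gt0.
  by rewrite pmulr_lgt0.
apply: inf_min.
  (* P0 and Q0 are the coordinates of the foot of the perpendicular, found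
     from the equality case of the inequality proved below. *)
  pose P0 := m * g2; pose Q0 := m * g1 - 2 * k1 ^+ 2 * g2.
  pose a := P0 * (r1 ^+ 2 + k1 ^+ 2) + Q0 * r2 ^+ 2.
  pose c := P0 * r1 + Q0 * r2; pose d := P0 + Q0.
  have dE : a * d - c ^+ 2 = m ^+ 2 * g2 * (m * g1 - k1 ^+ 2 * g2).
    have -> : a * d - c ^+ 2 = P0 * (k1 ^+ 2 * P0 + m * Q0).
      by rewrite /a /c /d /m /gpair; ring.
    by rewrite /P0 /Q0; ring.
  have dp : 0 < a * d - c ^+ 2 by rewrite dE !mulr_gt0.
  have ad : a + d != 0.
    apply/negP => /eqP ad; have aE : a = - d by lra.
    move: dp; rewrite aE; have := sqr_ge0 d; have := sqr_ge0 c; lra.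
  pose w : R * R := (2 * c / (a + d), (a - d) / (a + d)).
  have wa : ga w = a / (a + d) by rewrite /ga /w /=; field.
  have wc : gc w = c / (a + d) by rewrite /gc /w /=; field.
  have wd : gd w = d / (a + d) by rewrite /gd /w /=; field.
  have ow : ordinary w.
    apply/ordinary_gdet; rewrite wa wc wd.
    have -> : a / (a + d) * (d / (a + d)) - (c / (a + d)) ^+ 2 =
      (a * d - c ^+ 2) / (a + d) ^+ 2 by field.
    by rewrite divr_gt0// exprn_even_gt0.
  have adE : a + d = P0 * (r1 ^+ 2 + k1 ^+ 2 + 1) + Q0 * (r2 ^+ 2 + 1).
    by rewrite /a /d; ring.
  exists w.
    split=> //; exists (Q0 / (a + d) * (r2 ^+ 2 + 1)).
    have [_ h1 h2] := affineE (hp r1 k1) (hp r2 0) (Q0 / (a + d) * (r2 ^+ 2 + 1)).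
    have e1 : 1 - Q0 / (a + d) * (r2 ^+ 2 + 1) =
       P0 / (a + d) * (r1 ^+ 2 + k1 ^+ 2 + 1).
      rewrite -{1}[1](divff ad) {1}adE; field; exact: ad.
    apply: gpt_inj.
      rewrite h1 e1 wc !gc_hp expr0n addr0 /c; field.
      by rewrite ad !gt_eqF.
    rewrite h2 e1 wd !gd_hp expr0n addr0 /d; field.
    by rewrite ad !gt_eqF.
  rewrite hdistE; congr arcosh.
  have [] := @hcosh_line r1 k1 r2 x w (P0 / (a + d)) (Q0 / (a + d)) ox ow.
    by rewrite wa wc wd /a /c /d; split; field.
  rewrite -/m -/g1 -/g2 => delp hE.
  rewrite -[LHS]ger0_norm ?(ltW (hcosh_gt0 ox ow))// -sqrtr_sqr hE; congr Num.sqrt.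
  rewrite HE /P0 /Q0; field.
  rewrite ad !gt_eqF//=.
  have -> : k1 ^+ 2 * (m * g2) + m * (m * g1 - 2 * k1 ^+ 2 * g2) =
    m * (m * g1 - k1 ^+ 2 * g2) by ring.
  exact: mulr_gt0.
move=> _ [w [ow [t wE]] <-].
rewrite hdistE arcosh_le ?hcosh_ge1//.
rewrite -(@ler_sqr R) ?nnegrE ?sqrtr_ge0 ?(ltW (hcosh_gt0 ox ow))//.
rewrite sqr_sqrtr; last by lra.
have [h0 h1 h2] := affineE (hp r1 k1) (hp r2 0) t.
pose P := (1 - t) / (r1 ^+ 2 + k1 ^+ 2 + 1); pose Q := t / (r2 ^+ 2 + 1).
have [] := @hcosh_line r1 k1 r2 x w P Q ox ow.
  rewrite wE h0 h1 h2 !ga_hp !gc_hp !gd_hp expr0n addr0 /P /Q.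
  by split; field; rewrite !gt_eqF.
rewrite -/m -/g1 -/g2; set be := k1 ^+ 2 * P + m * Q => delp hE.
rewrite hE HE -subr_ge0.
have PB : P != 0 /\ be != 0.
  by move: delp; rewrite lt0r mulf_eq0 negb_or => /andP[/andP[]].
have -> : (P * g1 + Q * g2) ^+ 2 / (4 * (P * be) * (ga x * gd x - gc x ^+ 2)) -
  (m * g1 * g2 - k1 ^+ 2 * g2 ^+ 2) / (m ^+ 2 * (ga x * gd x - gc x ^+ 2)) =
  (P * (m * g1 - k1 ^+ 2 * g2) - be * g2) ^+ 2
   / (m ^+ 2 * (4 * (P * be) * (ga x * gd x - gc x ^+ 2))).
  have -> : Q = (be - k1 ^+ 2 * P) / m by rewrite /be; field; rewrite gt_eqF.
  by field; rewrite PB.1 PB.2 !gt_eqF.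
apply: divr_ge0; first exact: sqr_ge0.
apply: mulr_ge0; first exact: sqr_ge0.
by apply: mulr_ge0 (ltW d0); apply: mulr_ge0 => //; exact: ltW.
Qed.

Lemma hline_real r1 r2 : r1 != r2 -> hline (hp r1 0) (hp r2 0) =
  grange r1 0 r2 0 0 `&` @ordinary R.
Proof.
move=> r12; rewrite grange_normal; apply/seteqP; split=> x; last first.
  by move=> [[t _ ->] ox]; split=> //; exists t.
move=> [ox [t xE]]; split=> //; exists t => //.
have : 0 < 1 - inner x x by apply/ordinaryP.
have pE : 1 - inner (hp r1 0) (hp r1 0) = 0 by rewrite asymptotic_hp subrr.
have qE : 1 - inner (hp r2 0) (hp r2 0) = 0 by rewrite asymptotic_hp subrr.
have -> : 1 - inner x x = 2 * (1 - inner (hp r1 0) (hp r2 0)) * (t * (1 - t)).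
  rewrite xE; transitivity ((1 - t) ^+ 2 * (1 - inner (hp r1 0) (hp r1 0))
    + t ^+ 2 * (1 - inner (hp r2 0) (hp r2 0))
    + 2 * (1 - inner (hp r1 0) (hp r2 0)) * (t * (1 - t))).
    by rewrite /inner /affine /=; ring.
  by rewrite pE qE; ring.
rewrite pmulr_rgt0; last first.
  rewrite mulr_gt0// subr_gt0 lt_neqAle inner_le1 ?inner_hp_le1// andbT.
  apply/negP => /eqP /(inner_eq1 (inner_hp_le1 _ _) (inner_hp_le1 _ _)).
  move=> /(congr1 (fun v => gc v / gd v)); rewrite !gc_hp !gd_hp.
  have n1 := nsq1_neq0 r1 0; have n2 := nsq1_neq0 r2 0.
  by rewrite !div1r !invrK !divfK// => /eqP; rewrite (negPf r12).
move=> h; apply/andP; split; rewrite leNgt; apply/negP => h'; move: h.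
  by rewrite nmulr_rgt0// subr_lt0; lra.
by rewrite nmulr_lgt0 ?subr_lt0//; lra.
Qed.

Lemma gpair_real_gt0 r1 r2 : r1 != r2 -> 0 < gpair r1 0 r2 0.
Proof.
move=> r12; rewrite /gpair expr0n /= !addr0 exprn_even_gt0//.
by rewrite subr_eq0.
Qed.

(** For two real eigenvalues the conic is a multiple of
    (m + b^2) (a d - c^2) - g1 g2, where g1 g2 / (m (a d - c^2)) is the squared
    hyperbolic cosine of the distance from the line. *)
Lemma minor_semiaxis_lineP r1 r2 b : r1 != r2 ->
  minor_semiaxis_line (hp r1 0) (hp r2 0) (grange r1 0 r2 0 b)
    (semiaxis r1 0 r2 0 b)%:E.
Proof.
move=> r12; have m0 := gpair_real_gt0 r12.
have half : 0 <= (1 / 2 : R) <= 1 by apply/andP; split; lra.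
pose F := affine (hp r1 0) (hp r2 0) (1 / 2).
have GF b' : grange r1 0 r2 0 b' F.
  by apply: grange_convex half _ _; [exact: grange_hp1|exact: grange_hp2].
have oF : ordinary F.
  apply/ordinary_gdet.
  have [h0 h1 h2] := affineE (hp r1 0) (hp r2 0) (1 / 2).
  rewrite h0 h1 h2 !ga_hp !gc_hp !gd_hp.
  have n1 := nsq1_neq0 r1 0; have n2 := nsq1_neq0 r2 0.
  have -> : ((r1 ^+ 2 + 0 ^+ 2) / (r1 ^+ 2 + 0 ^+ 2 + 1) * (1 - 1 / 2) +
    (r2 ^+ 2 + 0 ^+ 2) / (r2 ^+ 2 + 0 ^+ 2 + 1) * (1 / 2)) *
   (1 / (r1 ^+ 2 + 0 ^+ 2 + 1) * (1 - 1 / 2) +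
    1 / (r2 ^+ 2 + 0 ^+ 2 + 1) * (1 / 2)) -
   (r1 / (r1 ^+ 2 + 0 ^+ 2 + 1) * (1 - 1 / 2) +
    r2 / (r2 ^+ 2 + 0 ^+ 2 + 1) * (1 / 2)) ^+ 2 =
   gpair r1 0 r2 0 / (4 * (r1 ^+ 2 + 0 ^+ 2 + 1) * (r2 ^+ 2 + 0 ^+ 2 + 1)).
    rewrite /gpair !expr0n /= !addr0 in n1 n2 *; field.
    by rewrite n1 n2.
  by rewrite divr_gt0// !mulr_gt0 ?nsq1_gt0.
have [->|b0] := eqVneq b 0.
  left; rewrite semiaxis0; split=> //.
  by rewrite hline_real//; exact: grange_closure (GF 0) oF.
have b2 : 0 < b ^+ 2 by rewrite exprn_even_gt0.
have dE : semiaxis_denom r1 0 r2 0 = gpair r1 0 r2 0.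
  by rewrite /semiaxis_denom normr0 !mulr0 addr0.
right; exists (semiaxis r1 0 r2 0 b); split=> //.
  by rewrite /semiaxis mulr_gt0// arcosh_gt0// ltrDl mulr_gt0// dE divr_gt0.
rewrite (grange_closure (GF b) oF); congr closure.
suff H x : ordinary x -> grange r1 0 r2 0 b x <->
  hdist_to (hline (hp r1 0) (hp r2 0)) x <= semiaxis r1 0 r2 0 b.
  by apply/seteqP; split=> x [] => [/H h /[dup] ox /h|ox /(H x ox)].
move=> ox; have /ordinary_gdet d0 := ox.
rewrite hdist_to_line// semiaxisE dE.
have bm : 0 <= b ^+ 2 / gpair r1 0 r2 0 by rewrite divr_ge0 ?ltW.
rewrite arcosh_le ?sqrt1D_ge1//; last first.
  by rewrite -[leLHS]sqrtr1 ler_wsqrtr// line_coshsq_ge1.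
rewrite ler_sqrt ?addr_ge0// grangeP /line_coshsq.
have g1p := gpol_gt0 r1 0 ox; have g2p := gpol_gt0 r2 0 ox.
rewrite /conic; set g1 := gpol r1 0 _ _ _ in g1p *.
set g2 := gpol r2 0 _ _ _ in g2p *.
set m := gpair _ _ _ _ in m0 bm dE *.
set del := ga x * _ - _ in d0 *.
have -> : 0 ^+ 2 * g1 ^+ 2 + 0 ^+ 2 * g2 ^+ 2 - (m + b ^+ 2) * (g1 * g2) +
   ((m + b ^+ 2) ^+ 2 - 4 * 0 ^+ 2 * 0 ^+ 2) * del =
   (m + b ^+ 2) * ((m + b ^+ 2) * del - g1 * g2) by ring.
have mb : 0 < m + b ^+ 2 by rewrite addr_gt0.
rewrite pmulr_rge0// (subr_ge0 (g1 * g2)).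
have -> : (m * g1 * g2 - 0 ^+ 2 * g2 ^+ 2) / (m ^+ 2 * del) = g1 * g2 / (m * del).
  by field; rewrite !gt_eqF.
rewrite ler_pdivrMr ?mulr_gt0//.
have -> : (1 + b ^+ 2 / m) * (m * del) = (m + b ^+ 2) * del.
  by field; rewrite gt_eqF.
split=> [[]//|h]; split=> //; first exact: ltW.
apply: le_trans h _; rewrite ler_pM2r//; lra.
Qed.

(** For a double real eigenvalue the conic is b^2 (b^2 (a d - c^2) - g^2), which
    compares the Busemann function of the eigenpoint with a constant. *)
Lemma minor_semiaxis_doubleP r b : exists2 s : \bar R,
  minor_semiaxis_double (grange r 0 r 0 b) s &
  s = if b == 0 then 0%E else +oo%E.
Proof.
have [->|b0] := eqVneq b 0.
  exists 0%E => //; exists (hp r 0); first exact: asymptotic_hp.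
  by left; split=> //; rewrite grange_normal hsegment_point.
exists +oo%E => //; exists (hp r 0); first exact: asymptotic_hp.
right; exists (ln (`|b| / (r ^+ 2 + 1))); split=> //.
have np : 0 < r ^+ 2 + 1 by have := nsq1_gt0 r 0; rewrite expr0n addr0.
have b2 : 0 < b ^+ 2 by rewrite exprn_even_gt0.
have bp : 0 < `|b| by rewrite normr_gt0.
have GE x : grange r 0 r 0 b x <-> 0 <= ga x * gd x - gc x ^+ 2 /\
  gpol r 0 (ga x) (gc x) (gd x) ^+ 2 <= b ^+ 2 * (ga x * gd x - gc x ^+ 2).
  rewrite grangeP /conic.
  have -> : gpair r 0 r 0 = 0 by rewrite /gpair subrr !expr0n /= !addr0.
  set g := gpol _ _ _ _ _; set del := ga x * _ - _.
  have -> : 0 ^+ 2 * g ^+ 2 + 0 ^+ 2 * g ^+ 2 - (0 + b ^+ 2) * (g * g) +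
   ((0 + b ^+ 2) ^+ 2 - 4 * 0 ^+ 2 * 0 ^+ 2) * del =
   b ^+ 2 * (b ^+ 2 * del - g ^+ 2) by ring.
  rewrite pmulr_rge0// (subr_ge0 (g ^+ 2)); split=> [[]//|[d0 h]]; split=> //.
  by rewrite add0r -expr2 (le_trans h)// ler_wpM2r//; lra.
have oF := ordinary_hp r b0.
have GF : grange r 0 r 0 b (hp r b).
  apply/GE; have /ordinary_gdet d0 := oF; split; first exact: ltW.
  have n := nsq1_neq0 r b.
  rewrite /gpol ga_hp gc_hp gd_hp le_eqVlt; apply/orP; left; apply/eqP.
  by field.
rewrite (grange_closure GF oF); congr closure.
suff H x : ordinary x -> grange r 0 r 0 b x <->
   horofun (hp r 0) x - ln (`|b| / (r ^+ 2 + 1)) <= 0.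
  by apply/seteqP; split=> x [] => [/H h /[dup] ox /h|ox /(H x ox)].
move=> ox; have /ordinary_gdet d0 := ox.
have g0 := gpol_gt0 r 0 ox.
rewrite GE horofun_hp// subr_le0 ler_ln ?posrE ?divr_gt0 ?mulr_gt0 ?sqrtr_gt0//.
set g := gpol _ _ _ _ _ in g0 *; set del := ga x * _ - _ in d0 *.
have sp : 0 < Num.sqrt del by rewrite sqrtr_gt0.
have -> : g / ((r ^+ 2 + 1) * Num.sqrt del) = g / Num.sqrt del / (r ^+ 2 + 1).
  by move: sp; move: (Num.sqrt _) => z z0; field; rewrite !gt_eqF.
rewrite ler_pM2r ?invr_gt0// ler_pdivrMr//.
rewrite -[g <= _](@ler_sqr R) ?nnegrE ?mulr_ge0 ?(ltW g0) ?(ltW sp)//.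
rewrite exprMn real_normK ?num_real// sqr_sqrtr ?(ltW d0)//.
by split=> [[]//|h]; split=> //; exact: ltW.
Qed.

Lemma parabolic_bound r1 k1 r2 b x : k1 != 0 -> ordinary x ->
  grange r1 k1 r2 0 b x ->
  line_coshsq r1 k1 r2 x <= 1 + b ^+ 2 / gpair r1 k1 r2 0.
Proof.
move=> h1 ox /grangeP[_ Q0 _]; have /ordinary_gdet d0 := ox.
have m0 := gpair_gt0 r1 r2 0 0 h1; rewrite expr0n addr0 in m0.
move: Q0; rewrite /conic /line_coshsq.
have g2p := gpol_gt0 r2 0 ox.
set g1 := gpol r1 _ _ _ _; set g2 := gpol r2 _ _ _ _ in g2p *.
set m := gpair _ _ _ _ in m0 *; set del := ga x * _ - _ in d0 *.
have b2 := sqr_ge0 b; have mb : 0 < m + b ^+ 2 by rewrite ltr_wpDr.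
move=> Q0; rewrite ler_pdivrMr; last by rewrite mulr_gt0// exprn_gt0.
have -> : (1 + b ^+ 2 / m) * (m ^+ 2 * del) = m * (m + b ^+ 2) * del.
  by field; rewrite gt_eqF.
rewrite -(ler_pM2l mb).
have : 0 <= m * (0 ^+ 2 * g1 ^+ 2 + k1 ^+ 2 * g2 ^+ 2 - (m + b ^+ 2) * (g1 * g2)
   + ((m + b ^+ 2) ^+ 2 - 4 * k1 ^+ 2 * 0 ^+ 2) * del).
  by rewrite mulr_ge0// ltW.
have : 0 <= b ^+ 2 * (k1 ^+ 2 * g2 ^+ 2).
  by rewrite mulr_ge0// mulr_ge0 ?sqr_ge0.
move=> h3 h4; rewrite -subr_ge0; apply: le_trans (addr_ge0 h3 h4) _.
by rewrite le_eqVlt; apply/orP; left; apply/eqP; ring.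
Qed.

(** For b != 0 the bound of [parabolic_bound] is not attained. On the boundary
    of the range, where the conic vanishes, it is approached towards the
    asymptotic point: X is the horizontal half-plane coordinate after l2 has been sent to
    infinity, and the height is determined by the equation of the boundary. *)
Lemma parabolic_boundary r1 k1 r2 b (X : R) : k1 != 0 -> b != 0 -> X != 0 ->
  exists x, [/\ ordinary x, grange r1 k1 r2 0 b x
   & 1 + b ^+ 2 / gpair r1 k1 r2 0 - b ^+ 2 / (gpair r1 k1 r2 0 ^+ 2 * X ^+ 2)
     <= line_coshsq r1 k1 r2 x].
Proof.
move=> h1 b0 X0.
have m0 := gpair_gt0 r1 r2 0 0 h1; rewrite expr0n addr0 in m0.
set m := gpair r1 k1 r2 0 in m0 *.
have mE : m = (r1 - r2) ^+ 2 + k1 ^+ 2.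
  by rewrite /m /gpair expr0n /= addr0.
have b2 : 0 < b ^+ 2 by rewrite exprn_even_gt0.
have k2 : 0 < k1 ^+ 2 by rewrite exprn_even_gt0.
have X2 : 0 < X ^+ 2 by rewrite exprn_even_gt0.
pose mu := m + b ^+ 2.
have mu0 : 0 < mu by rewrite addr_gt0.
pose Y := 1 - 2 * (r1 - r2) * X + m * X ^+ 2.
have YE : Y = (1 - (r1 - r2) * X) ^+ 2 + k1 ^+ 2 * X ^+ 2.
  by rewrite /Y mE; ring.
have mY : k1 ^+ 2 <= m * Y.
  rewrite -subr_ge0 /Y; have -> : m * (1 - 2 * (r1 - r2) * X + m * X ^+ 2) - k1 ^+ 2
    = (m * X - (r1 - r2)) ^+ 2 by rewrite mE; ring.
  exact: sqr_ge0.
have YX : k1 ^+ 2 * X ^+ 2 <= Y by rewrite YE lerDr sqr_ge0.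
have Y0 : 0 < Y by apply: lt_le_trans YX; rewrite mulr_gt0.
pose D := (mu * Y - k1 ^+ 2) / (b ^+ 2 * mu).
have DY : Y <= mu * D.
  have -> : mu * D = Y + (m * Y - k1 ^+ 2) / b ^+ 2.
    by rewrite /D /mu; field; rewrite b0 gt_eqF.
  by rewrite lerDl divr_ge0 ?subr_ge0// ltW.
have D0 : 0 < D by rewrite -(pmulr_rgt0 _ mu0); exact: lt_le_trans Y0 DY.
pose d := D + X ^+ 2; pose c := X + r2 * d; pose a := 1 + 2 * c * r2 - d * r2 ^+ 2.
have d0 : 0 < d by rewrite addr_gt0.
have delE : a * d - c ^+ 2 = D by rewrite /a /c /d; ring.
have g2E : gpol r2 0 a c d = 1 by rewrite /gpol /a; ring.
have g1E : gpol r1 k1 a c d = Y + m * D.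
  by rewrite /gpol /a /c /d /Y mE; ring.
have a0 : 0 < a.
  have : 0 < a * d by rewrite -[a * d](subrK (c ^+ 2)) delE ltr_wpDr ?sqr_ge0.
  by rewrite pmulr_lgt0.
have ad : 0 < a + d by rewrite addr_gt0.
have QE : conic r1 k1 r2 0 b a c d = 0.
  rewrite /conic g1E g2E delE -/m -/mu.
  have -> : Y = (b ^+ 2 * mu * D + k1 ^+ 2) / mu.
    by rewrite /D; field; rewrite b0 gt_eqF.
  by rewrite /mu; field; rewrite gt_eqF.
have Qge : 0 <= conic r1 k1 r2 0 b a c d by rewrite QE.
have [[e]|G] := conic_ge0_det b0 (ltW ad) Qge.
  by rewrite e ltxx in ad.
pose x : R * R := (2 * c / (a + d), (a - d) / (a + d)).
have Gx := grange_pt ad G; rewrite -/x in Gx.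
have dx : ga x * gd x - gc x ^+ 2 = D / (a + d) ^+ 2.
  rewrite ga_pt// gc_pt// gd_pt// -delE; field.
  by rewrite gt_eqF.
have ox : ordinary x.
  by apply/ordinary_gdet; rewrite dx divr_gt0// exprn_gt0.
exists x; split=> //.
rewrite /line_coshsq dx ga_pt// gc_pt// gd_pt// -/m.
have gZ r k : gpol r k (a / (a + d)) (c / (a + d)) (d / (a + d)) =
   gpol r k a c d / (a + d) by rewrite /gpol; field; rewrite gt_eqF.
rewrite !gZ g1E g2E.
have -> : (m * ((Y + m * D) / (a + d)) * (1 / (a + d)) - k1 ^+ 2 * (1 / (a + d)) ^+ 2) /
  (m ^+ 2 * (D / (a + d) ^+ 2)) = (m * Y + m ^+ 2 * D - k1 ^+ 2) / (m ^+ 2 * D).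
  by field; rewrite !gt_eqF.
have -> : (m * Y + m ^+ 2 * D - k1 ^+ 2) / (m ^+ 2 * D) =
  1 + b ^+ 2 / m - b ^+ 2 * k1 ^+ 2 / (m ^+ 2 * (mu * D)).
  have YD : Y = (b ^+ 2 * mu * D + k1 ^+ 2) / mu.
    by rewrite /D; field; rewrite b0 gt_eqF.
  rewrite YD /mu; field.
  by rewrite !gt_eqF.
rewrite lerD2l lerN2.
have -> : b ^+ 2 / (m ^+ 2 * X ^+ 2) = b ^+ 2 * k1 ^+ 2 / (m ^+ 2 * (k1 ^+ 2 * X ^+ 2)).
  by field; rewrite X0 h1 gt_eqF.
have bk : 0 < b ^+ 2 * k1 ^+ 2 by apply: mulr_gt0.
have m2 : 0 < m ^+ 2 by rewrite exprn_gt0.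
have kX : 0 < k1 ^+ 2 * X ^+ 2 by apply: mulr_gt0.
have mD : 0 < mu * D by apply: mulr_gt0.
rewrite (ler_pM2l bk) lef_pV2 ?posrE; [|exact: mulr_gt0|exact: mulr_gt0].
by rewrite (ler_pM2l m2) (le_trans YX).
Qed.

Lemma minor_semiaxis_parabolicP r1 k1 r2 b : k1 != 0 ->
  minor_semiaxis_parabolic (hp r1 k1) (hp r2 0) (grange r1 k1 r2 0 b)
    (semiaxis r1 k1 r2 0 b)%:E.
Proof.
move=> h1.
have m0 := gpair_gt0 r1 r2 0 0 h1; rewrite expr0n addr0 in m0.
have dE : semiaxis_denom r1 k1 r2 0 = gpair r1 k1 r2 0.
  by rewrite /semiaxis_denom normr0 !mulr0 addr0.
have bm : 0 <= b ^+ 2 / gpair r1 k1 r2 0 by rewrite divr_ge0 ?sqr_ge0 ?ltW.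
have sq1 x : ordinary x -> 1 <= Num.sqrt (line_coshsq r1 k1 r2 x).
  by move=> ox; rewrite -[leLHS]sqrtr1 ler_wsqrtr// line_coshsq_ge1.
exists (semiaxis r1 k1 r2 0 b); rewrite semiaxisE dE; split=> //.
  split; first by rewrite arcosh_ge0 ?sqrt1D_ge1.
  move=> x Gx ox; rewrite hdist_to_line// arcosh_le ?sqrt1D_ge1 ?sq1//.
  by rewrite ler_wsqrtr// parabolic_bound.
move=> r' [r0' hb].
have [b0|b0] := eqVneq b 0.
  by rewrite b0 expr0n /= mul0r addr0 sqrtr1 arcosh1.
have [K K1 KE] := arcosh_surj r0'; rewrite -KE in hb *.
rewrite arcosh_le ?sqrt1D_ge1// leNgt; apply/negP => lt.
have K2 : K ^+ 2 < 1 + b ^+ 2 / gpair r1 k1 r2 0.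
  rewrite -[ltRHS]sqr_sqrtr ?addr_ge0// ltr_sqr ?nnegrE ?sqrtr_ge0//; lra.
set m := gpair _ _ _ _ in m0 bm dE K2 lt *.
pose ep := 1 + b ^+ 2 / m - K ^+ 2.
have ep0 : 0 < ep by rewrite subr_gt0.
have b2 : 0 < b ^+ 2 by rewrite exprn_even_gt0.
pose z := b ^+ 2 / (m ^+ 2 * ep).
have z0 : 0 < z by rewrite divr_gt0// mulr_gt0// exprn_gt0.
have zX : z < (1 + z) ^+ 2 by have := sqr_ge0 z; lra.
have X0 : 1 + z != 0 by rewrite gt_eqF// addr_gt0.
have [x [ox Gx hx]] := parabolic_boundary r1 r2 h1 b0 X0.
have := hb x Gx ox; rewrite hdist_to_line// arcosh_le ?sq1//.
rewrite -(@ler_sqr R) ?nnegrE ?sqrtr_ge0//; last by lra.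
rewrite sqr_sqrtr; last by have := line_coshsq_ge1 m0 ox; lra.
move=> h; have := le_trans hx h; rewrite -/m => h2.
have : b ^+ 2 / (m ^+ 2 * (1 + z) ^+ 2) < ep.
  have z1 : 0 < 1 + z by rewrite addr_gt0.
  rewrite ltr_pdivrMr; last by apply: mulr_gt0; rewrite exprn_gt0.
  have -> : b ^+ 2 = z * (m ^+ 2 * ep) by rewrite /z; field; rewrite !gt_eqF.
  have -> : ep * (m ^+ 2 * (1 + z) ^+ 2) = (1 + z) ^+ 2 * (m ^+ 2 * ep) by ring.
  by rewrite ltr_pM2r// mulr_gt0// exprn_gt0.
by rewrite /ep; lra.
Qed.
End MinorSemiaxis.

(** * The boundary of the cone *)

Section ConeBoundary.
Variable R : realType.
Implicit Types r k b a c d p q s t : R.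

(** Move along the fibre until p q - s^2 - t^2, which tends to minus infinity,
    vanishes. *)
Lemma gram_cone_rank1 r1 k1 r2 k2 b a c d : gram_cone r1 k1 r2 k2 b a c d ->
  exists p q s t, [/\ 0 <= p, 0 <= q, s ^+ 2 + t ^+ 2 = p * q
    & [/\ a = (r1 ^+ 2 + k1 ^+ 2) * p + (r2 ^+ 2 + k2 ^+ 2 + b ^+ 2) * q
            + 2 * b * (r1 * s - k1 * t),
          c = r1 * p + r2 * q + b * s
        & d = p + q]].
Proof.
move=> [p [q [s [t [p0 q0 st [aE cE dE]]]]]].
have pq0 : 0 <= p * q by rewrite mulr_ge0.
have [b0|b0] := eqVneq b 0.
  exists p, q, (Num.sqrt (p * q)), 0; split=> //.
    by rewrite sqr_sqrtr// expr0n addr0.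
  by rewrite aE cE dE b0; split; ring.
set mu := gpair r1 k1 r2 k2 + b ^+ 2.
set N := mu ^+ 2 - 4 * k1 ^+ 2 * k2 ^+ 2.
have N0 : 0 < N by rewrite subr_gt0 gpair_sqr_gt.
set L := b * k1 * (q - p) + 2 * k1 * (r1 - r2) * s - t * (2 * k1 ^+ 2 - mu).
set e := p * q - (s ^+ 2 + t ^+ 2).
have e0 : 0 <= e by rewrite subr_ge0.
set y := Num.sqrt (L ^+ 2 + N * e).
have y2 : y ^+ 2 = L ^+ 2 + N * e.
  by rewrite sqr_sqrtr// addr_ge0 ?sqr_ge0// mulr_ge0// ltW.
pose x := (L + y) / N.
have xE : e + 2 * x * L - x ^+ 2 * N = 0.
  have -> : e = (y ^+ 2 - L ^+ 2) / N.
    by rewrite y2 addrAC subrr add0r mulrC mulKf// gt_eqF.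
  by rewrite /x; field; rewrite gt_eqF.
pose p' := p + 2 * b * k1 * x; pose q' := q - 2 * b * k1 * x.
pose s' := s - 2 * k1 * (r1 - r2) * x; pose t' := t + (2 * k1 ^+ 2 - mu) * x.
have st' : s' ^+ 2 + t' ^+ 2 = p' * q'.
  apply/esym/eqP; rewrite -subr_eq0 -xE; apply/eqP.
  by rewrite /p' /q' /s' /t' /e /L /N /mu /gpair; ring.
have dE' : d = p' + q' by rewrite dE /p' /q'; ring.
have [] := @sum_prod_ge0 _ p' q'.
- by rewrite -dE' dE addr_ge0.
- by rewrite -st' addr_ge0 ?sqr_ge0.
move=> p0' q0'; exists p', q', s', t'; split=> //; split=> //.
- by rewrite aE /p' /q' /s' /t' /mu /gpair; ring.
- by rewrite cE /p' /q' /s' /t'; ring.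
Qed.
End ConeBoundary.

(** * Real and imaginary parts *)

Section ComplexParts.
Variable R : realType.
Implicit Types z w : R[i].
Local Notation Re := complex.Re.
Local Notation Im := complex.Im.

Lemma ReD z w : Re (z + w) = Re z + Re w. Proof. by case: z w => ? ? []. Qed.
Lemma ImD z w : Im (z + w) = Im z + Im w. Proof. by case: z w => ? ? []. Qed.
Lemma ReN z : Re (- z) = - Re z. Proof. by case: z. Qed.
Lemma ImN z : Im (- z) = - Im z. Proof. by case: z. Qed.
Lemma ReM z w : Re (z * w) = Re z * Re w - Im z * Im w.
Proof. by case: z w => ? ? []. Qed.
Lemma ImM z w : Im (z * w) = Re z * Im w + Im z * Re w.
Proof. by case: z w => ? ? []. Qed.
Lemma ReJ z : Re (Num.conj z) = Re z. Proof. by case: z. Qed.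
Lemma ImJ z : Im (Num.conj z) = - Im z. Proof. by case: z. Qed.
Lemma complexP z w : Re z = Re w -> Im z = Im w -> z = w.
Proof. by case: z w => ? ? [? ?] /= -> ->. Qed.
Lemma cabs_sqr z : cabs z ^+ 2 = Re z ^+ 2 + Im z ^+ 2.
Proof.
by case: z => x y; rewrite /cabs /= sqr_sqrtr// addr_ge0 ?sqr_ge0.
Qed.
Lemma cabsM z w : cabs (z * w) = cabs z * cabs w.
Proof. exact: ComplexField.Normc.normcM. Qed.
Lemma cabsE z : cabs z = Num.sqrt (Re z ^+ 2 + Im z ^+ 2).
Proof. by case: z. Qed.

Lemma hpointE z : hpoint z = hp (Re z) (Im z).
Proof. by rewrite /hpoint /hp cabs_sqr. Qed.
End ComplexParts.

(** * Triangular form, traces and the range *)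

Section LinearAlgebra.
Variables (R : realType) (V : vectType R[i]) (form : {dot V for Num.conj}).
Implicit Types (A B f : 'End(V)) (x y e : V) (l z w : R[i]).
Local Notation Re := complex.Re.
Local Notation Im := complex.Im.

Definition orthonormal_basis e1 e2 : Prop :=
  [/\ form e1 e1 = 1, form e2 e2 = 1, form e1 e2 = 0
    & forall x, x = form x e1 *: e1 + form x e2 *: e2].

Lemma formC x y : form x y = Num.conj (form y x).
Proof. by rewrite hermC expr0 mul1r. Qed.

Lemma form_basis e1 e2 : orthonormal_basis e1 e2 -> forall x1 x2 y1 y2 : R[i],
  form (x1 *: e1 + x2 *: e2) (y1 *: e1 + y2 *: e2) =
  x1 * Num.conj y1 + x2 * Num.conj y2.
Proof.
move=> [h1 h2 h3 _] x1 x2 y1 y2.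
have h4 : form e2 e1 = 0 by rewrite formC h3 conjC0.
rewrite linearDl !linearDr !linearZl_LR !linearZr_LR /= h1 h2 h3 h4.
by rewrite !mulr1 !mulr0 !scaler0 addr0 add0r mulrC [x2 * _]mulrC.
Qed.

(** Expanding f in the orthonormal basis and its argument in the fixed basis
    exchanges the two sums, without a change of basis matrix. *)
Lemma tr_op_basis f e1 e2 : orthonormal_basis e1 e2 ->
  tr_op f = form (f e1) e1 + form (f e2) e2.
Proof.
move=> [_ _ _ H]; rewrite /tr_op /mx_of /mxtrace.
have vb := vbasisP (fullv : {vspace V}).
transitivity (\sum_i coord (vbasis {:V}) i (f (vbasis {:V})`_i)).
  by apply: eq_bigr => i _; rewrite !mxE /= passmx.vecof_delta.
transitivity (\sum_(i < \dim {:V}) (form (f (vbasis {:V})`_i) e1 * coord (vbasis {:V}) i e1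
   + form (f (vbasis {:V})`_i) e2 * coord (vbasis {:V}) i e2)).
  by apply: eq_bigr => i _; rewrite {1}[f _]H linearD !linearZ.
rewrite big_split /=.
have E e : \sum_(i < \dim {:V}) form (f (vbasis {:V})`_i) e * coord (vbasis {:V}) i e
   = form (f e) e.
  rewrite {3}(coord_basis vb (memvf e)) linear_sum linear_sumlz.
  by apply: eq_bigr => i _; rewrite linearZ linearZl_LR mulrC.
by rewrite !E.
Qed.

Lemma char_poly_size2 n (M : 'M[R[i]]_n) l1 l2 : n = 2%N ->
  char_poly M = ('X - l1%:P) * ('X - l2%:P) ->
  [/\ \tr M = l1 + l2, \det M = l1 * l2 & eigenvalue M l1].
Proof.
move=> n2; move: M; rewrite n2 => M h.
have hE : ('X - l1%:P) * ('X - l2%:P) = 'X ^+ 2 - (l1 + l2) *: 'X + (l1 * l2)%:P.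
  by rewrite -mul_polyC polyCD polyCM; ring.
split.
- have := @char_poly_trace _ _ M isT; rewrite h hE /=.
  rewrite !coefE /= !mulr1 !addr0 !sub0r => /eqP; rewrite eqr_opp => /eqP <- //.
- have := char_poly_det M; rewrite h coef0M !coefB !coefX !coefC /= !sub0r.
  by rewrite mulrNN sqrrN expr1n mul1r.
- by rewrite eigenvalue_root_char h rootM root_XsubC eqxx.
Qed.

Lemma eigenvector A l : eigenvalue (mx_of A) l ->
  exists2 x, x != 0 & A x = l *: x.
Proof.
move=> /eigenvalueP[v vM v0].
have vb := vbasisP (fullv : {vspace V}).
exists (passmx.vecof (vbasis {:V}) v); first by rewrite passmx.vecof_eq0.
rewrite (passmx.hom_vecof _ vb) -/(mx_of A) vM /passmx.vecof scaler_sumr.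
by apply: eq_bigr => i _; rewrite mxE scalerA.
Qed.

Lemma unit_vector x : x != 0 -> exists2 a, a != 0 & form (a *: x) (a *: x) = 1.
Proof.
move=> x0; have n0 : sqrtC (form x x) != 0 by rewrite sqrt_dnorm_eq0.
exists (sqrtC (form x x))^-1; first by rewrite invr_eq0.
rewrite dnormZ normfV exprVn ger0_norm ?sqrt_dnorm_ge0// sqrtCK mulVf//.
by rewrite dnorm_eq0.
Qed.

Lemma orthonormal_basis_ext e1 : \dim {:V} = 2%N -> form e1 e1 = 1 ->
  exists e2, orthonormal_basis e1 e2.
Proof.
move=> dim2 n1.
have [y yn] : exists y, y \notin <[e1]>%VS.
  have : ~~ ({:V} <= <[e1]>)%VS.
    apply/negP => /dimvS; rewrite dim2 dim_vline.
    by case: (e1 == 0).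
  by move=> /subvPn[y _ yn]; exists y.
pose z := y - form y e1 *: e1.
have z0 : z != 0.
  apply: contra yn; rewrite subr_eq0 => /eqP ->.
  by apply/vlineP; exists (form y e1).
have ze : form z e1 = 0 by rewrite /z linearBl linearZl_LR /= n1 mulr1 subrr.
have [a a0 n2] := unit_vector z0.
exists (a *: z).
have o12 : form e1 (a *: z) = 0.
  by rewrite formC linearZl_LR /= ze mulr0 conjC0.
have fr : free [:: e1; a *: z].
  by apply: (@orthonormal_free _ _ form); apply/orthonormal2P.
have bs : basis_of {:V} [:: e1; a *: z].
  by rewrite basisEfree fr subvf dim2.
split=> // x.
have xs : x \in <<[:: e1; a *: z]>>%VS.
  by rewrite (span_basis bs) memvf.
move: xs; rewrite span_cons span_seq1 => /memv_addP[u /vlineP[c1 ->] [w /vlineP[c2 ->] xE]].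
have e1x : form x e1 = c1.
  rewrite xE linearDl !linearZl_LR /= n1 mulr1.
  by rewrite ze !mulr0 addr0.
have e2x : form x (a *: z) = c2.
  rewrite xE linearDl [in X in X + _]linearZl_LR [in X in _ + X]linearZl_LR /=.
  by rewrite o12 n2 mulr1 mulr0 add0r.
by rewrite e1x e2x -xE.
Qed.

(** The second diagonal entry is the other eigenvalue because of the trace. *)
Lemma schur_basis A l1 l2 : \dim {:V} = 2%N -> eigenvalues2 A l1 l2 ->
  exists e1 e2, [/\ orthonormal_basis e1 e2, A e1 = l1 *: e1
    & form (A e2) e2 = l2].
Proof.
move=> dim2 /(char_poly_size2 dim2)[trA _ /eigenvector[x x0 Ax]].
have [a a0 n1] := unit_vector x0.
have [e2 E] := orthonormal_basis_ext dim2 n1.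
have Ae1 : A (a *: x) = l1 *: (a *: x) by rewrite linearZ /= Ax !scalerA mulrC.
exists (a *: x), e2; split=> //.
have := tr_op_basis A E; rewrite /tr_op trA Ae1.
by rewrite linearZl_LR /= n1 mulr1 => /addrI ->.
Qed.

Lemma sqnorm_basis e1 e2 : orthonormal_basis e1 e2 -> forall x1 x2 : R[i],
  sqnorm form (x1 *: e1 + x2 *: e2) =
  Re x1 ^+ 2 + Im x1 ^+ 2 + (Re x2 ^+ 2 + Im x2 ^+ 2).
Proof.
move=> E x1 x2; rewrite /sqnorm (form_basis E) ReD !ReM !ReJ !ImJ; ring.
Qed.

Section TriangularOperator.
Variables (A : 'End(V)) (l1 l2 : R[i]) (e1 e2 : V).
Hypotheses (E : orthonormal_basis e1 e2) (Ae1 : A e1 = l1 *: e1).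
Hypothesis (Ae2 : form (A e2) e2 = l2).
Let be := form (A e2) e1.
Let b := cabs be.

Lemma triangular_apply (x1 x2 : R[i]) :
  A (x1 *: e1 + x2 *: e2) = (l1 * x1 + be * x2) *: e1 + (l2 * x2) *: e2.
Proof.
have [_ _ _ H] := E.
rewrite linearD !linearZ /= Ae1 [A e2]H Ae2 -/be scalerDr !scalerA addrA -scalerDl.
by rewrite [x1 * _]mulrC [x2 * be]mulrC [x2 * _]mulrC.
Qed.

(** zr + i zi is x1 times the conjugate of be x2, that is, b times the entry
    s + i t of [gram_cone] up to a phase. *)
Lemma gram_of_vector (x1 x2 : R[i]) :
  let x := x1 *: e1 + x2 *: e2 in let y := A x in
  let zr := Re (be * x2) * Re x1 + Im (be * x2) * Im x1 in
  let zi := Re (be * x2) * Im x1 - Im (be * x2) * Re x1 in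
  let p := Re x1 ^+ 2 + Im x1 ^+ 2 in let q := Re x2 ^+ 2 + Im x2 ^+ 2 in
  [/\ sqnorm form y = (Re l1 ^+ 2 + Im l1 ^+ 2) * p
          + (Re l2 ^+ 2 + Im l2 ^+ 2 + b ^+ 2) * q
          + 2 * (Re l1 * zr - Im l1 * zi),
      Re (form y x) = Re l1 * p + Re l2 * q + zr,
      sqnorm form x = p + q
    & zr ^+ 2 + zi ^+ 2 = b ^+ 2 * (p * q)].
Proof.
move=> x y zr zi p q; rewrite /y /x triangular_apply !(sqnorm_basis E) (form_basis E).
rewrite /b cabs_sqr /zr /zi /p /q !(ReD, ImD, ReM, ImM, ReJ, ImJ).
by split=> //; ring.
Qed.

Lemma sqnorm_gt0 x : x != 0 -> 0 < sqnorm form x.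
Proof.
move=> x0; have : 0 < form x x by rewrite dnorm_gt0.
by rewrite /sqnorm ltcE => /andP[].
Qed.

(** The phase of the off-diagonal entry is absorbed in x1. *)
Lemma DW_grange : DW form A = grange (Re l1) (Im l1) (Re l2) (Im l2) b.
Proof.
have [n1 n2 o12 H] := E.
apply/seteqP; split=> v.
  move=> [x [x0 ->]] /=; have xE := H x.
  have := gram_of_vector (form x e1) (form x e2); rewrite -xE /=.
  set zr := Re (be * _) * Re _ + _; set zi := Re (be * _) * Im _ - _.
  set p := Re (form x e1) ^+ 2 + _; set q := Re (form x e2) ^+ 2 + _.
  move=> [yE cE xxE zE].
  apply: grange_pt.
    by rewrite ltr_wpDl ?sqnorm_gt0// /sqnorm; have := dnorm_ge0 form (A x);
       rewrite lecE => /andP[].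
  exists p, q, (zr / b), (zi / b).
  have p0 : 0 <= p by rewrite addr_ge0 ?sqr_ge0.
  have q0 : 0 <= q by rewrite addr_ge0 ?sqr_ge0.
  have [b0|b0] := eqVneq b 0.
    have [zr0 zi0] : zr = 0 /\ zi = 0.
      move: zE; rewrite b0 expr0n mul0r => /eqP.
      rewrite paddr_eq0 ?sqr_ge0// !expf_eq0 /= => /andP[/eqP h1 /eqP h2].
      by split; [exact: h1|exact: h2].
    rewrite zr0 zi0 mul0r; split=> //.
      by rewrite expr0n addr0 mulr_ge0.
    by rewrite yE cE xxE zr0 zi0; split; ring.
  split=> //.
    by rewrite !expr_div_n -mulrDl zE mulrC mulKf// expf_neq0.
  by rewrite yE cE xxE; split=> //; field.
move=> /gram_cone_rank1[p [q [s [t [p0 q0 st [aE cE dE]]]]]].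
pose u : R[i] := if b == 0 then 1 else be / (b +i* 0)%C.
have uE : Re u ^+ 2 + Im u ^+ 2 = 1 /\
    (Re be * Re u + Im be * Im u = b /\ Re be * Im u - Im be * Re u = 0).
  rewrite /u; case: eqP => [b0|/eqP b0].
    have := cabs_sqr be; rewrite -/b b0 expr0n => /esym/eqP.
    rewrite paddr_eq0 ?sqr_ge0// !expf_eq0 /= => /andP[/eqP-> /eqP->].
    by rewrite /= !mul0r; split; [ring|split; ring].
  have e : Re be ^+ 2 + Im be ^+ 2 = b ^+ 2 by rewrite -cabs_sqr.
  have -> : be / (b +i* 0)%C = (Re be / b +i* (Im be / b))%C.
    apply: (mulIf (_ : (b +i* 0)%C != 0)).
      by apply/eqP => -[/eqP]; rewrite (negPf b0).
    rewrite divfK; last by apply/eqP => -[/eqP]; rewrite (negPf b0).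
    by apply: complexP; rewrite /=; field.
  rewrite /=; split.
    by rewrite !expr_div_n -mulrDl e divff// expf_neq0.
  split; last by field.
  rewrite !mulrA -mulrDl -!expr2 e expr2 mulfK//.
have [u1 [u2 u3]] := uE.
(* x1 e1 + x2 e2 is to have p, q, s, t as the entries of its rank one matrix. *)
suff [x1 [x2 [x1E x2E zrE ziE]]] : exists x1 x2 : R[i],
  [/\ Re x1 ^+ 2 + Im x1 ^+ 2 = p, Re x2 ^+ 2 + Im x2 ^+ 2 = q,
   Re (be * x2) * Re x1 + Im (be * x2) * Im x1 = b * s
   & Re (be * x2) * Im x1 - Im (be * x2) * Re x1 = b * t].
  have := gram_of_vector x1 x2; rewrite /= x1E x2E zrE ziE => -[yE xyE xxE _].
  set x := x1 *: e1 + x2 *: e2 in yE xyE xxE.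
  have yE' : sqnorm form (A x) = ga v by rewrite yE aE; ring.
  have xyE' : Re (form (A x) x) = gc v by rewrite xyE cE.
  have xxE' : sqnorm form x = gd v by rewrite xxE dE.
  have d0 : gd v != 0.
    apply/negP => /eqP d0; move: (gaDgd v); rewrite d0 addr0 => a1.
    move: dE; rewrite d0 => /esym/eqP; rewrite paddr_eq0//.
    move=> /andP[/eqP p00 /eqP q00].
    move: st; rewrite p00 mul0r => /eqP.
    rewrite paddr_eq0 ?sqr_ge0// !expf_eq0 /= => /andP[/eqP s0 /eqP t0].
    move: aE; rewrite a1 p00 q00 s0 t0 !mulr0 subr0 mulr0 !addr0 => /eqP.
    by rewrite oner_eq0.
  exists x; split.
    apply/negP => /eqP x0; move: d0; rewrite -xxE' x0 /sqnorm linear0r.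
    by rewrite eqxx.
  rewrite /= yE' xyE' xxE' gaDgd !divr1 /ga /gc /gd.
  by case: (v) => v1 v2 /=; congr pair; field.
have [q00|q00] := eqVneq q 0.
  move: st; rewrite q00 mulr0 => /eqP.
  rewrite paddr_eq0 ?sqr_ge0// !expf_eq0 /= => /andP[/eqP s0 /eqP t0].
  exists (Num.sqrt p +i* 0)%C, 0; rewrite mulr0 /= s0 t0 !mul0r mulr0.
  by split; rewrite ?sqr_sqrtr ?expr0n ?addr0 ?subrr.
have qp : 0 < q by rewrite lt0r q00.
have sq : Num.sqrt q != 0 by rewrite gt_eqF// sqrtr_gt0.
have sq2 : Num.sqrt q ^+ 2 = q by rewrite sqr_sqrtr.
exists (u * (s / Num.sqrt q +i* (t / Num.sqrt q))%C), (Num.sqrt q +i* 0)%C.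
rewrite !(ReM, ImM) /=; split.
- have -> : (Re u * (s / Num.sqrt q) - Im u * (t / Num.sqrt q)) ^+ 2 +
    (Re u * (t / Num.sqrt q) + Im u * (s / Num.sqrt q)) ^+ 2 =
    (Re u ^+ 2 + Im u ^+ 2) * ((s ^+ 2 + t ^+ 2) / Num.sqrt q ^+ 2) by field.
  by rewrite u1 mul1r sq2 st mulfK.
- by rewrite expr0n addr0.
- transitivity ((Re be * Re u + Im be * Im u) * s - (Re be * Im u - Im be * Re u) * t).
    by field.
  by rewrite u2 u3 mul0r subr0.
- transitivity ((Re be * Re u + Im be * Im u) * t + (Re be * Im u - Im be * Re u) * s).
    by field.
  by rewrite u2 u3 mul0r addr0.
Qed.

Variable Astar : 'End(V).
Hypothesis adj : is_adjoint form A Astar.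

Lemma tr_adjoint : Re (tr_op (Astar \o A)%VF) =
  Re l1 ^+ 2 + Im l1 ^+ 2 + (Re l2 ^+ 2 + Im l2 ^+ 2) + b ^+ 2.
Proof.
rewrite (tr_op_basis _ E) !comp_lfunE.
have F x : form (Astar (A x)) x = form (A x) (A x).
  by rewrite formC -adj -formC.
have A1 : A e1 = l1 *: e1 + 0 *: e2 by rewrite Ae1 scale0r addr0.
have A2 : A e2 = be *: e1 + l2 *: e2.
  by have [_ _ _ H] := E; rewrite [LHS]H Ae2.
rewrite !F ReD -/(sqnorm form (A e1)) -/(sqnorm form (A e2)) A1 A2.
by rewrite !(sqnorm_basis E) /= /b cabs_sqr; ring.
Qed.

(** For normal A the vectors A e1 and Astar e1 have the same norm, and be is a
    coordinate of the second one only. *)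
Lemma normal_offdiag : (A \o Astar)%VF = (Astar \o A)%VF -> b = 0.
Proof.
move=> com; have [n1 n2 o12 H] := E.
have s1 : Astar e1 = Num.conj l1 *: e1 + Num.conj be *: e2.
  rewrite {1}[Astar e1]H; congr (_ *: _ + _ *: _).
    by rewrite formC -adj Ae1 linearZl_LR /= n1 mulr1.
  by rewrite formC -adj.
have : sqnorm form (A e1) = sqnorm form (Astar e1).
  have h : form (A e1) (A e1) = form (Astar e1) (Astar e1).
    have -> : form (A e1) (A e1) = form e1 (Astar (A e1)) by rewrite adj.
    have -> : Astar (A e1) = A (Astar e1).
      by rewrite -comp_lfunE -com comp_lfunE.
    by rewrite [LHS]formC adj -formC.
  by rewrite /sqnorm h.
have A1 : A e1 = l1 *: e1 + 0 *: e2 by rewrite Ae1 scale0r addr0.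
rewrite A1 s1 !(sqnorm_basis E) !ReJ !ImJ /= !sqrrN expr0n /= !addr0.
move=> h; have : cabs be ^+ 2 = 0 by rewrite cabs_sqr; lra.
by move=> /eqP; rewrite expf_eq0 /= => /eqP.
Qed.

Lemma scalar_normal : l1 = l2 -> b = 0 -> (A \o Astar)%VF = (Astar \o A)%VF.
Proof.
move=> l12 b0; have [n1 n2 o12 H] := E.
have be0 : be = 0 by apply: ComplexField.Normc.eq0_normc.
have AE x : A x = l1 *: x.
  rewrite [in LHS](H x) triangular_apply be0 mul0r addr0 -l12 -!scalerA -scalerDr.
  by rewrite -H.
by apply/lfunP => x; rewrite !comp_lfunE !AE linearZ.
Qed.
End TriangularOperator.
End LinearAlgebra.

(** * The closed forms of the minor semi-axis *)

Section ClosedForms.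
Variables (R : realType) (V : vectType R[i]) (form : {dot V for Num.conj}).
Variables (A Astar : 'End(V)) (l1 l2 : R[i]) (e1 e2 : V).
Hypotheses (dim2 : \dim {:V} = 2%N) (eig : eigenvalues2 A l1 l2).
Hypotheses (adj : is_adjoint form A Astar).
Hypotheses (E : orthonormal_basis form e1 e2) (Ae1 : A e1 = l1 *: e1).
Hypothesis (Ae2 : form (A e2) e2 = l2).
Local Notation Re := complex.Re.
Local Notation Im := complex.Im.
Let b := cabs (form (A e2) e1).

Let D_ofE : D_of A = - ((l1 - l2) / 2 * ((l1 - l2) / 2)).
Proof.
have [trA detA _] := char_poly_size2 dim2 eig.
by rewrite /D_of /tr_op /det_op trA detA; field.
Qed.

Let half_diff : Re ((l1 - l2) / 2) = (Re l1 - Re l2) / 2 /\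
  Im ((l1 - l2) / 2) = (Im l1 - Im l2) / 2.
Proof.
have -> : (l1 - l2) / 2 = ((Re l1 - Re l2) / 2 +i* ((Im l1 - Im l2) / 2))%C.
  apply: (mulIf (_ : (2 : R[i]) != 0)); first by rewrite pnatr_eq0.
  rewrite divfK ?pnatr_eq0//.
  by apply: complexP; rewrite !(ReM, ImM, ReD, ImD, ReN, ImN) /=; field.
by [].
Qed.

Let cabs_D : cabs (D_of A) =
  ((Re l1 - Re l2) ^+ 2 + (Im l1 - Im l2) ^+ 2) / 4.
Proof.
have [h1 h2] := half_diff.
rewrite D_ofE -mulNr cabsM.
have -> : cabs (- ((l1 - l2) / 2)) = cabs ((l1 - l2) / 2).
  by rewrite !cabsE ReN ImN !sqrrN.
by rewrite -expr2 cabs_sqr h1 h2; field.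
Qed.

Let Re_D : Re (D_of A) =
  - ((Re l1 - Re l2) ^+ 2 - (Im l1 - Im l2) ^+ 2) / 4.
Proof.
have [h1 h2] := half_diff.
by rewrite D_ofE ReN ReM h1 h2; field.
Qed.

Lemma discriminant_gap : U_of A Astar - cabs (D_of A) = b ^+ 2 / 2.
Proof.
have [trA _ _] := char_poly_size2 dim2 eig.
rewrite /U_of (tr_adjoint E Ae1 Ae2 adj) -/b cabs_D cabs_sqr /tr_op trA ReD ImD.
by field.
Qed.

(** |l1 - l2|^2 and |l1 - conj l2|^2 differ by 4 Im l1 Im l2. *)
Lemma max_E_D : Num.max (E_of A) (cabs (D_of A)) =
  semiaxis_denom (Re l1) (Im l1) (Re l2) (Im l2) / 4.
Proof.
have [trA _ _] := char_poly_size2 dim2 eig.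
have EE : E_of A = ((Re l1 - Re l2) ^+ 2 + (Im l1 + Im l2) ^+ 2) / 4.
  by rewrite /E_of cabs_D Re_D /tr_op trA ImD; field.
rewrite EE cabs_D /semiaxis_denom /gpair -normrM.
have [h|h] := leP 0 (Im l1 * Im l2).
  rewrite max_l ?ger0_norm//; first by field.
  by rewrite ler_pM2r ?invr_gt0// lerD2l; lra.
rewrite max_r; first by rewrite (ltr0_norm h); field.
by rewrite ler_pM2r ?invr_gt0// lerD2l; lra.
Qed.

Lemma semiaxis_closed_forms :
  0 < semiaxis_denom (Re l1) (Im l1) (Re l2) (Im l2) ->
  s_arcosh A Astar = (semiaxis (Re l1) (Im l1) (Re l2) (Im l2) b)%:E /\
  s_arsinh A Astar = (semiaxis (Re l1) (Im l1) (Re l2) (Im l2) b)%:E.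
Proof.
move=> M0; rewrite /s_arcosh /s_arsinh discriminant_gap max_E_D.
rewrite [in X in _ /\ X]semiaxisE /semiaxis.
set M := semiaxis_denom _ _ _ _ in M0 *.
have M40 : M / 4 != 0 by rewrite gt_eqF// divr_gt0.
have M20 : 2 * (M / 4) != 0 by rewrite mulf_neq0// pnatr_eq0.
rewrite !inver (negPf M40) (negPf M20) /=; split; congr (_%:E).
  by congr (_ * arcosh (_ + _)); field; rewrite gt_eqF.
have -> : b ^+ 2 / 2 / (2 * (M / 4)) = b ^+ 2 / M by field; rewrite gt_eqF.
by rewrite arsinh_arcosh// divr_ge0 ?sqr_ge0// ltW.
Qed.

Lemma degenerate_closed_forms :
  semiaxis_denom (Re l1) (Im l1) (Re l2) (Im l2) = 0 ->
  s_arcosh A Astar = (if b == 0 then 0%E else +oo%E) /\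
  s_arsinh A Astar = (if b == 0 then 0%E else +oo%E).
Proof.
move=> M0; rewrite /s_arcosh /s_arsinh discriminant_gap max_E_D M0 mul0r mulr0.
rewrite inve0; case: eqP => [->|/eqP b0].
  rewrite expr0n /= mul0r mul0e adde0 /= arcosh1 sqrtr0.
  by rewrite -EFinM mulr0 /arsinh expr0n /= !add0r sqrtr1 ln1.
have b2 : 0 < b ^+ 2 / 2 by rewrite divr_gt0// exprn_even_gt0.
rewrite gt0_muley ?lte_fin// addey//=; split=> //.
by rewrite gt0_muley// lte_fin invr_gt0.
Qed.
End ClosedForms.

Theorem theorem2p6 (R : realType) (V : vectType R[i])
    (form : {dot V for Num.conj}) (A Astar : 'End(V)) (l1 l2 : R[i]) :
  \dim {:V} = 2%N ->
  is_adjoint form A Astar ->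
  eigenvalues2 A l1 l2 ->
  [/\ (* no real eigenvalue *)
      ~~ isreal l1 -> ~~ isreal l2 ->
        is_elliptical_disk (DW form A) (hpoint l1) (hpoint l2),
      (* one real eigenvalue *)
      ~~ isreal l1 -> isreal l2 ->
        is_elliptic_parabolic_disk (DW form A) (hpoint l1) (hpoint l2),
      (* foci *)
      foci (DW form A) = [set hpoint l1; hpoint l2],
      (* no double real eigenvalue *)
      ~ (l1 = l2 /\ isreal l1) ->
        minor_semiaxis l1 l2 (DW form A) (s_arcosh A Astar) /\
        s_arcosh A Astar = s_arsinh A Astar
    & (* double real eigenvalue *)
      l1 = l2 -> isreal l1 ->
        minor_semiaxis l1 l2 (DW form A) (s_arcosh A Astar) /\
        ((A \o Astar)%VF = (Astar \o A)%VF ->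
           s_arcosh A Astar = 0%E /\ s_arsinh A Astar = 0%E) /\
        ((A \o Astar)%VF <> (Astar \o A)%VF ->
           s_arcosh A Astar = +oo%E /\ s_arsinh A Astar = +oo%E)].
Proof.
move=> dim2 adj eig.
have [e1 [e2 [E Ae1 Ae2]]] := schur_basis form dim2 eig.
rewrite (DW_grange E Ae1 Ae2) !hpointE.
set b := cabs _.
split.
- exact: grange_is_elliptical.
- by move=> h1 /eqP ->; exact: grange_is_parabolic.
- exact: foci_grange.
- move=> ndouble.
  have M0 : 0 < semiaxis_denom (complex.Re l1) (complex.Im l1)
                               (complex.Re l2) (complex.Im l2).
    rewrite lt0r semiaxis_denom_ge0 andbT; apply/negP => /eqP M0.
    apply: ndouble; move: M0; rewrite /semiaxis_denom /gpair => /eqP.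
    rewrite paddr_eq0 ?gpair_ge0 ?mulr_ge0// paddr_eq0 ?addr_ge0 ?sqr_ge0//.
    rewrite paddr_eq0 ?sqr_ge0// !expf_eq0 /= subr_eq0.
    move=> /andP[/andP[/andP[/eqP rr /eqP i1] /eqP i2] _].
    by split; [apply: complexP; rewrite ?i1|rewrite /isreal i1].
  have [-> ->] := semiaxis_closed_forms dim2 eig adj E Ae1 Ae2 M0.
  split=> //; rewrite /minor_semiaxis !hpointE -/b /isreal.
  have [i1|i1] := eqVneq (complex.Im l1) 0; have [i2|i2] := eqVneq (complex.Im l2) 0.
  + rewrite /=; case: eqP => [l12|l12].
      by case: ndouble; rewrite /isreal i1.
    rewrite i1 i2; apply: minor_semiaxis_lineP.
    by apply/eqP => rr; apply: l12; apply: complexP; rewrite ?i1.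
  + rewrite /= i1 grangeC semiaxisC /minor_semiaxis_parabolic hlineC.
    exact: minor_semiaxis_parabolicP.
  + rewrite /= i2; exact: minor_semiaxis_parabolicP.
  + exact: minor_semiaxis_ellipticalP.
- move=> l12 re1; have i1 : complex.Im l1 = 0 by apply/eqP.
  have M0 : semiaxis_denom (complex.Re l1) (complex.Im l1)
                           (complex.Re l2) (complex.Im l2) = 0.
    rewrite -l12 i1 /semiaxis_denom /gpair subrr normr0 expr0n /=.
    by rewrite !mulr0 !addr0.
  have [-> ->] := degenerate_closed_forms dim2 eig adj E Ae1 Ae2 M0.
  rewrite -/b; split.
    rewrite /minor_semiaxis -l12 re1 eqxx /= i1.
    by have [s hs <-] := minor_semiaxis_doubleP (complex.Re l1) b.
  split=> com.
    have b0 : b = 0 := normal_offdiag E Ae1 adj com.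
    by rewrite b0 eqxx.
  have [b0|//] := eqVneq b 0.
  by case: com; apply: (scalar_normal E Ae1 Ae2).
Qed.
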